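(* With $X$, $\Sigma$, $\nu^I_i$, $\nu^{II}_i$ as in the context: (1) For distinct points $P_1,P_2\in X\setminus\{\infty\}$, the one-form $\Pi_{P_1}^{P_2}(P):=\Sigma(P,P_1)-\Sigma(P,P_2)$ (in the variable $P$) is a differential of the third kind on $X$ whose only poles are at $P=P_1$ and $P=P_2$; they are of first order, with residues $+1$ and $-1$ respectively. (2) The form $$\Omega(P_1,P_2):=d_{P_2}\Sigma(P_1,P_2)+\sum_{i=1}^g\nu^I_i(P_1)\otimes\nu^{II}_i(P_2)$$ is a fundamental differential of the second kind on $X\times X$: it is symmetric, $\Omega(P_1,P_2)=\Omega(P_2,P_1)$; its only pole is along the diagonal, of second order; and in terms of a local coordinate $t$, as $P_1\to P_2$, $$\Omega(P_1,P_2)=\left(\frac{1}{(t_{P_1}-t_{P_2})^2}+(\text{regular power series})\right)dt_{P_1}\otimes dt_{P_2}.$$ Moreover it has the form $$\Omega(P_1,P_2)=\frac{F(P_1,P_2)\,dx_1\otimes dx_2}{9(x_1-x_2)^2\,y_{\hat r,P_1}y_{\hat s,P_1}y_{\hat r,P_2}y_{\hat s,P_2}}\qquad\text{with } F\in R\otimes_{\mathbb{C}} R .$$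
   Context: Let $r,s$ be integers with $0<r<s$ and $r\not\equiv s \pmod 3$. Put $\hat r=2r+s$, $\hat s=2s+r$ and $g=r+s-1$. Let $b_1,\dots,b_{r+s}\in\mathbb{C}$ be pairwise distinct, $k_s(x)=\prod_{i=1}^{s}(x-b_i)$, $k_r(x)=\prod_{i=s+1}^{s+r}(x-b_i)$, and $$R=\mathbb{C}[x,y_{\hat r},y_{\hat s}]/\bigl(y_{\hat r}^2-y_{\hat s}k_r(x),\ y_{\hat r}y_{\hat s}-k_r(x)k_s(x),\ y_{\hat s}^2-y_{\hat r}k_s(x)\bigr).$$ $\mathrm{Spec}\,R$ is a non-singular affine curve; $X$ denotes the compact Riemann surface (of genus $g$) obtained by adding one point $\infty$. The functions $x,y_{\hat r},y_{\hat s}$ have poles only at $\infty$, of orders $3,\hat r,\hat s$. For a point $P$ write $x_P,y_{\hat r,P},y_{\hat s,P}$ for its coordinates (and $x_i=x_{P_i}$). Let $\widehat R\subset R$ be the subspace of $f\in R$ vanishing at all points $B_i=(x=b_i,y_{\hat r}=0,y_{\hat s}=0)$, $i=1,\dots,r+s$. It has the basis of monomials $x^ay_{\hat r}$, $x^ay_{\hat s}$, $x^ay_{\hat r}y_{\hat s}$ ($a\ge0$), with pairwise distinct pole orders at $\infty$; $\hat\phi_0,\hat\phi_1,\dots$ is this basis ordered by increasing pole order. Put $\nu^I_i=\hat\phi_{i-1}dx/(3y_{\hat r}y_{\hat s})$, $i=1,\dots,g$; these form a basis of the holomorphic differentials on $X$. Define $$\Sigma(P,Q):=\frac{y_{\hat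 r,P}y_{\hat s,P}+y_{\hat r,P}y_{\hat s,Q}+y_{\hat r,Q}y_{\hat s,P}}{3(x_P-x_Q)\,y_{\hat r,P}y_{\hat s,P}}\,dx_P,$$ $$d_Q\Sigma(P,Q):=dx_P\otimes dx_Q\,\frac{\partial}{\partial x_Q}\left(\frac{y_{\hat r,P}y_{\hat s,P}+y_{\hat r,P}y_{\hat s,Q}+y_{\hat r,Q}y_{\hat s,P}}{3(x_P-x_Q)\,y_{\hat r,P}y_{\hat s,P}}\right),$$ where $\partial/\partial x_Q$ denotes differentiation on $X$ in the variable $Q$ with respect to $x_Q$. In tensor products of one-forms in $P$ and $Q$ the order of the factors is immaterial. $\nu^{II}_1,\dots,\nu^{II}_g$ are differentials of the second kind on $X$ whose only pole is at $\infty$ and which satisfy $$d_Q\Sigma(P,Q)-d_P\Sigma(Q,P)=\sum_{i=1}^g\bigl(\nu^I_i(Q)\otimes\nu^{II}_i(P)-\nu^I_i(P)\otimes\nu^{II}_i(Q)\bigr)$$ (such differentials exist). *)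

(* Defs.v *)
From HB Require Import structures.
From mathcomp Require Import all_boot all_order all_algebra.
From mathcomp Require Import complex.
From mathcomp Require Import all_classical all_reals all_analysis.

Set Implicit Arguments.
Unset Strict Implicit.
Unset Printing Implicit Defensive.

Import Order.TTheory GRing.Theory Num.Theory numFieldNormedType.Exports.

Local Open Scope classical_set_scope.
Local Open Scope ring_scope.

(** Definitions are for a [numFieldType] [K]; the case of interest is
    [K := R[i]], the complex numbers over a [realType] [R]. *)

Definition analytic_at0 (K : numFieldType) (f : K -> K) : Prop :=
  exists a : nat -> K, \forall t \near (0 : K),
    [series a i * t ^+ i]_i @ \oo --> f t.

(* The geometric bound makes the double series absolutely convergent near
   (0, 0), so that summing it along squares is harmless. *)
Definition analytic2_at0 (K : numFieldType) (h : K * K -> K) : Prop :=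
  exists a : nat -> nat -> K,
    (exists rho M : K, 0 < rho /\
      forall i j : nat, `|a i j| * rho ^+ (i + j) <= M) /\
    \forall z \near ((0, 0) : K * K),
      (\sum_(i < n) \sum_(j < n) a i j * z.1 ^+ i * z.2 ^+ j) @[n --> \oo]
        --> h z.

Definition pole_of_order (K : numFieldType) (n : nat) (f : K -> K) : Prop :=
  exists h : K -> K, analytic_at0 h /\ h 0 != 0 /\
    \forall t \near (0 : K)^', f t = h t / t ^+ n.

(* A triple (x, y_rhat, y_shat) of affine coordinates. *)
Definition pt (K : numFieldType) := (K * K * K)%type.
Definition xc (K : numFieldType) (P : pt K) : K := P.1.1.
Definition yr (K : numFieldType) (P : pt K) : K := P.1.2.
Definition ys (K : numFieldType) (P : pt K) : K := P.2.

Definition rhat (r s : nat) : nat := (2 * r + s)%N.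
Definition shat (r s : nat) : nat := (2 * s + r)%N.
Definition genus (r s : nat) : nat := (r + s).-1.

Definition k_s (K : numFieldType) (r s : nat) (b : 'I_(s + r) -> K) : {poly K} :=
  \prod_(i < s) ('X - (b (lshift r i))%:P).
Definition k_r (K : numFieldType) (r s : nat) (b : 'I_(s + r) -> K) : {poly K} :=
  \prod_(i < r) ('X - (b (rshift s i))%:P).

Definition curve (K : numFieldType) (r s : nat) (b : 'I_(s + r) -> K) :
    set (pt K) :=
  [set P | [/\ yr P ^+ 2 = ys P * (k_r b).[xc P],
               yr P * ys P = (k_r b).[xc P] * (k_s b).[xc P] &
               ys P ^+ 2 = yr P * (k_s b).[xc P]]].

(* The points of the compact Riemann surface X; [None] is the point ∞. *)
Definition surface (K : numFieldType) (r s : nat) (b : 'I_(s + r) -> K) :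
    set (option (pt K)) :=
  [set p | if p is Some P then curve b P else True].

(** The complex structure of X, through the inverses [gam : t |-> point] of the
    local coordinates [t] centred at [p]: at an affine point, analytic
    parametrizations with nonzero velocity of the nonsingular curve in K^3; at
    ∞ (where the value [gam 0] is meaningless), meromorphic ones for which
    x, y_rhat, y_shat have poles of order 3, rhat, shat. *)
Definition local_coord (K : numFieldType) (r s : nat) (b : 'I_(s + r) -> K)
    (p : option (pt K)) (gam : K -> pt K) : Prop :=
  (\forall t \near (0 : K)^', curve b (gam t)) /\
  match p with
  | Some P =>
      [/\ curve b P, gam 0 = P,
          [/\ analytic_at0 (@xc K \o gam), analytic_at0 (@yr K \o gam) &
              analytic_at0 (@ys K \o gam)] &
          [\/ derive1 (@xc K \o gam) 0 != 0, derive1 (@yr K \o gam) 0 != 0 |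
              derive1 (@ys K \o gam) 0 != 0]]
  | None =>
      [/\ pole_of_order 3 (@xc K \o gam),
          pole_of_order (rhat r s) (@yr K \o gam) &
          pole_of_order (shat r s) (@ys K \o gam)]
  end.

(** A meromorphic one-form [w dx] on X is represented by its coefficient
    [w : pt K -> K] with respect to [dx]. Only its values away from finitely
    many points matter: all local conditions are imposed on punctured neighbourhoods. *)

(* The coefficient of [dt] in [w dx]. *)
Definition pullback (K : numFieldType) (w : pt K -> K) (gam : K -> pt K)
    (t : K) : K :=
  w (gam t) * derive1 (@xc K \o gam) t.

Definition holomorphic_at (K : numFieldType) (r s : nat) (b : 'I_(s + r) -> K)
    (w : pt K -> K) (p : option (pt K)) : Prop :=
  forall gam, local_coord b p gam ->
    exists h : K -> K, analytic_at0 h /\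
      \forall t \near (0 : K)^', pullback w gam t = h t.

(* At most a first order pole, with residue [c]. *)
Definition simple_pole_at (K : numFieldType) (r s : nat) (b : 'I_(s + r) -> K)
    (w : pt K -> K) (p : option (pt K)) (c : K) : Prop :=
  forall gam, local_coord b p gam ->
    exists h : K -> K, analytic_at0 h /\
      \forall t \near (0 : K)^', pullback w gam t = c / t + h t.

(* A pole of any finite order, with zero residue (or no pole). *)
Definition residue_free_at (K : numFieldType) (r s : nat) (b : 'I_(s + r) -> K)
    (w : pt K -> K) (p : option (pt K)) : Prop :=
  forall gam, local_coord b p gam ->
    exists (n : nat) (c : nat -> K) (h : K -> K), analytic_at0 h /\
      \forall t \near (0 : K)^',
        pullback w gam t = \sum_(k < n) c k / t ^+ k.+2 + h t.

Definition second_kind (K : numFieldType) (r s : nat) (b : 'I_(s + r) -> K)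
    (w : pt K -> K) : Prop :=
  forall p, surface b p -> residue_free_at b w p.

Definition third_kind (K : numFieldType) (r s : nat) (b : 'I_(s + r) -> K)
    (w : pt K -> K) : Prop :=
  forall p, surface b p -> exists c : K, simple_pole_at b w p c.

(* [(a, e, f)] stands for the monomial x^a y_rhat^e y_shat^f; those lying in
   the basis of Rhat have (e, f) <> (0, 0). *)
Definition monom := (nat * bool * bool)%type.
Definition hat_monom (m : monom) : bool := m.1.2 || m.2.
Definition monom_order (r s : nat) (m : monom) : nat :=
  (3 * m.1.1 + m.1.2 * rhat r s + m.2 * shat r s)%N.
Definition monom_eval (K : numFieldType) (m : monom) (P : pt K) : K :=
  xc P ^+ m.1.1 * yr P ^+ m.1.2 * ys P ^+ m.2.

Definition hat_basis (r s : nat) (phi : nat -> monom) : Prop :=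
  [/\ forall i, hat_monom (phi i),
      forall i, (monom_order r s (phi i) < monom_order r s (phi i.+1))%N &
      forall m, hat_monom m -> exists i, phi i = m].

Definition nuI (K : numFieldType) (phi : nat -> monom) (i : nat) (P : pt K) : K :=
  monom_eval (phi i) P / (3 * yr P * ys P).

(* The coefficient of dx_P in Sigma(P, Q). *)
Definition Sigma (K : numFieldType) (P Q : pt K) : K :=
  (yr P * ys P + yr P * ys Q + yr Q * ys P)
    / (3 * (xc P - xc Q) * yr P * ys P).

(* The derivative with respect to x, along the curve, at a point where x is
   unramified. *)
Definition dx_along (K : numFieldType) (r s : nat) (b : 'I_(s + r) -> K)
    (f : pt K -> K) (Q : pt K) : K :=
  lim ((f Q' - f Q) / (xc Q' - xc Q) @[Q' --> within (curve b) Q^']).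

(* The coefficient of dx_P ⊗ dx_Q in d_Q Sigma(P, Q). *)
Definition dSigma (K : numFieldType) (r s : nat) (b : 'I_(s + r) -> K)
    (P Q : pt K) : K :=
  dx_along b (Sigma P) Q.

Definition Pi3 (K : numFieldType) (P1 P2 : pt K) (P : pt K) : K :=
  Sigma P P1 - Sigma P P2.

Definition Omega (K : numFieldType) (r s : nat) (b : 'I_(s + r) -> K)
    (phi : nat -> monom) (nuII : 'I_(genus r s) -> pt K -> K)
    (P1 P2 : pt K) : K :=
  dSigma b P1 P2 + \sum_(i < genus r s) nuI phi i P1 * nuII i P2.

(** A meromorphic two-form [W dx_1 ⊗ dx_2] on X × X is represented by [W].
    The formulas above are evaluated on the dense open set of [generic] pairs, where no denominator vanishes and x
    is unramified; this determines the form. *)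
Definition generic (K : numFieldType) (r s : nat) (b : 'I_(s + r) -> K)
    (P Q : pt K) : Prop :=
  [/\ curve b P, curve b Q, yr P * ys P != 0, yr Q * ys Q != 0 &
      xc P != xc Q].

Definition pullback2 (K : numFieldType) (W : pt K -> pt K -> K)
    (gam del : K -> pt K) (z : K * K) : K :=
  W (gam z.1) (del z.2) * derive1 (@xc K \o gam) z.1 * derive1 (@xc K \o del) z.2.

Definition second_kind_relation (K : numFieldType) (r s : nat)
    (b : 'I_(s + r) -> K) (phi : nat -> monom)
    (nuII : 'I_(genus r s) -> pt K -> K) : Prop :=
  forall P Q, generic b P Q ->
    dSigma b P Q - dSigma b Q P =
    \sum_(i < genus r s) (nuI phi i Q * nuII i P - nuI phi i P * nuII i Q).

(* In the local coordinates given by [gam] and [del], the two-form is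
   [sing + (regular power series)] times dt_1 ⊗ dt_2. *)
Definition regular_up_to (K : numFieldType) (r s : nat) (b : 'I_(s + r) -> K)
    (W : pt K -> pt K -> K) (gam del : K -> pt K) (sing : K * K -> K) : Prop :=
  exists h : K * K -> K, analytic2_at0 h /\
    \forall z \near ((0, 0) : K * K),
      z.1 != 0 -> z.2 != 0 -> generic b (gam z.1) (del z.2) ->
      pullback2 W gam del z = sing z + h z.

Definition fundamental_second_kind (K : numFieldType) (r s : nat)
    (b : 'I_(s + r) -> K) (W : pt K -> pt K -> K) : Prop :=
  [/\ forall P Q, generic b P Q -> W P Q = W Q P,
      forall p q gam del, surface b p -> surface b q -> p <> q ->
        local_coord b p gam -> local_coord b q del ->
        regular_up_to b W gam del (fun=> 0) &
      forall p gam, surface b p -> local_coord b p gam ->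
        regular_up_to b W gam gam (fun z => 1 / (z.1 - z.2) ^+ 2)].

(** Elements of the coordinate ring are given by representatives in
    C[x][y_rhat][y_shat], those of its tensor square by finite sums of pure
    tensors. *)
Definition coord_eval (K : numFieldType) (p : {poly {poly {poly K}}})
    (P : pt K) : K :=
  p.[(ys P)%:P%:P].[(yr P)%:P].[xc P].

Definition tensor_eval (K : numFieldType)
    (F : seq ({poly {poly {poly K}}} * {poly {poly {poly K}}}))
    (P Q : pt K) : K :=
  \sum_(fg <- F) coord_eval fg.1 P * coord_eval fg.2 Q.

(* Main.v *)
Require Import Defs.
From mathcomp Require Import all_boot all_order all_algebra.
From mathcomp Require Import complex.
From mathcomp Require Import all_classical all_reals all_analysis.
From mathcomp Require Import ring zify.

Set Implicit Arguments.
Unset Strict Implicit.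
Unset Printing Implicit Defensive.

Import Order.TTheory GRing.Theory Num.Theory numFieldNormedType.Exports.

Local Open Scope classical_set_scope.
Local Open Scope ring_scope.

(** The pullback of Omega near a pair of points is a meromorphic germ in two
    variables, with possible poles on the axes and along x_1 = x_2. Writing
    Omega as Gnum / (9 (x_1 - x_2)^2 y_r y_s y_r y_s) plus the sum of the
    nuI_i ⊗ nuII_i, Gnum vanishes doubly on conjugate sheets (same x, distinct
    points), so only the diagonal survives. A germ with poles on the axes only
    is analytic once its restrictions to generic lines are. For a fixed generic second
    point this is an order count in the first one, at infinity and at branch
    points; the other direction follows from the symmetry of Omega, which is
    the defining relation of the nuII_i. Near the diagonal, k(t, u) =
    (t - u)^2 Omega is analytic and symmetric with k(t, t) = 1; the symmetry
    kills the first-order term, so (t - u)^2 divides k - 1.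

    Evaluating the relation at finitely many points Q that separate the nuI_i
    gives nuII_i = (U_i(x) y_r + V_i(x) y_s) dx / (y_r y_s) with polynomial
    U_i, V_i, hence the numerator in the tensor square. *)

(** * Convergent double power series *)

Definition abs_complete (K : numFieldType) : Prop :=
  forall u : nat -> K, (exists M, forall n, \sum_(i < n) `|u i| <= M) ->
    cvgn (series u).

Section Arrays.
Variable K : numFieldType.
Implicit Types (a b c : nat -> nat -> K) (z : K * K) (rho M : K) (n : nat).

Definition psum a z n : K := \sum_(i < n) \sum_(j < n) a i j * z.1 ^+ i * z.2 ^+ j.

Definition pnorm a rho n : K := \sum_(i < n) \sum_(j < n) `|a i j| * rho ^+ (i + j).

Definition cauchy_prod a b i j : K :=
  \sum_(k < i.+1) \sum_(l < j.+1) a k l * b (i - k)%N (j - l)%N.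

Lemma cauchy_sum (F : nat -> nat -> K) n :
  \sum_(i < n) \sum_(k < i.+1) F k (i - k)%N =
  \sum_(k < n) \sum_(l < n) (k + l < n)%:R * F k l.
Proof.
transitivity (\sum_(k < n) \sum_(i < n | (k <= i)%N) F k (i - k)%N).
  under eq_bigr => i _.
    rewrite (big_ord_widen_cond n xpredT (fun k => F k (i - k)%N)); last exact: ltn_ord.
    under eq_bigl => k do rewrite ltnS.
  over.
  by rewrite (exchange_big_dep xpredT).
apply: eq_bigr => k _.
rewrite -(big_mkord (fun i => k <= i)%N (fun i => F k (i - k)%N)).
rewrite (@big_cat_nat _ _ _ k) //=; last exact: ltnW.
rewrite big_nat_cond big_pred0 ?add0r; last by move=> i; case: ltnP; rewrite ?andbF// => ->; rewrite andbF.
rewrite -[X in \sum_(X <= _ < _ | _) _]add0n big_addn.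
under eq_bigl => i do rewrite leq_addl.
under eq_bigr => i _ do rewrite addnK.
rewrite (big_nat_widen _ _ n) ?leq_subr// big_mkord big_mkcond /=.
apply: eq_bigr => l _; rewrite ltn_subRL.
by case: ifP => _; rewrite ?mul1r ?mul0r.
Qed.

Lemma psum_conv a b z n :
  psum (cauchy_prod a b) z n =
  \sum_(k < n) \sum_(p < n) \sum_(l < n) \sum_(q < n)
    ((k + p < n)%N && (l + q < n)%N)%:R *
    ((a k l * z.1 ^+ k * z.2 ^+ l) * (b p q * z.1 ^+ p * z.2 ^+ q)).
Proof.
pose T k l : K := a k l * z.1 ^+ k * z.2 ^+ l.
pose U p q : K := b p q * z.1 ^+ p * z.2 ^+ q.
transitivity (\sum_(i < n) \sum_(k < i.+1) \sum_(j < n) \sum_(l < j.+1)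
    T k l * U (i - k)%N (j - l)%N).
  apply: eq_bigr => i _; rewrite exchange_big; apply: eq_bigr => j _ /=.
  rewrite /cauchy_prod !mulr_suml; apply: eq_bigr => k _.
  rewrite !mulr_suml; apply: eq_bigr => l _.
  have ki : (k <= i)%N by rewrite -ltnS ltn_ord.
  have lj : (l <= j)%N by rewrite -ltnS ltn_ord.
  have -> : z.1 ^+ i = z.1 ^+ k * z.1 ^+ (i - k) by rewrite -exprD subnKC.
  have -> : z.2 ^+ j = z.2 ^+ l * z.2 ^+ (j - l) by rewrite -exprD subnKC.
  rewrite /T /U; ring.
rewrite (cauchy_sum (fun k p => \sum_(j < n) \sum_(l < j.+1) T k l * U p (j - l)%N)).
apply: eq_bigr => k _; apply: eq_bigr => p _.
rewrite (cauchy_sum (fun l q => T k l * U p q)).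
rewrite mulr_sumr; apply: eq_bigr => l _.
rewrite mulr_sumr; apply: eq_bigr => q _.
by rewrite mulrA -natrM mulnb.
Qed.

Lemma psum_mul a b z n :
  psum a z n * psum b z n =
  \sum_(k < n) \sum_(p < n) \sum_(l < n) \sum_(q < n)
    ((a k l * z.1 ^+ k * z.2 ^+ l) * (b p q * z.1 ^+ p * z.2 ^+ q)).
Proof.
rewrite /psum mulr_suml; apply: eq_bigr => k _.
rewrite mulr_sumr; apply: eq_bigr => p _.
rewrite mulr_suml; apply: eq_bigr => l _.
by rewrite mulr_sumr.
Qed.

Lemma pnormE a rho n : pnorm a rho n = psum (fun i j => `|a i j|) (rho, rho) n.
Proof.
by apply: eq_bigr => i _; apply: eq_bigr => j _; rewrite exprD mulrA.
Qed.

Lemma pnorm_ge0 a rho n : 0 <= rho -> 0 <= pnorm a rho n.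
Proof.
by move=> ?; apply: sumr_ge0 => i _; apply: sumr_ge0 => j _; rewrite mulr_ge0 ?exprn_ge0.
Qed.

Lemma pnorm_conv a b rho n : 0 <= rho ->
  pnorm (cauchy_prod a b) rho n <= pnorm a rho n * pnorm b rho n.
Proof.
move=> rho0; rewrite !pnormE psum_mul.
apply: (@le_trans _ _ (psum (cauchy_prod (fun i j => `|a i j|) (fun i j => `|b i j|)) (rho, rho) n)).
  apply: ler_sum => i _; apply: ler_sum => j _.
  rewrite !ler_wpM2r ?exprn_ge0//.
  apply: le_trans (ler_norm_sum _ _ _) _; apply: ler_sum => k _.
  apply: le_trans (ler_norm_sum _ _ _) _; apply: ler_sum => l _.
  by rewrite normrM.
rewrite psum_conv.
do 4 (apply: ler_sum => ? _).
by case: (_ && _); rewrite ?mul1r // mul0r !mulr_ge0 ?exprn_ge0.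
Qed.

Lemma pnorm_add a b rho n : 0 <= rho ->
  pnorm (fun i j => a i j + b i j) rho n <= pnorm a rho n + pnorm b rho n.
Proof.
move=> rho0; rewrite /pnorm -big_split; apply: ler_sum => i _ /=.
rewrite -big_split; apply: ler_sum => j _ /=.
by rewrite -mulrDl ler_wpM2r ?exprn_ge0 ?ler_normD.
Qed.

Lemma pnorm_mono a rho sig n : 0 <= rho -> rho <= sig -> pnorm a rho n <= pnorm a sig n.
Proof.
move=> r0 rs; apply: ler_sum => i _; apply: ler_sum => j _.
by rewrite ler_wpM2l // lerXn2r // nnegrE // (le_trans r0).
Qed.

Lemma pnorm_coef a rho M i j : 0 <= rho -> (forall n, pnorm a rho n <= M) ->
  `|a i j| * rho ^+ (i + j) <= M.
Proof.
move=> r0 /(_ (maxn i j).+1); apply: le_trans.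
have im : (i < (maxn i j).+1)%N by rewrite ltnS leq_maxl.
have jm : (j < (maxn i j).+1)%N by rewrite ltnS leq_maxr.
rewrite /pnorm (bigD1 (Ordinal im)) //= (bigD1 (Ordinal jm)) //=.
rewrite -addrA lerDl addr_ge0 //; first by apply: sumr_ge0 => ? _; rewrite mulr_ge0 ?exprn_ge0.
by do 2 apply: sumr_ge0 => ? _; rewrite mulr_ge0 ?exprn_ge0.
Qed.

Lemma geo_half n : \sum_(i < n) (2%:R^-1 : K) ^+ i <= 2.
Proof.
suff -> : \sum_(i < n) (2%:R^-1 : K) ^+ i = 2 - 2 * 2^-1 ^+ n.
  by rewrite gerBl mulr_ge0 ?exprn_ge0 ?invr_ge0 ?ler0n.
elim: n => [|n IH]; first by rewrite big_ord0 expr0; ring.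
by rewrite big_ord_recr /= IH exprS; field.
Qed.

Lemma pnorm_geo a rho M n : 0 <= rho -> (forall i j, `|a i j| * rho ^+ (i + j) <= M) ->
  pnorm a (rho / 2) n <= M * 4.
Proof.
move=> r0 aM.
have M0 : 0 <= M by apply: le_trans (aM 0%N 0%N); rewrite mulr_ge0 ?exprn_ge0.
apply: (@le_trans _ _ (\sum_(i < n) \sum_(j < n) M * (2^-1 ^+ i * 2^-1 ^+ j))).
  apply: ler_sum => i _; apply: ler_sum => j _.
  by rewrite exprMn mulrA -exprD ler_wpM2r ?exprn_ge0 ?invr_ge0 ?ler0n.
have -> : \sum_(i < n) \sum_(j < n) M * (2^-1 ^+ i * 2^-1 ^+ j) =
    M * ((\sum_(i < n) 2^-1 ^+ i) * (\sum_(i < n) 2^-1 ^+ i)).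
  rewrite mulr_suml mulr_sumr; apply: eq_bigr => i _.
  by rewrite mulr_sumr mulr_sumr.
rewrite ler_wpM2l //.
have -> : (4 : K) = 2 * 2 by ring.
by rewrite ler_pM ?geo_half //; apply: sumr_ge0 => i _; rewrite exprn_ge0 ?invr_ge0 ?ler0n.
Qed.

Lemma psum_norm a z rho n : 0 <= rho -> `|z.1| <= rho -> `|z.2| <= rho ->
  `|psum a z n| <= pnorm a rho n.
Proof.
move=> r0 z1 z2; apply: le_trans (ler_norm_sum _ _ _) _; apply: ler_sum => i _.
apply: le_trans (ler_norm_sum _ _ _) _; apply: ler_sum => j _.
rewrite !normrM !normrX exprD mulrA ler_pM ?mulr_ge0 ?exprn_ge0 //; last by rewrite lerXn2r ?nnegrE.
by rewrite ler_wpM2l // lerXn2r ?nnegrE.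
Qed.

Lemma psum_conv_diff a b z rho M n : 0 <= rho ->
  (forall n, pnorm a rho n <= M) -> (forall n, pnorm b rho n <= M) ->
  `|z.1| <= rho / 2 -> `|z.2| <= rho / 2 ->
  `|psum a z n * psum b z n - psum (cauchy_prod a b) z n| <= M * M * 2^-1 ^+ n.
Proof.
move=> r0 aM bM z1 z2.
have h0 : (0 : K) <= 2^-1 by rewrite invr_ge0 ler0n.
have h1 : (2^-1 : K) <= 1 by rewrite invf_le1 ?ler1n ?ltr0n.
have N0 c m : 0 <= pnorm c rho m by exact: pnorm_ge0.
have term c k l : `|c k l * z.1 ^+ k * z.2 ^+ l| <= `|c k l| * rho ^+ (k + l) * 2^-1 ^+ (k + l).
  have -> : `|c k l| * rho ^+ (k + l) * 2^-1 ^+ (k + l) = `|c k l| * (rho / 2) ^+ k * (rho / 2) ^+ l.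
    by rewrite -mulrA -exprMn exprD mulrA.
  rewrite !normrM !normrX ler_pM ?mulr_ge0 ?exprn_ge0 //; last first.
    by rewrite lerXn2r ?nnegrE // mulr_ge0.
  by rewrite ler_wpM2l // lerXn2r ?nnegrE // mulr_ge0.
apply: (@le_trans _ _ (pnorm a rho n * pnorm b rho n * 2^-1 ^+ n)); last first.
  by rewrite ler_wpM2r ?exprn_ge0// ler_pM.
rewrite psum_mul psum_conv !pnormE psum_mul mulr_suml -sumrB.
apply: le_trans (ler_norm_sum _ _ _) _; apply: ler_sum => k _.
rewrite mulr_suml -sumrB; apply: le_trans (ler_norm_sum _ _ _) _; apply: ler_sum => p _.
rewrite mulr_suml -sumrB; apply: le_trans (ler_norm_sum _ _ _) _; apply: ler_sum => l _.
rewrite mulr_suml -sumrB; apply: le_trans (ler_norm_sum _ _ _) _; apply: ler_sum => q _ /=.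
have X0 c i j : 0 <= `|c i j| * rho ^+ i * rho ^+ j :> K by rewrite !mulr_ge0 ?exprn_ge0.
case: (boolP (_ && _)) => [_|hn]; first by rewrite mul1r subrr normr0 !mulr_ge0 ?exprn_ge0.
rewrite mul0r subr0 normrM.
apply: (@le_trans _ _ ((`|a k l| * rho ^+ (k + l) * 2^-1 ^+ (k + l)) *
   (`|b p q| * rho ^+ (p + q) * 2^-1 ^+ (p + q)))).
  by rewrite ler_pM.
have -> : `|a k l| * rho ^+ (k + l) * 2^-1 ^+ (k + l) *
   (`|b p q| * rho ^+ (p + q) * 2^-1 ^+ (p + q)) =
  `|a k l| * rho ^+ k * rho ^+ l * (`|b p q| * rho ^+ p * rho ^+ q) * 2^-1 ^+ (k + l + (p + q)).
  rewrite !exprD; ring.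
rewrite ler_wpM2l ?mulr_ge0 ?exprn_ge0 //.
apply: (ler_wiXn2l h0 h1).
by move: hn; rewrite negb_and -!leqNgt; lia.
Qed.

End Arrays.

Lemma gt0_min2 (K : numFieldType) (x y : K) : 0 < x -> 0 < y ->
  exists z : K, [/\ 0 < z, z <= x & z <= y].
Proof.
move=> x0 y0; have := real_leP (gtr0_real x0) (gtr0_real y0).
by case=> [xy|/ltW yx]; [exists x | exists y].
Qed.

Section Evaluation.
Variables (K : numFieldType) (Kc : abs_complete K).
Implicit Types (a b c : nat -> nat -> K) (z : K * K) (rho M : K) (n : nat).

Definition ev a z : K := lim (psum a z n @[n --> \oo]).

Lemma half_cvg0 : (2^-1 : K) ^+ n @[n --> \oo] --> (0 : K).
Proof.
apply: (@cvg_series_cvg_0 _ K (fun n => 2^-1 ^+ n)); apply: Kc.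
exists 2 => n; under eq_bigr do rewrite ger0_norm ?exprn_ge0 ?invr_ge0 ?ler0n //.
exact: geo_half.
Qed.

Lemma cvg0_geo (u : nat -> K) (C : K) : (forall n, `|u n| <= C * 2^-1 ^+ n) ->
  u n @[n --> \oo] --> (0 : K).
Proof.
move=> uC; apply/cvgr0Pnorm_lt => e e0.
have h : C * 2^-1 ^+ n @[n --> \oo] --> (0 : K).
  by rewrite -[X in _ --> X](mulr0 C); apply: cvgMr; exact: half_cvg0.
move/cvgr0Pnorm_lt: h => /(_ e e0); apply: filterS => n; apply: le_lt_trans.
apply: le_trans (uC n) _.
by rewrite ger0_norm// (le_trans _ (uC n)).
Qed.

Lemma psumS a z n : psum a z n.+1 = psum a z n +
  (\sum_(i < n) a i n * z.1 ^+ i * z.2 ^+ n + \sum_(j < n.+1) a n j * z.1 ^+ n * z.2 ^+ j).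
Proof.
rewrite /psum big_ord_recr /= addrA; congr (_ + _).
by rewrite -big_split; apply: eq_bigr => i _; rewrite big_ord_recr.
Qed.

Lemma psumS_norm a z rho n : 0 <= rho -> `|z.1| <= rho -> `|z.2| <= rho ->
  `|psum a z n.+1 - psum a z n| <= pnorm a rho n.+1 - pnorm a rho n.
Proof.
move=> r0 z1 z2; rewrite !pnormE !psumS ![_ + _ - _]addrAC !subrr !add0r.
have T i j : `|a i j * z.1 ^+ i * z.2 ^+ j| <= `|a i j| * rho ^+ i * rho ^+ j.
  by rewrite !normrM !normrX ler_pM ?mulr_ge0 ?exprn_ge0 ?lerXn2r ?nnegrE // ler_wpM2l ?lerXn2r ?nnegrE.
apply: le_trans (ler_normD _ _) _; apply: lerD.
  by apply: le_trans (ler_norm_sum _ _ _) _; apply: ler_sum => i _.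
by apply: le_trans (ler_norm_sum _ _ _) _; apply: ler_sum => i _.
Qed.

Lemma telescope_ord (u : nat -> K) n : \sum_(i < n) (u i.+1 - u i) = u n - u 0%N.
Proof.
by elim: n => [|n IH]; rewrite ?big_ord0 ?subrr// big_ord_recr /= IH addrC subrKA.
Qed.

Lemma psum0 a z : psum a z 0 = 0. Proof. by rewrite /psum big_ord0. Qed.

Lemma evP a z rho M : 0 <= rho -> (forall n, pnorm a rho n <= M) ->
  `|z.1| <= rho -> `|z.2| <= rho -> psum a z n @[n --> \oo] --> ev a z.
Proof.
move=> r0 aM z1 z2.
suff : cvgn (psum a z) by [].
have -> : psum a z = series (fun n => psum a z n.+1 - psum a z n).
  apply/funext => n; rewrite /series /= big_mkord.
  by rewrite (telescope_ord (psum a z)) psum0 subr0.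
apply: Kc; exists M => n.
apply: le_trans (_ : \sum_(i < n) (pnorm a rho i.+1 - pnorm a rho i) <= M).
  by apply: ler_sum => i _; apply: psumS_norm.
by rewrite (telescope_ord (pnorm a rho)) !pnormE psum0 subr0 -pnormE.
Qed.

Lemma ev_lim a z l : psum a z n @[n --> \oo] --> l -> ev a z = l.
Proof. by move=> h; apply: cvg_lim => //; exact: norm_hausdorff. Qed.

Lemma ev_norm a z rho M : 0 <= rho -> (forall n, pnorm a rho n <= M) ->
  `|z.1| <= rho -> `|z.2| <= rho -> `|ev a z| <= M + 1.
Proof.
move=> r0 aM z1 z2.
have /cvgrPdist_le /(_ 1 ltr01) [N _ /(_ N (leqnn N)) /= h] := evP r0 aM z1 z2.
rewrite -(subrK (psum a z N) (ev a z)) addrC.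
by apply: le_trans (ler_normD _ _) _; rewrite lerD// (le_trans (psum_norm a N r0 z1 z2)).
Qed.

Lemma evM a b z rho M : 0 <= rho ->
  (forall n, pnorm a rho n <= M) -> (forall n, pnorm b rho n <= M) ->
  `|z.1| <= rho / 2 -> `|z.2| <= rho / 2 -> ev (cauchy_prod a b) z = ev a z * ev b z.
Proof.
move=> r0 aM bM z1 z2; apply: ev_lim.
have hr : rho / 2 <= rho by rewrite ler_pdivrMr ?ltr0n// ler_peMr// ler1n.
have z1' := le_trans z1 hr; have z2' := le_trans z2 hr.
have h1 := evP r0 aM z1' z2'; have h2 := evP r0 bM z1' z2'.
have h3 := cvg0_geo (fun n => psum_conv_diff n r0 aM bM z1 z2).
have := cvgB (cvgM h1 h2) h3; rewrite subr0 => h.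
have -> : psum (cauchy_prod a b) z =
    (fun n => psum a z n * psum b z n - (psum a z n * psum b z n - psum (cauchy_prod a b) z n)).
  by apply/funext => n; rewrite opprB addrC subrK.
exact: h.
Qed.

Lemma evD a b z rho M : 0 <= rho ->
  (forall n, pnorm a rho n <= M) -> (forall n, pnorm b rho n <= M) ->
  `|z.1| <= rho -> `|z.2| <= rho -> ev (fun i j => a i j + b i j) z = ev a z + ev b z.
Proof.
move=> r0 aM bM z1 z2; apply: ev_lim.
suff -> : psum (fun i j => a i j + b i j) z = psum a z + psum b z.
  exact: (cvgD (evP r0 aM z1 z2) (evP r0 bM z1 z2)).
apply/funext => n; rewrite fctE /psum /= -big_split; apply: eq_bigr => i _ /=.
by rewrite -big_split; apply: eq_bigr => j _ /=; rewrite !mulrDl.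
Qed.

End Evaluation.

Lemma near0P (K : numFieldType) (P : K -> Prop) :
  (\forall t \near (0 : K), P t) <-> exists2 e, 0 < e & forall t, `|t| < e -> P t.
Proof.
split=> [/nbhs_ballP [e /= e0 h]|[e e0 h]].
  by exists e => // t te; apply: h; rewrite /ball /= sub0r normrN.
by apply/nbhs_ballP; exists e => // t; rewrite /ball /= sub0r normrN; apply: h.
Qed.

Lemma near0'P (K : numFieldType) (P : K -> Prop) :
  (\forall t \near (0 : K)^', P t) <->
  exists2 e, 0 < e & forall t, `|t| < e -> t != 0 -> P t.
Proof. exact: near0P. Qed.

Lemma near00P (K : numFieldType) (P : K * K -> Prop) :
  (\forall z \near ((0, 0) : K * K), P z) <->
  exists2 e, 0 < e & forall z, `|z.1| < e -> `|z.2| < e -> P z.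
Proof.
split=> [/nbhs_ballP [e /= e0 h]|[e e0 h]].
  exists e => // -[x y] xe ye; apply: h; split; rewrite /ball /= sub0r normrN //.
apply/nbhs_ballP; exists e => // -[x y] []; rewrite /ball /= !sub0r !normrN.
exact: (h (x, y)).
Qed.

Section Germs.
Variables (K : numFieldType) (Kc : abs_complete K).
Implicit Types (a b : nat -> nat -> K) (z : K * K) (rho M : K) (n : nat).
Implicit Types (h : K * K -> K).

Definition bounded_coefs a rho := exists M, forall n, pnorm a rho n <= M.

Definition represents a rho h := [/\ 0 < rho, bounded_coefs a rho &
  forall z, `|z.1| <= rho -> `|z.2| <= rho -> h z = ev a z].

Lemma bnd_mono a rho sig : 0 <= rho -> rho <= sig -> bounded_coefs a sig -> bounded_coefs a rho.
Proof.
by move=> r0 rs [M aM]; exists M => n; apply: le_trans (aM n); apply: pnorm_mono.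
Qed.

Lemma rep_mono a rho sig h : 0 < rho -> rho <= sig -> represents a sig h -> represents a rho h.
Proof.
move=> r0 rs [s0 ba ha]; split=> //; first exact: bnd_mono (ltW r0) rs ba.
by move=> z z1 z2; apply: ha; apply: le_trans rs.
Qed.

Lemma half_le rho : 0 < rho -> rho / 2 <= rho.
Proof. by move=> r0; rewrite ler_pdivrMr ?ltr0n// ler_peMr ?ler1n// ltW. Qed.

Lemma bnd2 a b rho : 0 <= rho -> bounded_coefs a rho -> bounded_coefs b rho ->
  exists M, (forall n, pnorm a rho n <= M) /\ (forall n, pnorm b rho n <= M).
Proof.
move=> r0 [M aM] [N bN].
have M0 : 0 <= M by apply: le_trans (aM 0%N); apply: pnorm_ge0.
have N0 : 0 <= N by apply: le_trans (bN 0%N); apply: pnorm_ge0.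
by exists (M + N); split=> n; [apply: le_trans (aM n) _; rewrite lerDl |
  apply: le_trans (bN n) _; rewrite lerDr].
Qed.

Lemma bndM a b rho : 0 <= rho -> bounded_coefs a rho -> bounded_coefs b rho -> bounded_coefs (cauchy_prod a b) rho.
Proof.
move=> r0 ba bb; have [M [aM bM]] := bnd2 r0 ba bb; exists (M * M) => n.
by apply: le_trans (pnorm_conv _ _ _ r0) _; rewrite ler_pM ?pnorm_ge0.
Qed.

Lemma bndD a b rho : 0 <= rho -> bounded_coefs a rho -> bounded_coefs b rho ->
  bounded_coefs (fun i j => a i j + b i j) rho.
Proof.
move=> r0 ba bb; have [M [aM bM]] := bnd2 r0 ba bb; exists (M + M) => n.
by apply: le_trans (pnorm_add _ _ _ r0) _; rewrite lerD.
Qed.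

Lemma rep_ev a rho : 0 < rho -> bounded_coefs a rho -> represents a rho (ev a).
Proof. by move=> r0 ba; split. Qed.

Lemma repD a b rho h k : represents a rho h -> represents b rho k ->
  represents (fun i j => a i j + b i j) rho (fun z => h z + k z).
Proof.
move=> [r0 ba ha] [_ bb hb]; split=> //; first exact: bndD (ltW r0) ba bb.
have [M [aM bM]] := bnd2 (ltW r0) ba bb.
by move=> z z1 z2; rewrite ha// hb// (evD Kc (ltW r0) aM bM).
Qed.

Lemma repM a b rho h k : represents a rho h -> represents b rho k ->
  represents (cauchy_prod a b) (rho / 2) (fun z => h z * k z).
Proof.
move=> [r0 ba ha] [_ bb hb]; have hr := half_le r0.
split; first by rewrite divr_gt0 ?ltr0n.
  by apply: bnd_mono hr _; [rewrite divr_ge0 ?ltW ?ltr0n|exact: bndM (ltW r0) ba bb].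
have [M [aM bM]] := bnd2 (ltW r0) ba bb.
move=> z z1 z2; rewrite ha ?hb ?(le_trans _ hr)//.
by rewrite (evM Kc (ltW r0) aM bM).
Qed.

Lemma an2P h : analytic2_at0 h <-> exists a rho, represents a rho h.
Proof.
split=> [[a [[rho [M [r0 aM]]] /near00P [e e0 he]]]|[a [rho [r0 [M aM] ha]]]].
  have r20 : 0 < rho / 2 by rewrite divr_gt0 ?ltr0n.
  have e20 : 0 < e / 2 by rewrite divr_gt0 ?ltr0n.
  have [s [s0 s1 s2]] := gt0_min2 r20 e20.
  exists a, s; split=> //.
    by apply: bnd_mono (ltW s0) s1 _; exists (M * 4) => n; apply: pnorm_geo (ltW r0) aM.
  have se : s < e by apply: le_lt_trans s2 _; rewrite ltr_pdivrMr ?ltr0n// ltr_pMr ?ltr1n.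
  by move=> z z1 z2; apply/esym/ev_lim; apply: he; apply: le_lt_trans se.
exists a; split.
  by exists rho, M; split=> // i j; apply: pnorm_coef aM; exact: ltW.
apply/near00P; exists rho => // z z1 z2; rewrite ha ?ltW//.
by apply: (evP Kc (ltW r0) aM); exact: ltW.
Qed.

Lemma rep_common h k : analytic2_at0 h -> analytic2_at0 k ->
  exists a b rho, represents a rho h /\ represents b rho k.
Proof.
move=> /an2P [a [r ha]] /an2P [b [s hb]].
have [r0 _ _] := ha; have [s0 _ _] := hb.
have [t [t0 tr ts]] := gt0_min2 r0 s0.
by exists a, b, t; split; [exact: rep_mono tr ha|exact: rep_mono ts hb].
Qed.

Lemma an2D h k : analytic2_at0 h -> analytic2_at0 k -> analytic2_at0 (fun z => h z + k z).
Proof.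
move=> hh hk; have [a [b [r [ha hb]]]] := rep_common hh hk.
by apply/an2P; exists (fun i j => a i j + b i j), r; apply: repD.
Qed.

Lemma an2M h k : analytic2_at0 h -> analytic2_at0 k -> analytic2_at0 (fun z => h z * k z).
Proof.
move=> hh hk; have [a [b [r [ha hb]]]] := rep_common hh hk.
by apply/an2P; exists (cauchy_prod a b), (r / 2); apply: repM.
Qed.

Lemma an2_near h k : (\forall z \near ((0, 0) : K * K), h z = k z) ->
  analytic2_at0 h -> analytic2_at0 k.
Proof.
move=> hk [a [ab ha]]; exists a; split=> //.
by near=> z; rewrite -(near hk z) //; near: z.
Unshelve. all: by end_near. Qed.

Definition mono_arr (p q : nat) (c : K) i j : K := ((i == p) && (j == q))%:R * c.

Lemma psum_mono p q c z n : (p < n)%N -> (q < n)%N ->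
  psum (mono_arr p q c) z n = c * z.1 ^+ p * z.2 ^+ q.
Proof.
move=> pn qn; rewrite /psum (bigD1 (Ordinal pn)) //= (bigD1 (Ordinal qn)) //=.
rewrite /mono_arr !eqxx mul1r big1 ?addr0; last first.
  by move=> j /negPf jq; rewrite -val_eqE /= in jq; rewrite jq !mul0r.
rewrite big1 ?addr0// => i /negPf ip; rewrite big1// => j _.
by rewrite -val_eqE /= in ip; rewrite ip !mul0r.
Qed.

Lemma rep_mono_arr p q c rho : 0 < rho ->
  represents (mono_arr p q c) rho (fun z => c * z.1 ^+ p * z.2 ^+ q).
Proof.
move=> r0; split=> //.
  exists (`|c| * rho ^+ p * rho ^+ q) => n; rewrite pnormE.
  have -> : (fun i j => `|mono_arr p q c i j|) = mono_arr p q `|c|.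
    by apply/funext => i; apply/funext => j; rewrite /mono_arr normrM normr_nat.
  rewrite -(@psum_mono p q `|c| (rho, rho) (n + p + q).+1); last 2 first.
  - by rewrite ltnS -addnA addnCA leq_addr.
  - by rewrite ltnS leq_addl.
  have P : forall i j, 0 <= mono_arr p q `|c| i j.
    by move=> i j; rewrite mulr_ge0.
  have -> : (n + p + q).+1 = (n + (p + q).+1)%N by rewrite addnS addnA.
  elim: ((p + q).+1) => [|m IH]; first by rewrite addn0.
  rewrite addnS psumS; apply: le_trans IH _; rewrite lerDl addr_ge0// sumr_ge0// => i _;
    by apply: mulr_ge0; [apply: mulr_ge0 => //|]; apply: exprn_ge0; exact: ltW.
move=> z z1 z2; apply/esym/ev_lim.
apply/cvgrPdist_lt => e e0; exists (maxn p q).+1 => // n /= hn.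
by rewrite psum_mono ?subrr ?normr0//; apply: leq_trans hn; rewrite ltnS ?leq_maxl ?leq_maxr.
Qed.

Lemma an2_cst c : analytic2_at0 (fun _ : K * K => c).
Proof.
apply/an2P; exists (mono_arr 0 0 c), 1.
by have [r0 ba ha] := rep_mono_arr 0 0 c ltr01; split=> // z z1 z2; rewrite -ha// !mulr1.
Qed.

Lemma an2_fst : analytic2_at0 (fun z : K * K => z.1).
Proof.
apply/an2P; exists (mono_arr 1 0 1), 1.
by have [r0 ba ha] := rep_mono_arr 1 0 1 ltr01; split=> // z z1 z2; rewrite -ha// mul1r mulr1.
Qed.

Lemma an2N h : analytic2_at0 h -> analytic2_at0 (fun z => - h z).
Proof.
move=> /(an2M (an2_cst (-1))); apply: an2_near.
by apply/near00P; exists 1 => // z _ _; rewrite mulN1r.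
Qed.

Lemma an2B h k : analytic2_at0 h -> analytic2_at0 k -> analytic2_at0 (fun z => h z - k z).
Proof. by move=> hh /an2N; apply: an2D. Qed.

Lemma psum_swap a z n : psum (fun i j => a j i) (z.2, z.1) n = psum a z n.
Proof.
rewrite /psum exchange_big; apply: eq_bigr => i _; apply: eq_bigr => j _ /=.
by rewrite mulrAC.
Qed.

Lemma an2_swap h : analytic2_at0 h -> analytic2_at0 (fun z => h (z.2, z.1)).
Proof.
move=> /an2P [a [r [r0 [M aM] ha]]]; apply/an2P; exists (fun i j => a j i), r; split=> //.
  exists M => n; rewrite pnormE; have := aM n; rewrite pnormE.
  by rewrite -(psum_swap (fun i j => `|a i j|)).
move=> z z1 z2; rewrite ha//; apply/esym/ev_lim.
have -> : psum (fun i j => a j i) z = psum a (z.2, z.1).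
  by apply/funext => n; rewrite -[RHS]psum_swap.
exact: (evP Kc (z := (z.2, z.1)) (ltW r0) aM z2 z1).
Qed.

Lemma an2_snd : analytic2_at0 (fun z : K * K => z.2).
Proof. exact: an2_swap an2_fst. Qed.

Lemma an2_bounded h : analytic2_at0 h ->
  exists C, \forall z \near ((0, 0) : K * K), `|h z| <= C.
Proof.
move=> /an2P [a [r [r0 [M aM] ha]]]; exists (M + 1); apply/near00P; exists r => // z z1 z2.
by rewrite ha ?(ev_norm Kc (ltW r0) aM)// ltW.
Qed.

End Germs.

Section DiagonalQuotient.
Variables (K : numFieldType) (Kc : abs_complete K).
Implicit Types (a b : nat -> nat -> K) (z : K * K) (rho M : K) (n : nat).
Implicit Types (h : K * K -> K) (f : K -> K).

Lemma cauchy_mono p q c a i j :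
  cauchy_prod (mono_arr p q c) a i j =
  ((p <= i)%N && (q <= j)%N)%:R * (c * a (i - p)%N (j - q)%N).
Proof.
rewrite /cauchy_prod; case: (leqP p i) => pi /=; last first.
  rewrite mul0r big1// => k _; rewrite big1// => l _.
  by rewrite /mono_arr ltn_eqF ?mul0r// (leq_ltn_trans _ pi)// -ltnS.
have pi' : (p < i.+1)%N by [].
rewrite (bigD1 (Ordinal pi')) //= [X in _ + X]big1 ?addr0; last first.
  move=> k /negPf kp; rewrite -val_eqE /= in kp; rewrite big1// => l _.
  by rewrite /mono_arr kp /= !mul0r.
case: (leqP q j) => qj /=; last first.
  rewrite mul0r big1// => l _.
  by rewrite /mono_arr [(l == q :> nat)]ltn_eqF ?andbF ?mul0r// (leq_ltn_trans _ qj)// -ltnS.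
have qj' : (q < j.+1)%N by [].
rewrite (bigD1 (Ordinal qj')) //= big1 ?addr0; last first.
  by move=> l /negPf lq; rewrite -val_eqE /= in lq; rewrite /mono_arr lq andbF !mul0r.
by rewrite /mono_arr !eqxx !mul1r.
Qed.

Lemma rep_fst rho : 0 < rho -> represents (mono_arr 1 0 1) rho (fun z => z.1).
Proof.
by move=> r0; have [_ ba ha] := rep_mono_arr 1 0 1 r0; split=> // z z1 z2; rewrite -ha// mul1r mulr1.
Qed.

Lemma rep_snd rho : 0 < rho -> represents (mono_arr 0 1 1) rho (fun z => z.2).
Proof.
by move=> r0; have [_ ba ha] := rep_mono_arr 0 1 1 r0; split=> // z z1 z2; rewrite -ha// !mul1r.
Qed.

Lemma bnd_coef a rho : 0 < rho -> bounded_coefs a rho ->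
  exists2 M, 0 <= M & forall i j, `|a i j| * rho ^+ (i + j) <= M.
Proof.
move=> r0 [M aM]; exists M; first by apply: le_trans (aM 0%N); apply: pnorm_ge0; exact: ltW.
by move=> i j; apply: pnorm_coef aM; exact: ltW.
Qed.

Lemma natS_exp2 n : (n.+1%:R : K) <= 2 ^+ n.
Proof. by rewrite -natrX ler_nat; apply: ltn_expl. Qed.

Lemma bnd_geo a rho M : 0 <= rho -> (forall i j, `|a i j| * rho ^+ (i + j) <= M) ->
  bounded_coefs a (rho / 2).
Proof. by move=> r0 aM; exists (M * 4) => n; apply: pnorm_geo. Qed.

Lemma bnd_lin a rho C : 0 < rho ->
  (forall i j, `|a i j| * rho ^+ (i + j) <= C * j.+1%:R) -> bounded_coefs a (rho / 2 / 2).
Proof.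
move=> r0 aC; apply: (@bnd_geo _ _ C); first by rewrite divr_ge0 ?ltW ?ltr0n.
have C0 : 0 <= C by apply: le_trans (_ : `|a 0%N 0%N| * rho ^+ 0 <= _); rewrite ?mulr_ge0// (le_trans (aC 0%N 0%N))// mulr1.
move=> i j; rewrite expr_div_n mulrA ler_pdivrMr ?exprn_gt0 ?ltr0n//.
apply: le_trans (aC i j) _; rewrite ler_wpM2l//; apply: le_trans (natS_exp2 j) _.
by apply: ler_weXn2l; rewrite ?ler1n// leq_addl.
Qed.

(* Coefficients of [(h(z1, z2) - h(z2, z2)) / (z1 - z2)]. *)
Definition diag_quot a k l : K := \sum_(j < l.+1) a (k + l.+1 - j)%N j.

Definition diag_arr a i j : K := if i is 0%N then \sum_(k < j.+1) a (j - k)%N k else 0.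

Lemma diag_quotE a i j :
  a i j + cauchy_prod (mono_arr 0 1 1) (diag_quot a) i j =
  diag_arr a i j + cauchy_prod (mono_arr 1 0 1) (diag_quot a) i j.
Proof.
rewrite !cauchy_mono !mul1r !subn0 /=; case: i => [|i]; case: j => [|j] /=;
  rewrite /diag_quot ?mul0r ?mul1r ?addr0 ?add0r ?subn1 /=.
- by rewrite big_ord_recr big_ord0 /= add0r.
- by rewrite [RHS]big_ord_recr /= subnn addrC.
- by rewrite big_ord_recr big_ord0 /= add0r subn0 addn1.
- rewrite [RHS]big_ord_recr /= addrC; congr (_ + _).
  by congr (a _ _); lia.
by apply: eq_bigr => k _; rewrite addSnnS.
Qed.

Lemma ev_diag_arr a z : ev (diag_arr a) z = ev (diag_arr a) (0, z.2).
Proof.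
rewrite /ev; suff -> : psum (diag_arr a) z = psum (diag_arr a) (0, z.2) by [].
apply/funext => n; apply: eq_bigr => -[[|i] ?] _; apply: eq_bigr => j _ //=.
by rewrite !mul0r.
Qed.

Lemma an2_diag h : analytic2_at0 h -> exists q d, [/\ analytic2_at0 q,
  analytic2_at0 d,
  \forall z \near ((0, 0) : K * K), h z - h (z.2, z.2) = (z.1 - z.2) * q z &
  \forall z \near ((0, 0) : K * K), h (z.2, z.2) = d z].
Proof.
move=> /(an2P Kc) [a [r rh]]; have [r0 ba _] := rh.
have [M M0 aM] := bnd_coef r0 ba.
pose t := r / 2 / 2.
have r20 : 0 < r / 2 by rewrite divr_gt0 ?ltr0n.
have t0 : 0 < t by rewrite divr_gt0 ?ltr0n.
have tr : t <= r by apply: le_trans (half_le _) _ => //; exact: half_le.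
have bq : bounded_coefs (diag_quot a) t.
  apply: (@bnd_lin _ _ (M / r)) => // k l.
  apply: le_trans (_ : \sum_(j < l.+1) M / r <= _); last by rewrite sumr_const card_ord mulr_natr.
  apply: le_trans (ler_wpM2r _ (ler_norm_sum _ _ _)) _; first by rewrite exprn_ge0// ltW.
  rewrite mulr_suml; apply: ler_sum => j _; rewrite ler_pdivlMr// -mulrA -exprSr.
  have jl : (j <= k + l.+1)%N by rewrite (leq_trans (ltnW (ltn_ord j)))// leq_addl.
  by rewrite -addnS; have := aM (k + l.+1 - j)%N j; rewrite subnK.
have bd : bounded_coefs (diag_arr a) t.
  apply: (@bnd_lin _ _ M) => // -[|k] l; last first.
    by rewrite normr0 mul0r mulr_ge0.
  apply: le_trans (_ : \sum_(j < l.+1) M <= _); last by rewrite sumr_const card_ord mulr_natr.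
  apply: le_trans (ler_wpM2r _ (ler_norm_sum _ _ _)) _; first by rewrite exprn_ge0// ltW.
  rewrite mulr_suml; apply: ler_sum => j _ /=.
  have jl : (j <= l)%N by rewrite -ltnS.
  by have := aM (l - j)%N j; rewrite subnK.
have rq := rep_ev t0 bq; have rd := rep_ev t0 bd.
have t20 : 0 < t / 2 by rewrite divr_gt0 ?ltr0n.
have tt := half_le t0.
have R1 := repD Kc (rep_mono t20 (le_trans tt tr) rh) (repM Kc (rep_snd t0) rq).
have R2 := repD Kc (rep_mono t20 tt rd) (repM Kc (rep_fst t0) rq).
have E z : `|z.1| <= t / 2 -> `|z.2| <= t / 2 ->
    h z + z.2 * ev (diag_quot a) z = ev (diag_arr a) z + z.1 * ev (diag_quot a) z.
  move=> z1 z2; case: R1 => _ _ ->//; case: R2 => _ _ ->//.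
  congr (ev _ _); apply/funext => i; apply/funext => j; exact: diag_quotE.
have D z : `|z.2| <= t / 2 -> h (z.2, z.2) = ev (diag_arr a) z.
  move=> z2; have := E (z.2, z.2) z2 z2.
  by move=> /addIr ->; rewrite ev_diag_arr [RHS]ev_diag_arr.
exists (ev (diag_quot a)), (ev (diag_arr a)); split.
- by apply/(an2P Kc); exists (diag_quot a), t.
- by apply/(an2P Kc); exists (diag_arr a), t.
- apply/near00P; exists (t / 2) => // z /ltW z1 /ltW z2.
  by rewrite D//; have := E z z1 z2; move=> /(canRL (addrK _)) ->; ring.
- by apply/near00P; exists (t / 2) => // z /ltW z1 /ltW z2; rewrite D.
Qed.

Lemma an2_shift h : analytic2_at0 h -> exists q d, [/\ analytic2_at0 q,
  analytic2_at0 d,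
  \forall z \near ((0, 0) : K * K), h z - h (0, z.2) = z.1 * q z &
  \forall z \near ((0, 0) : K * K), h (0, z.2) = d z].
Proof.
move=> /(an2P Kc) [a [r rh]]; have [r0 ba _] := rh.
have [M M0 aM] := bnd_coef r0 ba.
pose t := r / 2.
have t0 : 0 < t by rewrite divr_gt0 ?ltr0n.
have tr : t <= r by exact: half_le.
pose q i j := a i.+1 j.
pose d i j := if i is 0%N then a 0%N j else 0.
have bq : bounded_coefs q t.
  apply: (@bnd_geo _ _ (M / r)) => [|k l]; first exact: ltW.
  by rewrite ler_pdivlMr// -mulrA -exprSr -addSn aM.
have bd : bounded_coefs d t.
  apply: (@bnd_geo _ _ M) => [|[|k] l]; first exact: ltW.
    exact: aM.
  by rewrite normr0 mul0r.
have rq := rep_ev t0 bq; have rd := rep_ev t0 bd.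
have t20 : 0 < t / 2 by rewrite divr_gt0 ?ltr0n.
have tt := half_le t0.
have R1 := rep_mono t20 (le_trans tt tr) rh.
have R2 := repD Kc (rep_mono t20 tt rd) (repM Kc (rep_fst t0) rq).
have E z : `|z.1| <= t / 2 -> `|z.2| <= t / 2 -> h z = ev d z + z.1 * ev q z.
  move=> z1 z2; case: R1 => _ _ ->//; case: R2 => _ _ ->//.
  congr (ev _ _); apply/funext => i; apply/funext => j.
  rewrite cauchy_mono mul1r subn0 /d /q.
  by case: i => [|i] /=; rewrite ?mul0r ?mul1r ?addr0 ?add0r ?subn1.
have D z : `|z.2| <= t / 2 -> h (0, z.2) = ev d z.
  move=> z2; rewrite E//= ?normr0 ?ltW// mul0r addr0.
  rewrite /ev; suff -> : psum d (0, z.2) = psum d z by [].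
  by apply/funext => n; apply: eq_bigr => -[[|i] ?] _; apply: eq_bigr => j _ //=; rewrite !mul0r.
exists (ev q), (ev d); split.
- by apply/(an2P Kc); exists q, t.
- by apply/(an2P Kc); exists d, t.
- apply/near00P; exists (t / 2) => // z /ltW z1 /ltW z2.
  by rewrite D// E// addrC addKr.
- by apply/near00P; exists (t / 2) => // z /ltW z1 /ltW z2; rewrite D.
Qed.

End DiagonalQuotient.

Section Inverse.
Variables (K : numFieldType) (Kc : abs_complete K).
Implicit Types (a b w : nat -> nat -> K) (z : K * K) (rho M : K) (n : nat).
Implicit Types (h : K * K -> K) (f g : K -> K).

(* Iterates of [b |-> 1 + w b]; the coefficients stabilize when [w 0 0 = 0]. *)
Fixpoint inv_iter w k : nat -> nat -> K :=
  if k is k'.+1 then fun i j => mono_arr 0 0 1 i j + cauchy_prod w (inv_iter w k') i j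
  else fun _ _ => 0.

Definition inv_arr w i j := inv_iter w (i + j).+1 i j.

Lemma cauchy_ext w b b' i j : w 0%N 0%N = 0 ->
  (forall p q, (p + q < i + j)%N -> b p q = b' p q) ->
  cauchy_prod w b i j = cauchy_prod w b' i j.
Proof.
move=> w0 bb; apply: eq_bigr => k _; apply: eq_bigr => l _.
case: (posnP (k + l)%N) => [/eqP|kl]; last by rewrite bb//; have := ltn_ord k; have := ltn_ord l; lia.
by rewrite addn_eq0 => /andP [/eqP -> /eqP ->]; rewrite w0 !mul0r.
Qed.

Lemma inv_iter_stab w k m i j : w 0%N 0%N = 0 -> (i + j < k)%N -> (k <= m)%N ->
  inv_iter w m i j = inv_iter w k i j.
Proof.
move=> w0; elim: k m i j => [//|k IH] [//|m] i j; rewrite ltnS => ik km /=.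
congr (_ + _); apply: cauchy_ext => // p q pq; apply: IH => //.
exact: leq_trans pq ik.
Qed.

Lemma inv_arrE w i j : w 0%N 0%N = 0 ->
  inv_arr w i j = mono_arr 0 0 1 i j + cauchy_prod w (inv_arr w) i j.
Proof.
move=> w0; rewrite /inv_arr /=; congr (_ + _).
by apply: cauchy_ext => // p q pq; apply: (@inv_iter_stab w (p + q).+1).
Qed.

Lemma pnorm_inv_iter w rho n k : 0 <= rho -> pnorm w rho n <= 2^-1 ->
  pnorm (inv_iter w k) rho n <= 2.
Proof.
move=> r0 wn; elim: k => [|k IH].
  rewrite /pnorm big1 ?ler0n// => i _; rewrite big1// => j _; by rewrite normr0 mul0r.
apply: le_trans (pnorm_add _ _ _ r0) _.
have -> : (2 : K) = 1 + 2^-1 * 2 by field.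
apply: lerD; last by apply: le_trans (pnorm_conv _ _ _ r0) _; rewrite ler_pM ?pnorm_ge0.
rewrite pnormE.
have -> : (fun i j => `|mono_arr 0 0 (1 : K) i j|) = mono_arr 0 0 1.
  by apply/funext => i; apply/funext => j; rewrite /mono_arr normrM normr_nat normr1.
by case: n {wn IH} => [|n]; rewrite ?psum0 ?ler01// psum_mono// !mulr1.
Qed.

Lemma pnorm_inv w rho n : 0 <= rho -> w 0%N 0%N = 0 -> pnorm w rho n <= 2^-1 ->
  pnorm (inv_arr w) rho n <= 2.
Proof.
move=> r0 w0 wn; apply: le_trans (pnorm_inv_iter (n + n) r0 wn).
apply: ler_sum => i _; apply: ler_sum => j _.
rewrite (@inv_iter_stab w (i + j).+1)//.
by have := ltn_ord i; have := ltn_ord j; lia.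
Qed.

Lemma pnorm_scale w rho th n : 0 <= rho -> 0 <= th -> th <= 1 -> w 0%N 0%N = 0 ->
  pnorm w (th * rho) n <= th * pnorm w rho n.
Proof.
move=> r0 t0 t1 w0; rewrite mulr_sumr; apply: ler_sum => i _.
rewrite mulr_sumr; apply: ler_sum => j _; rewrite exprMn mulrCA.
case: (posnP (i + j)%N) => [/eqP|ij].
  by rewrite addn_eq0 => /andP [/eqP -> /eqP ->]; rewrite w0 normr0 !(mul0r,mulr0).
rewrite ler_wpM2r ?mulr_ge0 ?exprn_ge0//.
by case: (i + j)%N ij => // m _; rewrite exprS ler_piMr// exprn_ile1.
Qed.

Lemma ev00 a rho : 0 < rho -> bounded_coefs a rho -> ev a (0, 0) = a 0%N 0%N.
Proof.
move=> r0 [M aM]; apply: ev_lim.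
apply/cvgrPdist_lt => e e0; exists 1%N => // -[//|n] _.
suff -> : psum a (0, 0) n.+1 = a 0%N 0%N by rewrite subrr normr0.
rewrite /psum big_ord_recl /= big_ord_recl /= !mulr1.
rewrite [X in _ + X]big1 ?addr0; last first.
  by move=> i _; rewrite big1// => j _; rewrite expr0n /= mulr0 mul0r.
by rewrite big1 ?addr0// => i _; rewrite exprS mul0r mulr0.
Qed.

Lemma an2V h : analytic2_at0 h -> h (0, 0) != 0 -> analytic2_at0 (fun z => (h z)^-1).
Proof.
move=> hh h0; set c := h (0, 0) in h0.
have : analytic2_at0 (fun z => 1 - c^-1 * h z).
  by apply: (an2B Kc); [|apply: (an2M Kc) => //]; exact: an2_cst.
move=> /(an2P Kc) [w [r [r0 [M wM] hw]]].
have w0 : w 0%N 0%N = 0.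
  rewrite -(ev00 r0) //; last by exists M.
  by rewrite -hw ?normr0 ?ltW// mulVf ?subrr.
have M0 : 0 <= M by apply: le_trans (wM 0%N); apply: pnorm_ge0; exact: ltW.
pose th := (2 * (M + 1))^-1.
have M1 : 0 < M + 1 by rewrite ltr_wpDl.
have t0 : 0 < th by rewrite invr_gt0 mulr_gt0 ?ltr0n.
have t1 : th <= 1.
  by rewrite invf_le1 ?mulr_gt0 ?ltr0n// -[leLHS]mulr1 ler_pM ?ler1n// lerDr.
have s0 : 0 < th * r by rewrite mulr_gt0.
have wn n : pnorm w (th * r) n <= 2^-1.
  apply: le_trans (pnorm_scale _ (ltW r0) (ltW t0) t1 w0) _.
  rewrite /th invfM -mulrA ger_pMr ?invr_gt0 ?ltr0n// mulrC ler_pdivrMr// mul1r.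
  by apply: le_trans (wM n) _; rewrite lerDl.
have bw : bounded_coefs w (th * r) by exists 2^-1.
have bi : bounded_coefs (inv_arr w) (th * r) by exists 2 => n; apply: pnorm_inv => //; exact: ltW.
have R := repD Kc (rep_mono_arr 0 0 1 (divr_gt0 s0 (ltr0n _ 2)))
  (repM Kc (rep_ev s0 bw) (rep_ev s0 bi)).
have sr : th * r / 2 <= r.
  apply: le_trans (half_le s0) _; by rewrite ger_pMl.
apply: (an2_near (h := fun z => c^-1 * ev (inv_arr w) z)).
  apply/near00P; exists (th * r / 2); first by rewrite divr_gt0 ?ltr0n.
  move=> z /ltW z1 /ltW z2.
  have := hw z (le_trans z1 sr) (le_trans z2 sr).
  have : ev (inv_arr w) z = 1 + ev w z * ev (inv_arr w) z.
    case: R => _ _ /(_ z z1 z2); rewrite !mulr1 => ->.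
    by congr (ev _ z); apply/funext => i; apply/funext => j; exact: inv_arrE.
  set B := ev (inv_arr w) z => hB hz.
  have e : c^-1 * h z * B = 1.
    have -> : c^-1 * h z = 1 - ev w z by rewrite -hz opprB addrC subrK.
    by rewrite mulrBl mul1r {1}hB addrK.
  apply: (mulfI (x := h z)); last rewrite mulfV.
  - by apply: contra_eq_neq e => ->; rewrite mulr0 mul0r eq_sym oner_eq0.
  - by rewrite -e; ring.
  - by apply: contra_eq_neq e => ->; rewrite mulr0 mul0r eq_sym oner_eq0.
apply: (an2M Kc); first exact: an2_cst.
by apply/(an2P Kc); exists (inv_arr w), (th * r).
Qed.

Lemma an1P f : analytic_at0 f <-> analytic2_at0 (fun z : K * K => f z.1).
Proof.
split=> [[a /near0P [e e0 af]]|/(an2P Kc) [a [r [r0 [M aM] fa]]]]; last first.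
  exists (fun i => a i 0%N); apply/near0P; exists r => // t /ltW tr.
  have := @fa (t, 0) tr; rewrite /= normr0 => -> //; last exact: ltW.
  have -> : series (fun i => a i 0%N * t ^+ i) = psum a (t, 0).
    apply/funext => n; rewrite /series /= big_mkord; apply: eq_bigr => i _.
    case: n i => [[]//|n] i; rewrite big_ord_recl /= mulr1 big1 ?addr0// => j _.
    by rewrite exprS mul0r mulr0.
  by apply: (evP Kc (ltW r0) aM) => //=; rewrite normr0 ltW.
pose r := e / 2.
have r0 : 0 < r by rewrite divr_gt0 ?ltr0n.
have re : r < e by rewrite /r ltr_pdivrMr ?ltr0n// ltr_pMr ?ltr1n.
have /cvg_series_cvg_0 /cvgr0Pnorm_lt /(_ 1 ltr01) [N _ hN] : cvgn (series (fun i => a i * r ^+ i)).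
  by apply/cvg_ex; exists (f r); apply: af; rewrite ger0_norm// ltW.
pose M : K := 1 + \sum_(i < N) `|a i * r ^+ i|.
have M1 : 1 <= M by rewrite lerDl sumr_ge0.
have aM i : `|a i| * r ^+ i <= M.
  have -> : `|a i| * r ^+ i = `|a i * r ^+ i| by rewrite normrM normrX (ger0_norm (ltW r0)).
  case: (leqP N i) => [/hN /= /ltW h|iN]; first exact: le_trans h M1.
  rewrite /M (bigD1 (Ordinal iN)) //= addrCA lerDl addr_ge0// sumr_ge0//.
pose A i j := if j is 0%N then a i else 0.
have bA : bounded_coefs A (r / 2).
  apply: (@bnd_geo _ _ _ M); first exact: ltW.
  move=> i [|j]; first by rewrite addn0; exact: aM.
  by rewrite normr0 mul0r (le_trans ler01).
apply/(an2P Kc); exists A, (r / 2); split=> //; first by rewrite divr_gt0 ?ltr0n.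
move=> z z1 z2; apply/esym/ev_lim.
have -> : psum A z = series (fun i => a i * z.1 ^+ i).
  apply/funext => n; rewrite /series /= big_mkord; apply: eq_bigr => i _.
  case: n i => [[]//|n] i; rewrite big_ord_recl /= mulr1 big1 ?addr0// => j _.
  by rewrite !mul0r.
by apply: af; apply: le_lt_trans (le_trans z1 (half_le r0)) re.
Qed.

End Inverse.

Lemma cvg_dnbhsP (K : numFieldType) (F : K -> K) (t l : K) :
  F s @[s --> t^'] --> l <->
  forall e, 0 < e -> exists2 d, 0 < d &
    forall s, `|s - t| < d -> s != t -> `|F s - l| < e.
Proof.
split=> [/cvgrPdist_lt H e /H /nbhs_ballP [d /= d0 h]|H].
  by exists d => // s sd st; rewrite distrC; apply: h => //; rewrite /ball /= distrC.
apply/cvgrPdist_lt => e /H [d d0 h]; apply/nbhs_ballP; exists d => // s.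
by rewrite /ball /= distrC => sd st; rewrite distrC; apply: h.
Qed.

Lemma is_derive_slope (K : numFieldType) (f : K -> K) (t l : K) :
  is_derive t 1 f l <-> (f s - f t) / (s - t) @[s --> t^'] --> l.
Proof.
split=> [[fd fl]|/cvg_dnbhsP H].
  have /cvg_dnbhsP H : h^-1 *: (f (h *: 1 + t) - f t) @[h --> 0^'] --> l by rewrite -fl.
  apply/cvg_dnbhsP => e /H [d d0 h]; exists d => // s sd st.
  have := h (s - t); rewrite subr0 subr_eq0 => /(_ sd st).
  by rewrite [_ *: 1]mulr1 subrK [_ *: _]mulrC.
have H' : h^-1 *: (f (h *: 1 + t) - f t) @[h --> (0:K)^'] --> l.
  apply/cvg_dnbhsP => e /H [d d0 h]; exists d => // s; rewrite subr0 => sd s0.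
  have := h (s + t); rewrite addrK -subr_eq0 addrK => /(_ sd s0).
  by rewrite [_ *: 1]mulr1 [_ *: _]mulrC.
apply: DeriveDef; first by apply/cvg_ex; exists l.
by apply: cvg_lim H'; exact: norm_hausdorff.
Qed.

Lemma is_derive1 (K : numFieldType) (f : K -> K) (t l : K) :
  is_derive t 1 f l -> derive1 f t = l.
Proof. by move=> fl; rewrite derive1E derive_val. Qed.

Section Analytic.
Variables (K : numFieldType) (Kc : abs_complete K).
Implicit Types (z : K * K) (h : K * K -> K) (f g : K -> K).

Lemma an2_slice h : analytic2_at0 h -> analytic2_at0 (fun z => h (0, z.2)).
Proof.
move=> /(an2_shift Kc) [_ [d [_ ad _ hd]]]; apply: an2_near ad.
by near=> z; apply/esym; near: z.
Unshelve. all: by end_near. Qed.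

Lemma an2_on_diag h : analytic2_at0 h -> analytic2_at0 (fun z => h (z.2, z.2)).
Proof.
move=> /(an2_diag Kc) [_ [d [_ ad _ hd]]]; apply: an2_near ad.
by near=> z; apply/esym; near: z.
Unshelve. all: by end_near. Qed.

Lemma an1_snd f : analytic_at0 f <-> analytic2_at0 (fun z => f z.2).
Proof.
split=> [/(an1P Kc) h|h]; first exact: (an2_swap Kc h).
by apply/(an1P Kc); exact: (an2_swap Kc h).
Qed.

Lemma an2_slice1 h : analytic2_at0 h -> analytic_at0 (fun t => h (t, 0)).
Proof.
by move=> /(an2_swap Kc) /an2_slice /(an2_swap Kc) /= h1; apply/(an1P Kc).
Qed.

Lemma an2_diag1 h : analytic2_at0 h -> analytic_at0 (fun t => h (t, t)).
Proof. by move=> /an2_on_diag ?; apply/an1_snd. Qed.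

Lemma an1_cst (c : K) : analytic_at0 (fun _ => c).
Proof. by apply/(an1P Kc); exact: an2_cst. Qed.

Lemma an1_id : analytic_at0 (fun t : K => t).
Proof. by apply/(an1P Kc); exact: an2_fst. Qed.

Lemma an1D f g : analytic_at0 f -> analytic_at0 g -> analytic_at0 (fun t => f t + g t).
Proof. by move=> /(an1P Kc) ? /(an1P Kc) ?; apply/(an1P Kc); exact: an2D. Qed.

Lemma an1M f g : analytic_at0 f -> analytic_at0 g -> analytic_at0 (fun t => f t * g t).
Proof. by move=> /(an1P Kc) ? /(an1P Kc) ?; apply/(an1P Kc); exact: an2M. Qed.

Lemma an1N f : analytic_at0 f -> analytic_at0 (fun t => - f t).
Proof. by move=> /(an1P Kc) ?; apply/(an1P Kc); exact: an2N. Qed.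

Lemma an1B f g : analytic_at0 f -> analytic_at0 g -> analytic_at0 (fun t => f t - g t).
Proof. by move=> ? /an1N; exact: an1D. Qed.

Lemma an1V f : analytic_at0 f -> f 0 != 0 -> analytic_at0 (fun t => (f t)^-1).
Proof. by move=> /(an1P Kc) h ?; apply/(an1P Kc); apply: (an2V Kc h). Qed.

Lemma an1X f n : analytic_at0 f -> analytic_at0 (fun t => f t ^+ n).
Proof.
move=> fa; elim: n => [|n IH]; first exact: an1_cst.
by under eq_fun do rewrite exprS; exact: an1M.
Qed.

Lemma an1_shift f : analytic_at0 f -> exists2 g, analytic_at0 g &
  \forall t \near (0 : K), f t = f 0 + t * g t.
Proof.
move=> /(an1P Kc) /(an2_shift Kc) [q [_ [aq _ /near00P [e e0 he] _]]].
exists (fun t => q (t, 0)); first exact: an2_slice1.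
apply/near0P; exists e => // t te; have /= := he (t, 0) te.
by rewrite normr0 => /(_ e0) <-; rewrite addrC subrK.
Qed.

Lemma an2_diag_cvg h : analytic2_at0 h ->
  \forall t \near (0 : K), h (s, t) @[s --> t^'] --> h (t, t).
Proof.
move=> ah; have [q [_ [aq _ /near00P [e e0 he] _]]] := an2_diag Kc ah.
have [C /near00P [c c0 hc]] := an2_bounded Kc aq.
have [d [d0 de dc]] := gt0_min2 e0 c0.
apply/near0P; exists d => // t td; apply/cvg_dnbhsP => eps eps0.
have C0 : 0 <= C by apply: le_trans (hc (0, 0) _ _); rewrite /= ?normr0.
have t0 : 0 < d - `|t| by rewrite subr_gt0.
have g0 : 0 < eps / (C + 1) by rewrite divr_gt0// ltr_wpDl.
have [u [u0 ut ug]] := gt0_min2 t0 g0.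
exists u => // s su _.
have sd : `|s| < d.
  rewrite -[s](subrK t); apply: le_lt_trans (ler_normD _ _) _.
  by rewrite -ltrBrDr; exact: lt_le_trans su ut.
have -> : h (s, t) - h (t, t) = (s - t) * q (s, t).
  by rewrite (he (s, t))//=; [exact: lt_le_trans sd de|exact: lt_le_trans td de].
rewrite normrM; apply: (@le_lt_trans _ _ (u * C)).
  rewrite ler_pM ?normr_ge0 ?(ltW su)// hc//; [exact: lt_le_trans sd dc|exact: lt_le_trans td dc].
rewrite (@lt_le_trans _ _ (u * (C + 1)))//; first by rewrite ltr_pM2l// ltrDl.
by rewrite -ler_pdivlMr// ltr_wpDl.
Qed.

Lemma an1_derive f : analytic_at0 f -> exists2 g, analytic_at0 g &
  \forall t \near (0 : K), is_derive (t : K) (1 : K) f (g t).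
Proof.
move=> /(an1P Kc) /(an2_diag Kc) [q [_ [aq _ /near00P [e e0 he] _]]].
exists (fun t => q (t, t)); first exact: an2_diag1.
have /near0P [d d0 hd] := an2_diag_cvg aq.
have [c [c0 ce cd]] := gt0_min2 e0 d0.
apply/near0P; exists c => // t tc; apply/is_derive_slope/cvg_dnbhsP => eps eps0.
have /hd/cvg_dnbhsP/(_ eps eps0) [u u0 hu] := lt_le_trans tc cd.
have t0 : 0 < c - `|t| by rewrite subr_gt0.
have [v [v0 vu vt]] := gt0_min2 u0 t0.
exists v => // s sv st.
have sc : `|s| < c.
  rewrite -[s](subrK t); apply: le_lt_trans (ler_normD _ _) _.
  by rewrite -ltrBrDr; exact: lt_le_trans sv vt.
rewrite (he (s, t))//=; [|exact: lt_le_trans sc ce|exact: lt_le_trans tc ce].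
rewrite mulrAC mulfV ?subr_eq0// mul1r; apply: hu => //; exact: lt_le_trans sv vu.
Qed.

Lemma an1_cvg f : analytic_at0 f -> \forall t \near (0 : K), f s @[s --> t^'] --> f t.
Proof. by move=> /(an1P Kc) /an2_diag_cvg. Qed.

End Analytic.

(** * Orders and meromorphic germs *)

Section Meromorphic.
Variables (K : numFieldType) (Kc : abs_complete K).
Implicit Types (z : K * K) (h F G : K * K -> K) (f g u : K -> K).

Definition hol f := exists2 g, analytic_at0 g & \forall t \near (0 : K)^', f t = g t.

Definition has_order (m : int) f := exists u,
  [/\ analytic_at0 u, u 0 != 0 & \forall t \near (0 : K)^', f t = u t * t ^ m].

Lemma hol_near f g : (\forall t \near (0 : K)^', f t = g t) -> hol f -> hol g.
Proof.
move=> fg [k ka fk]; exists k => //; near=> t.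
by rewrite -(near fg t)// (near fk t).
Unshelve. all: by end_near. Qed.

Lemma hol_an1 f : analytic_at0 f -> hol f.
Proof. by move=> fa; exists f => //; near=> t. Unshelve. all: by end_near. Qed.

Lemma hol_cst c : hol (fun _ => c).
Proof. exact: hol_an1 (an1_cst Kc c). Qed.

Lemma holD f g : hol f -> hol g -> hol (fun t => f t + g t).
Proof.
move=> [f' fa ff] [g' ga gg]; exists (fun t => f' t + g' t); first exact: an1D.
by near=> t; rewrite (near ff t)// (near gg t).
Unshelve. all: by end_near. Qed.

Lemma holM f g : hol f -> hol g -> hol (fun t => f t * g t).
Proof.
move=> [f' fa ff] [g' ga gg]; exists (fun t => f' t * g' t); first exact: an1M.
by near=> t; rewrite (near ff t)// (near gg t).
Unshelve. all: by end_near. Qed.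

Lemma holB f g : hol f -> hol g -> hol (fun t => f t - g t).
Proof.
move=> hf hg; have := holD hf (holM (hol_cst (-1)) hg); apply: hol_near.
by near=> t; rewrite mulN1r.
Unshelve. all: by end_near. Qed.

Lemma hol_sum (I : Type) (s : seq I) (f : I -> K -> K) :
  (forall i, hol (f i)) -> hol (fun t => \sum_(i <- s) f i t).
Proof.
move=> hf; elim: s => [|i s IH].
  by under eq_fun do rewrite big_nil; exact: hol_cst.
by under eq_fun do rewrite big_cons; exact: holD.
Qed.

Lemma holX f n : hol f -> hol (fun t => f t ^+ n).
Proof.
move=> hf; elim: n => [|n IH]; first exact: hol_cst.
by under eq_fun do rewrite exprS; exact: holM.
Qed.

Lemma order_near m f g : (\forall t \near (0 : K)^', f t = g t) -> has_order m f -> has_order m g.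
Proof.
move=> fg [u [ua u0 fu]]; exists u; split=> //; near=> t.
by rewrite -(near fg t)// (near fu t).
Unshelve. all: by end_near. Qed.

Lemma near0'_neq0 : \forall t \near (0 : K)^', t != 0.
Proof. by apply/near0'P; exists 1. Qed.

Lemma orderM m n f g : has_order m f -> has_order n g -> has_order (m + n) (fun t => f t * g t).
Proof.
move=> [u [ua u0 fu]] [v [va v0 gv]]; exists (fun t => u t * v t); split.
- exact: an1M.
- by rewrite mulf_neq0.
- near=> t; have t0 : t != 0 by near: t; exact: near0'_neq0.
  by rewrite (near fu t)// (near gv t)// expfzDr// mulrACA.
Unshelve. all: by end_near. Qed.

Lemma orderV m f : has_order m f -> has_order (- m) (fun t => (f t)^-1).
Proof.
move=> [u [ua u0 fu]]; exists (fun t => (u t)^-1); split.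
- exact: an1V.
- by rewrite invr_eq0.
- by near=> t; rewrite (near fu t)// invfM invr_expz.
Unshelve. all: by end_near. Qed.

Lemma order_an1 f : analytic_at0 f -> f 0 != 0 -> has_order 0 f.
Proof.
by move=> fa f0; exists f; split=> //; near=> t; rewrite expr0z mulr1.
Unshelve. all: by end_near. Qed.

Lemma order_cst c : c != 0 -> has_order 0 (fun _ => c).
Proof. by move=> c0; apply: order_an1 => //; exact: an1_cst. Qed.

Lemma orderX m f n : has_order m f -> has_order (m * n%:Z) (fun t => f t ^+ n).
Proof.
move=> hf; elim: n => [|n IH].
  by rewrite mulr0; apply: order_cst; exact: oner_neq0.
have -> : m * n.+1%:Z = m + m * n%:Z by rewrite intS mulrDr mulr1.
by under eq_fun do rewrite exprS; exact: orderM.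
Qed.

Lemma hol_order f m : has_order m f -> 0 <= m -> hol f.
Proof.
case: m => [n|n] [u [ua u0 fu]] // _; exists (fun t => u t * t ^+ n) => //.
by apply: (an1M Kc) => //; apply: (an1X Kc); exact: an1_id.
Qed.

Lemma an1_neq0 u : analytic_at0 u -> u 0 != 0 -> \forall t \near (0 : K), u t != 0.
Proof.
move=> ua u0; have /near0P [e e0 h] := an1_cvg Kc ua.
have h1 : u s @[s --> (0 : K)^'] --> u 0 by apply: h; rewrite normr0.
  have /cvg_dnbhsP/(_ `|u 0|) [|d d0 hd] := h1; rewrite ?normr_gt0//.
apply/near0P; exists d => // t td; have [->//|t0] := eqVneq t 0.
have := hd t; rewrite subr0 => /(_ td t0); apply: contraTneq => ->.
by rewrite sub0r normrN ltxx.
Qed.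

Lemma near0'_ex (P : K -> Prop) : (\forall t \near (0 : K)^', P t) -> exists t, P t.
Proof.
move=> /near0'P [w w0 hw]; exists (w / 2).
have w20 : 0 < w / 2 by rewrite divr_gt0 ?ltr0n.
by apply: hw; rewrite ?gt_eqF// gtr0_norm// ltr_pdivrMr ?ltr0n// ltr_pMr ?ltr1n.
Qed.

Lemma near0_near0' (P : K -> Prop) : (\forall t \near (0 : K), P t) -> \forall t \near (0 : K)^', P t.
Proof. by move=> /near0P [w w0 hw]; apply/near0'P; exists w => // t /hw. Qed.

Lemma an1_at0 u c : analytic_at0 u -> (\forall t \near (0 : K)^', u t = c) -> u 0 = c.
Proof.
move=> ua uc; apply/eqP; rewrite -subr_eq0; apply/negPn/negP => h0.
have /near0_near0' h1 := an1_neq0 (an1B Kc ua (an1_cst Kc c)) h0.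
have [t [/eqP]] : exists t, u t - c <> 0 /\ u t = c.
  apply: near0'_ex; near=> t; split; last by near: t.
  by apply/eqP; near: t.
by move=> h2 h3; rewrite h3 subrr eqxx in h2.
Unshelve. all: by end_near. Qed.

Lemma order_neq0 m f : has_order m f -> \forall t \near (0 : K)^', f t != 0.
Proof.
move=> [u [ua u0 fu]]; have /near0P [e e0 h] := an1_neq0 ua u0.
have /near0'P [d d0 hd] := fu; have [c [c0 ce cd]] := gt0_min2 e0 d0.
apply/near0'P; exists c => // t tc t0; rewrite hd//; last exact: lt_le_trans tc cd.
by rewrite mulf_neq0 ?expfz_neq0// h//; exact: lt_le_trans tc ce.
Qed.

Lemma simple_pole_split u : analytic_at0 u ->
  exists2 h, analytic_at0 h & \forall t \near (0 : K)^', u t / t = u 0 / t + h t.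
Proof.
move=> /(an1_shift Kc) [g ga /near0P [e e0 h]]; exists g => //.
apply/near0'P; exists e => // t te t0.
by rewrite h// mulrDl mulrAC mulfV// mul1r.
Qed.

Lemma is_derive_exprz (t : K) (m : int) : t != 0 ->
  is_derive t (1 : K) (fun s : K => s ^ m) (m%:~R * t ^ (m - 1)).
Proof.
move=> t0.
have P n : is_derive t (1 : K) (fun s : K => s ^+ n) (n%:R * t ^+ n.-1).
  have -> : (fun s : K => s ^+ n) = id ^+ n by apply/funext => s; rewrite exprfctE.
  by apply: is_derive_eq; rewrite /= [_ *: _]mulr1.
case: m => n.
  have := P n; congr is_derive; rewrite -[(Posz n)%:~R]/(n%:R).
  by case: n => [|n]; rewrite ?mul0r//= intS addrAC subrr add0r.
have d1 : derivable (fun s : K => s ^+ n.+1) t 1 by case: (P n.+1).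
have n0 : t ^+ n.+1 != 0 by rewrite expf_neq0.
apply: DeriveDef; first exact: derivableV.
rewrite deriveV//; case: (P n.+1) => _ -> /=.
have scaleE (a b : K) : a *: (b : K^o) = a * b by [].
rewrite scaleE NegzE intrN -[(Posz n.+1)%:~R]/(n.+1%:R).
have -> : (- n.+1%:Z - 1 : int) = - n.+2%:Z by lia.
rewrite -exprnN !mulNr; congr (- _).
rewrite mulrCA; congr (_ * _).
by rewrite !exprS; field; rewrite t0 expf_neq0.
Qed.

(* [c] is only there to allow [f = x], which is finite but nonzero at affine points. *)
Lemma order_is_derive f u c (m : int) : analytic_at0 u ->
  (\forall t \near (0 : K)^', f t = c + u t * t ^ m) ->
  exists2 v, analytic_at0 v & \forall t \near (0 : K)^',
    is_derive (t : K) (1 : K) f ((t * v t + m%:~R * u t) * t ^ (m - 1)).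
Proof.
move=> ua /near0'P [e e0 fu]; have [v va /near0P [d d0 hv]] := an1_derive Kc ua.
exists v => //; have [r [r0 re rd]] := gt0_min2 e0 d0.
apply/near0'P; exists r => // t tr t0.
have h1 : is_derive t (1 : K) (cst c + u * (fun s : K => s ^ m))
    ((t * v t + m%:~R * u t) * t ^ (m - 1)).
  have h2 := hv t (lt_le_trans tr rd); have h3 := is_derive_exprz m t0.
  have scaleE (a b : K) : a *: (b : K^o) = a * b by [].
  apply: is_derive_eq; rewrite add0r !scaleE.
  have -> : t ^ m = t * t ^ (m - 1) by rewrite -{2}[t]expr1z -expfzDr// addrC subrK.
  by ring.
apply: near_eq_is_derive h1; apply/nbhs_ballP.
have tr0 : 0 < r - `|t| by rewrite subr_gt0.
have tt0 : 0 < `|t| by rewrite normr_gt0.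
have [q [q0 q1 q2]] := gt0_min2 tr0 tt0.
exists q => // s; rewrite /ball /= => st.
have s0 : s != 0.
  by apply: contraTneq st => ->; rewrite subr0 le_gtF.
rewrite fu// -[s](subrK t); apply: lt_le_trans re.
apply: le_lt_trans (ler_normD _ _) _; rewrite -ltrBrDr distrC.
exact: lt_le_trans st q1.
Qed.

Lemma order_derive f u c (m : int) : analytic_at0 u -> u 0 != 0 -> m != 0 ->
  (\forall t \near (0 : K)^', f t = c + u t * t ^ m) -> exists w,
  [/\ analytic_at0 w, w 0 = m%:~R * u 0 &
     \forall t \near (0 : K)^', derive1 f t = w t * t ^ (m - 1)].
Proof.
move=> ua u0 m0 fu; have [v va hv] := order_is_derive ua fu.
exists (fun t => t * v t + m%:~R * u t); split.
- apply: (an1D Kc); apply: (an1M Kc) => //; [exact: an1_id|exact: an1_cst].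
- by rewrite mul0r add0r.
- by near=> t; apply: is_derive1; near: t.
Unshelve. all: by end_near. Qed.

Lemma is_derive_cvg f (t l : K) : is_derive t (1 : K) f l -> f s @[s --> t^'] --> f t.
Proof.
move=> /is_derive_slope fl.
have h : (f s - f t) / (s - t) * (s - t) + f t @[s --> t^'] --> l * 0 + f t.
  apply: cvgD; last exact: cvg_cst.
  apply: cvgM => //; apply/cvg_dnbhsP => e e0; exists e => // s; by rewrite subr0.
rewrite mulr0 add0r in h; apply/cvg_dnbhsP => e e0.
have [d d0 hd] := (cvg_dnbhsP _ _ _).1 h e e0.
exists d => // s sd st; have := hd s sd st.
by rewrite mulfVK ?subr_eq0// subrK.
Qed.

Definition mer2 F := exists (n : nat) h, analytic2_at0 h /\
  \forall z \near ((0, 0) : K * K), z.1 != 0 -> z.2 != 0 ->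
    F z = h z / (z.1 * z.2) ^+ n.

Lemma mer2_an2 h : analytic2_at0 h -> mer2 h.
Proof.
by move=> ah; exists 0%N, h; split=> //; near=> z => _ _; rewrite divr1.
Unshelve. all: by end_near. Qed.

Lemma mer2_cst c : mer2 (fun _ => c).
Proof. by apply: mer2_an2; exact: an2_cst. Qed.

Lemma mer2M F G : mer2 F -> mer2 G -> mer2 (fun z => F z * G z).
Proof.
move=> [m [f [fa hf]]] [n [g [ga hg]]].
exists (m + n)%N, (fun z => f z * g z); split; first exact: an2M.
near=> z => z1 z2; rewrite (near hf z)// (near hg z)// exprD.
by rewrite invfM mulrACA.
Unshelve. all: by end_near. Qed.

Lemma an2X h n : analytic2_at0 h -> analytic2_at0 (fun z => h z ^+ n).
Proof.
move=> ah; elim: n => [|n IH]; first exact: an2_cst.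
by under eq_fun do rewrite exprS; exact: an2M.
Qed.

Lemma an2_prod : analytic2_at0 (fun z : K * K => z.1 * z.2).
Proof. by apply: (an2M Kc); [exact: an2_fst|exact: an2_snd]. Qed.

Lemma mer2D F G : mer2 F -> mer2 G -> mer2 (fun z => F z + G z).
Proof.
move=> [m [f [fa hf]]] [n [g [ga hg]]].
exists (m + n)%N, (fun z => f z * (z.1 * z.2) ^+ n + g z * (z.1 * z.2) ^+ m); split.
  by apply: (an2D Kc); apply: (an2M Kc) => //; apply: an2X; exact: an2_prod.
near=> z => z1 z2; rewrite (near hf z)// (near hg z)// exprD.
have ? : (z.1 * z.2) ^+ m != 0 by rewrite expf_neq0// mulf_neq0.
have ? : (z.1 * z.2) ^+ n != 0 by rewrite expf_neq0// mulf_neq0.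
by field; apply/andP.
Unshelve. all: by end_near. Qed.

Lemma mer2_near F G : (\forall z \near ((0, 0) : K * K), z.1 != 0 -> z.2 != 0 -> F z = G z) ->
  mer2 F -> mer2 G.
Proof.
move=> FG [n [h [ah Fh]]]; exists n, h; split=> //; near=> z => z1 z2.
by rewrite -(near FG z)// (near Fh z).
Unshelve. all: by end_near. Qed.

Lemma mer2B F G : mer2 F -> mer2 G -> mer2 (fun z => F z - G z).
Proof.
move=> hF hG; have := mer2D hF (mer2M (mer2_cst (-1)) hG).
by apply: mer2_near; near=> z => _ _; rewrite mulN1r.
Unshelve. all: by end_near. Qed.

Lemma mer2_sum (I : Type) (s : seq I) (F : I -> K * K -> K) :
  (forall i, mer2 (F i)) -> mer2 (fun z => \sum_(i <- s) F i z).
Proof.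
move=> hF; elim: s => [|i s IH].
  by under eq_fun do rewrite big_nil; exact: mer2_cst.
by under eq_fun do rewrite big_cons; exact: mer2D.
Qed.

Lemma mer2X F n : mer2 F -> mer2 (fun z => F z ^+ n).
Proof.
move=> hF; elim: n => [|n IH]; first exact: mer2_cst.
by under eq_fun do rewrite exprS; exact: mer2M.
Qed.

Lemma mer2_poly (p : {poly K}) F : mer2 F -> mer2 (fun z => p.[F z]).
Proof.
move=> hF; under eq_fun do rewrite horner_coef.
by apply: mer2_sum => i; apply: mer2M; [exact: mer2_cst|exact: mer2X].
Qed.

Lemma mer2_swap F : mer2 F -> mer2 (fun z => F (z.2, z.1)).
Proof.
move=> [n [h [ah /near00P [e e0 Fh]]]]; exists n, (fun z => h (z.2, z.1)); split.
  exact: an2_swap.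
by apply/near00P; exists e => // z z1 z2 n1 n2; rewrite Fh//= [z.2 * z.1]mulrC.
Qed.

Lemma mer2_fst f : hol f \/ (exists m, has_order m f) -> mer2 (fun z => f z.1).
Proof.
case=> [[g /(an1P Kc) ga /near0'P [e e0 fg]]|[m [u [/(an1P Kc) ua _ /near0'P [e e0 fu]]]]].
  apply: mer2_near (mer2_an2 ga).
  by apply/near00P; exists e => // z z1 _ n1 _; rewrite fg.
apply: (@mer2_near (fun z => u z.1 * z.1 ^ m)).
  by apply/near00P; exists e => // z z1 _ n1 _; rewrite fu.
apply: mer2M; first exact: mer2_an2.
case: m {fu} => n; first by apply: mer2X; apply: mer2_an2; exact: an2_fst.
exists n.+1, (fun z => z.2 ^+ n.+1); split; first by apply: an2X; exact: an2_snd.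
near=> z => z1 z2.
by rewrite NegzE -exprnN exprMn invfM mulrCA mulfV ?mulr1 ?expf_neq0.
Unshelve. all: by end_near. Qed.

Lemma mer2_snd f : hol f \/ (exists m, has_order m f) -> mer2 (fun z => f z.2).
Proof. by move=> /mer2_fst /mer2_swap. Qed.

Lemma an2_clear h n : analytic2_at0 h ->
  (\forall y \near (0 : K)^', exists C, \forall x \near (0 : K)^',
     `|h (x, y)| <= C * `|x| ^+ n) ->
  exists2 k, analytic2_at0 k & \forall z \near ((0, 0) : K * K), h z = z.1 ^+ n * k z.
Proof.
elim: n h => [|n IH] h ah hC.
  by exists h => //; near=> z; rewrite mul1r.
have [q [d [aq ad hq hd]]] := an2_shift Kc ah.
have [B /near00P [r r0 qB]] := an2_bounded Kc aq.
have /near00P [e e0 hqe] := hq.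
have h0 : \forall y \near (0 : K)^', h (0, y) = 0.
  have /near0'P [c c0 hc] := hC.
  have [s [s0 sr sc]] := gt0_min2 r0 c0; have [s' [s'0 s's s'e]] := gt0_min2 s0 e0.
  apply/near0'P; exists s' => // y ys y0.
  have yc : `|y| < c by apply: lt_le_trans ys (le_trans s's sc).
  have yr : `|y| < r by apply: lt_le_trans ys (le_trans s's sr).
  have ye : `|y| < e by apply: lt_le_trans ys s'e.
  have [C /near0'P [v v0 hv]] := hc y yc y0.
  have [w [w0 wv ws]] := gt0_min2 v0 s'0.
  pose A := `|C| + `|B| + 1.
  have A0 : 0 < A by rewrite ltr_wpDl// addr_ge0.
  have [//|hn0] := eqVneq (h (0, y)) 0; exfalso.
  have H0 : 0 < `|h (0, y)| by rewrite normr_gt0.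
  have H1 : 0 < `|h (0, y)| / A by rewrite divr_gt0.
  have [x [x0 xw xH]] := gt0_min2 w0 H1.
  have [x' [x'0 x'x x'1]] := gt0_min2 x0 (ltr01).
  pose x2 := x' / 2.
  have x20 : 0 < x2 by rewrite divr_gt0 ?ltr0n.
  have x2lt : x2 < x' by rewrite ltr_pdivrMr ?ltr0n// ltr_pMr ?ltr1n.
  have nx : `|x2| = x2 by rewrite ger0_norm// ltW.
  have x2w : x2 < w by apply: lt_le_trans x2lt (le_trans x'x xw).
  have k1 := hv x2; rewrite nx (lt_le_trans x2w wv) (gt_eqF x20) in k1.
  have {}k1 := k1 isT isT.
  have x2s := lt_le_trans x2w ws.
  have k2 := hqe (x2, y); rewrite /= nx (lt_le_trans x2s s'e) in k2.
  have {}k2 := k2 isT ye.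
  have k3 := qB (x2, y); rewrite /= nx (lt_le_trans x2s (le_trans s's sr)) in k3.
  have {}k3 := k3 isT yr.
  have : `|h (0, y)| < `|h (0, y)|.
    have e1 : h (0, y) = h (x2, y) - x2 * q (x2, y) by rewrite -k2 opprB addrC subrK.
    rewrite {1}e1; apply: (@le_lt_trans _ _ (x2 * (`|C| + `|B|))).
      apply: le_trans (ler_normB _ _) _; rewrite mulrDr; apply: lerD; last first.
        rewrite normrM nx ler_wpM2l ?(ltW x20)//; apply: (le_trans k3).
        by rewrite real_ler_norm// ger0_real// (le_trans _ k3).
      have C0 : 0 <= C by rewrite -(pmulr_lge0 _ (exprn_gt0 n.+1 x20)) (le_trans _ k1).
      apply: (le_trans k1); rewrite (ger0_norm C0) mulrC ler_wpM2r// exprS ler_piMr ?(ltW x20)// exprn_ile1 ?(ltW x20)//.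
      exact: ltW (lt_le_trans x2lt x'1).
    apply: (@lt_le_trans _ _ (x2 * A)); first by rewrite ltr_pM2l// ltrDl.
    by rewrite -ler_pdivlMr// (le_trans (ltW x2lt))// (le_trans x'x).
  by rewrite ltxx.
have h0' : \forall z \near ((0, 0) : K * K), h z = z.1 * q z.
  have ah0 : analytic_at0 (fun y => h (0, y)) by apply/(an1_snd Kc); exact: an2_slice ah.
  have h00 : h (0, 0) = 0 := an1_at0 ah0 h0.
  have /near0'P [c c0 hc] := h0; have [w [w0 wc we]] := gt0_min2 c0 e0.
  apply/near00P; exists w => // z z1 z2.
  rewrite -hqe ?(lt_le_trans z1)// ?(lt_le_trans z2)//.
  have [->|y0] := eqVneq z.2 0; first by rewrite h00 subr0.
  by rewrite hc ?subr0// (lt_le_trans z2).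
have [|k ak hk] := IH q aq.
  have /near0'P [c c0 hc] := hC; have /near00P [e' e'0 he'] := h0'.
  have [w [w0 wc we]] := gt0_min2 c0 e'0.
  apply/near0'P; exists w => // y yw y0.
  have [C /near0'P [v v0 hv]] := hc y (lt_le_trans yw wc) y0.
  exists C; have [v' [v'0 v'v v'w]] := gt0_min2 v0 w0.
  apply/near0'P; exists v' => // x xv x0.
  have := hv x (lt_le_trans xv v'v) x0.
  rewrite he'//= ?(lt_le_trans yw we)// ?(lt_le_trans xv (le_trans v'w we))//.
  by rewrite normrM exprS mulrCA ler_pM2l// normr_gt0.
exists k => //; near=> z; rewrite (near h0' z)// (near hk z)//.
by rewrite exprS mulrA.
Unshelve. all: by end_near. Qed.

Lemma an2_diag_expand h : analytic2_at0 h ->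
  (\forall t \near (0 : K)^', h (t, t) = 1) ->
  (\forall t \near (0 : K)^', \forall s \near t^', h (s, t) = h (t, s)) ->
  exists2 k, analytic2_at0 k &
    \forall z \near ((0, 0) : K * K), h z = 1 + (z.1 - z.2) ^+ 2 * k z.
Proof.
move=> ah h1 hs.
have [q [_ [aq _ hq _]]] := an2_diag Kc ah.
have ah1 := an2_diag1 Kc ah.
have h00 : h (0, 0) = 1 := an1_at0 ah1 h1.
have [q2 [_ [aq2 _ hq2 _]]] := an2_diag Kc aq.
have h1' : forall e : K, 0 < e -> (forall t : K, `|t| < e -> t != 0 -> h (t, t) = 1) ->
    forall t : K, `|t| < e -> h (t, t) = 1.
  by move=> e e0 he t te; have [->//|] := eqVneq t 0; exact: he.
have /near00P [e e0 he] := hq.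
have qt : \forall t \near (0 : K)^', q (t, t) = 0.
  have /near0P [c1 c10 hc1] := an2_diag_cvg Kc aq.
  have /near0P [c2 c20 hc2] := an2_diag_cvg Kc (an2_swap Kc aq).
  have /near0'P [c3 c30 hc3'] := h1; have hc3 := h1' _ c30 hc3'; have /near0'P [c4 c40 hc4] := hs.
  have [d1 [d10 d11 d12]] := gt0_min2 c10 c20; have [d2 [d20 d21 d22]] := gt0_min2 c30 c40.
  have [d3 [d30 d31 d32]] := gt0_min2 d10 d20; have [d [d0 d31' de]] := gt0_min2 d30 e0.
  apply/near0'P; exists d => // t td t0.
  have L (a b : K) : d3 <= a -> `|b| < d -> `|b| < a by move=> ? bd; apply: lt_le_trans bd (le_trans d31' _).
  have k1 := hc1 t (L _ _ (le_trans d31 d11) td); have k2 := hc2 t (L _ _ (le_trans d31 d12) td).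
  have k3 := hc3 t (L _ _ (le_trans d32 d21) td).
  have /nbhs_ballP [v /= v0 hv] := hc4 t (L _ _ (le_trans d32 d22) td) t0.
  have td0 : 0 < d - `|t| by rewrite subr_gt0.
  have [w [w0 wv wd]] := gt0_min2 v0 td0.
  have k5 s : `|s - t| < w -> s != t -> q (s, t) + q (t, s) = 0.
    move=> sw st; have sd : `|s| < d.
      rewrite -[s](subrK t); apply: le_lt_trans (ler_normD _ _) _.
      by rewrite -ltrBrDr; exact: lt_le_trans sw wd.
    have e1 := he (s, t) (lt_le_trans sd de) (lt_le_trans td de).
    have e2 := he (t, s) (lt_le_trans td de) (lt_le_trans sd de).
    rewrite /= k3 in e1; rewrite /= (hc3 s) ?(L _ _ (le_trans d32 d21))// in e2.
    have e3 : h (s, t) = h (t, s).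
      by apply: hv => //; rewrite /ball /= distrC; exact: lt_le_trans sw wv.
    apply: (mulfI (x := s - t)); first by rewrite subr_eq0.
    by rewrite mulrDr mulr0 -e1 -[s - t]opprB mulNr -e2 e3 subrr.
  have k6 : q (s, t) + q (t, s) @[s --> t^'] --> q (t, t) + q (t, t) by apply: cvgD.
  apply/eqP; rewrite -[_ == 0](mulrn_eq0 _ 2) mulr2n; apply/eqP.
  apply: cvg_unique k6 _; first exact: norm_hausdorff.
  apply/cvg_dnbhsP => eps eps0; exists w => // s sw st.
  by rewrite k5// subr0 normr0.
have q00 : q (0, 0) = 0 := an1_at0 (an2_diag1 Kc aq) qt.
exists q2 => //.
have /near00P [e2 e20 he2] := hq2.
have /near0'P [c c0 hc] := qt; have /near0'P [c' c'0 hc0'] := h1; have hc' := h1' _ c'0 hc0'.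
have [d1 [d10 d1e d1e2]] := gt0_min2 e0 e20; have [d2 [d20 d2c d2c']] := gt0_min2 c0 c'0.
have [d [d0 dd1 dd2]] := gt0_min2 d10 d20.
apply/near00P; exists d => // z z1 z2.
have L (a b : K) : d <= a -> `|b| < d -> `|b| < a by move=> ? bd; apply: lt_le_trans bd _.
have a1 := he z (L _ _ (le_trans dd1 d1e) z1) (L _ _ (le_trans dd1 d1e) z2).
have a2 := he2 z (L _ _ (le_trans dd1 d1e2) z1) (L _ _ (le_trans dd1 d1e2) z2).
rewrite hc' ?(L _ _ (le_trans dd2 d2c'))// in a1.
have a3 : q (z.2, z.2) = 0.
  have [->//|y0] := eqVneq z.2 0; apply: hc => //; exact: L _ _ (le_trans dd2 d2c) z2.
by rewrite a3 subr0 in a2; rewrite -[h z](subrK 1) a1 a2 expr2 mulrA addrC.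
Qed.

End Meromorphic.

Lemma normc_ge_Im (R : rcfType) (z : R[i]) : (`|complex.Im z|%:C)%C <= `|z|.
Proof. by rewrite normc_def lecR -sqrtr_sqr ler_wsqrtr// lerDr sqr_ge0. Qed.

Lemma normc_le_ReIm (R : rcfType) (z : R[i]) :
  `|z| <= ((`|complex.Re z| + `|complex.Im z|)%:C)%C.
Proof.
rewrite normc_def lecR.
have h : 0 <= `|complex.Re z| + `|complex.Im z| by rewrite addr_ge0.
rewrite -(ger0_norm h) -(sqrtr_sqr (_ + _)) ler_wsqrtr// sqrrD !real_normK ?num_real//.
by rewrite lerD2r lerDl mulrn_wge0// mulr_ge0.
Qed.

Lemma abs_completeP (K : numFieldType) :
  (forall u : nat -> K, (exists M, forall n, \sum_(i < n) `|u i| <= M) ->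
     exists l, forall e, 0 < e -> exists N, forall n, (N <= n)%N ->
       `|l - \sum_(i < n) u i| < e) ->
  abs_complete K.
Proof.
move=> H u /H [l hl]; apply/cvg_ex; exists l; apply/cvgrPdist_lt => e /hl [N hN].
by exists N => // n /= /hN; rewrite /series /= big_mkord.
Qed.

Lemma abs_complete_complex (R : realType) : abs_complete R[i].
Proof.
apply: abs_completeP => u [M uM].
have part (p : {additive R[i] -> R}) (pu : forall z, (`|p z|%:C)%C <= `|z|) :
    cvgn (series (fun n => p (u n))).
  apply: normed_cvg; apply: nondecreasing_is_cvgn.
    apply/nondecreasing_seqP => n.
    by rewrite -subr_ge0 seriesSB; exact: normr_ge0.
  exists (complex.Re M) => _ [n _ <-].
  have h : ((\sum_(i < n) `|p (u i)|)%:C)%C <= M.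
    apply: le_trans (uM n); rewrite rmorph_sum; apply: ler_sum => i _; exact: pu.
  move: h; rewrite lecE => /andP [_] /=.
  by rewrite /series /= big_mkord.
have /cvg_ex [a /= ha] := part (@complex.Re R) (@normc_ge_Re R).
have /cvg_ex [b /= hb] := part (@complex.Im R) (@normc_ge_Im R).
exists (a +i* b)%C => e e0.
have [e1 e2] : 0 < complex.Re e /\ e = ((complex.Re e)%:C)%C.
  move: e0; rewrite ltcE => /andP [/eqP /= i0 r0]; split=> //.
  by apply/eqP; rewrite eq_complex /= i0 !eqxx.
have e3 : 0 < complex.Re e / 2 by rewrite divr_gt0.
move/cvgrPdist_lt: ha => /(_ _ e3) [N1 _ ha]; move/cvgrPdist_lt: hb => /(_ _ e3) [N2 _ hb].
exists (maxn N1 N2) => n; rewrite geq_max => /andP [n1 n2].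
rewrite e2; apply: le_lt_trans (normc_le_ReIm _) _; rewrite ltcR.
have pE (p : {additive R[i] -> R}) : series (fun n => p (u n)) n = p (\sum_(i < n) u i).
  by rewrite /series /= big_mkord raddf_sum.
rewrite [complex.Re e]splitr !raddfB /= -!(pE (@complex.Re R)) -!(pE (@complex.Im R)).
by apply: ltrD; [exact: ha | exact: hb].
Qed.

(** * Algebra of the curve *)

Section DividedDifferences.
Variable K : fieldType.
Implicit Types (p q : {poly K}) (x y : K) (n : nat).

Definition ddX n x y : K := \sum_(j < n) x ^+ (n.-1 - j) * y ^+ j.
Definition ddX2 n x y : K := \sum_(j < n) y ^+ j * ddX (n.-1 - j) x y.
Definition dd p x y : K := \sum_(i < size p) p`_i * ddX i x y.
Definition dd2 p x y : K := \sum_(i < size p) p`_i * ddX2 i x y.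

Lemma ddXE n x y : x ^+ n - y ^+ n = (x - y) * ddX n x y.
Proof. by rewrite subrXX. Qed.

Lemma ddX2E n x y : ddX n x y = n%:R * y ^+ n.-1 + (x - y) * ddX2 n x y.
Proof.
have -> : n%:R * y ^+ n.-1 = \sum_(j < n) y ^+ n.-1 by rewrite sumr_const card_ord mulr_natl.
rewrite mulr_sumr -big_split.
apply: eq_bigr => j _ /=; rewrite mulrCA -ddXE mulrBr -exprD.
have /subnKC -> : (j <= n.-1)%N by rewrite -ltnS (leq_trans (ltn_ord j))//; exact: leqSpred.
by rewrite addrC subrK mulrC.
Qed.

Lemma ddE p x y : p.[x] - p.[y] = (x - y) * dd p x y.
Proof.
rewrite !horner_coef -sumrB mulr_sumr; apply: eq_bigr => i _.
by rewrite -mulrBr ddXE mulrCA.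
Qed.

Lemma dd2E p x y : dd p x y = p^`().[y] + (x - y) * dd2 p x y.
Proof.
have -> : p^`().[y] = \sum_(i < size p) p`_i * (i%:R * y ^+ i.-1).
  rewrite -{1}[p]coefK poly_def raddf_sum horner_sum /=.
  by apply: eq_bigr => i _; rewrite derivZ derivXn hornerZ hornerMn hornerXn mulr_natl.
rewrite mulr_sumr -big_split; apply: eq_bigr => i _ /=.
by rewrite ddX2E; ring.
Qed.

End DividedDifferences.

Section Numerator.
Variable K : fieldType.

(* [rho], [rho1], [rho2] stand for [p.[y]], [dd p x y], [dd2 p x y] and
   [rho'] for [p'.[y]]; likewise [sig...] for [q]; [a], [c] for the values of
   y_r and [d] for [x - y]. *)
Variables d a c rho rho' rho1 rho2 sig sig' sig1 sig2 : K.
Let A := 2 * sig' * rho + sig * rho'.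
Let B := 2 * rho' * sig + rho * sig'.
Let rhoP := rho + d * rho1.
Let sigP := sig + d * sig1.
Let L := rho1 * (rhoP + rho) * sigP + rho ^+ 2 * sig1.
Let L' := rho2 * (2 * rho + d * rho1) * sigP + rho' * rho1 * sigP
  + 2 * rho * rho' * sig1 + rho ^+ 2 * sig2.

Definition num0 := d * (a * c ^+ 2 * A * rhoP + a ^+ 2 * c * B * rho)
  + 3 * rho * sig * (rho * (a ^+ 3 + a ^+ 2 * c) + rhoP * a * c ^+ 2).

Definition num1 := (a - c) * (a * c ^+ 2 * A * rhoP + a ^+ 2 * c * B * rho)
  + 3 * rho * sig * (rho * a * L + rho1 * a * c ^+ 2 * (a - c)).

Definition num2 :=
  L * (A * rhoP * c ^+ 2 + B * rho * (a * c - 2 * c ^+ 2) + 3 * rho * sig * rho1 * c ^+ 2)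
  + A * rho1 * (rho ^+ 2 * sig) * (c ^+ 2 - 2 * a ^+ 2 + a * c)
  + 3 * rho ^+ 2 * sig * L' * (a ^+ 2 - a * c)
  + 3 * rho * sig * rho2 * (rho ^+ 2 * sig) * (c ^+ 2 - 2 * a ^+ 2 + a * c).

Hypothesis ha : a ^+ 3 = rhoP ^+ 2 * sigP.
Hypothesis hc : c ^+ 3 = rho ^+ 2 * sig.
Hypothesis hrho : rho1 = rho' + d * rho2.
Hypothesis hsig : sig1 = sig' + d * sig2.

Lemma num0_eq : (a - c) * num0 = d * num1.
Proof.
have e : a ^+ 3 - c ^+ 3 = d * L by rewrite ha hc /L /rhoP /sigP; ring.
suff : (a - c) * num0 - d * num1 = 3 * rho ^+ 2 * sig * a * (a ^+ 3 - c ^+ 3 - d * L).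
  by rewrite e subrr mulr0 => /eqP; rewrite subr_eq0 => /eqP.
rewrite /num0 /num1 /rhoP; ring.
Qed.

Lemma num1_eq : (a - c) * num1 = d * num2.
Proof.
have e : a ^+ 3 - c ^+ 3 = d * L by rewrite ha hc /L /rhoP /sigP; ring.
move: ha; rewrite /num1 /num2 /L' /L /A /B /rhoP /sigP hrho hsig => ha'.
ring: ha' hc.
Qed.
End Numerator.

Section CurveAlgebra.
Variable K : numFieldType.
Implicit Types (p q : {poly K}) (P Q : pt K).

Definition curve_of p q : set (pt K) :=
  [set P | [/\ yr P ^+ 2 = ys P * p.[xc P], yr P * ys P = p.[xc P] * q.[xc P] &
    ys P ^+ 2 = yr P * q.[xc P]]].

(* Exchanging r and s exchanges y_rhat and y_shat. *)
Definition swap_y P : pt K := (xc P, ys P, yr P).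

(* Numerator of [d_Q Sigma] over [9 (x_P - x_Q)^2 y_r y_s (P) y_r y_s (Q)]. *)
Definition Gnum p q P Q : K :=
  (xc P - xc Q) *
    (yr P * ys Q * (2 * q^`().[xc Q] * p.[xc Q] + q.[xc Q] * p^`().[xc Q]) +
     ys P * yr Q * (2 * p^`().[xc Q] * q.[xc Q] + p.[xc Q] * q^`().[xc Q]))
  + 3 * (yr Q * ys Q) * (yr P * ys P + yr P * ys Q + ys P * yr Q).

Lemma Gnum_swap p q P Q : Gnum q p (swap_y P) (swap_y Q) = Gnum p q P Q.
Proof. by rewrite /Gnum /swap_y /xc /yr /ys /=; ring. Qed.

Lemma curve_swap p q P : curve_of p q P -> curve_of q p (swap_y P).
Proof.
move=> [h1 h2 h3]; split; rewrite /swap_y /xc /yr /ys /= in h1 h2 h3 *.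
- by rewrite h3.
- by rewrite mulrC h2 mulrC.
- by rewrite h1.
Qed.

Lemma curve_yr3 p q P : curve_of p q P -> yr P ^+ 3 = p.[xc P] ^+ 2 * q.[xc P].
Proof. by move=> [h1 h2 h3]; rewrite exprS h1 mulrA h2; ring. Qed.

Lemma curve_ys3 p q P : curve_of p q P -> ys P ^+ 3 = q.[xc P] ^+ 2 * p.[xc P].
Proof. by move=> /curve_swap /curve_yr3. Qed.

Definition num0_at p q P Q := num0 (xc P - xc Q) (yr P) (yr Q) p.[xc Q] p^`().[xc Q]
  (dd p (xc P) (xc Q)) q.[xc Q] q^`().[xc Q].

Definition num1_at p q P Q := num1 (xc P - xc Q) (yr P) (yr Q) p.[xc Q] p^`().[xc Q]
  (dd p (xc P) (xc Q)) q.[xc Q] q^`().[xc Q] (dd q (xc P) (xc Q)).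

Definition num2_at p q P Q := num2 (xc P - xc Q) (yr P) (yr Q) p.[xc Q] p^`().[xc Q]
  (dd p (xc P) (xc Q)) (dd2 p (xc P) (xc Q)) q.[xc Q] q^`().[xc Q]
  (dd q (xc P) (xc Q)) (dd2 q (xc P) (xc Q)).

Definition diag_num p q M P Q : K :=
  let e := - ddX M (xc P) (xc Q) in
  (xc P ^+ M) ^+ 2 * num2_at p q P Q + 2 * xc P ^+ M * e * yr P * num1_at p q P Q
  + e ^+ 2 * yr P ^+ 2 * num0_at p q P Q.

(* [yr / x^M] is a local parameter on which the squared difference kills the
   double pole of [Gnum / (x_P - x_Q)^2] along the diagonal and along the
   conjugate sheets. *)
Lemma Gnum_diag p q M P Q : curve_of p q P -> curve_of p q Q ->
  (xc Q ^+ M * yr P - xc P ^+ M * yr Q) ^+ 2 * (p.[xc P] * p.[xc Q] * Gnum p q P Q) =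
  (xc P - xc Q) ^+ 2 * diag_num p q M P Q.
Proof.
move=> cP cQ; have [P1 P2 P3] := cP; have [Q1 Q2 Q3] := cQ.
have ep : p.[xc P] = p.[xc Q] + (xc P - xc Q) * dd p (xc P) (xc Q) by rewrite -ddE addrC subrK.
have eq : q.[xc P] = q.[xc Q] + (xc P - xc Q) * dd q (xc P) (xc Q) by rewrite -ddE addrC subrK.
have ha := curve_yr3 cP; have hc := curve_yr3 cQ; rewrite ep eq in ha.
have hp := dd2E p (xc P) (xc Q); have hq := dd2E q (xc P) (xc Q).
have E0 : p.[xc P] * p.[xc Q] * Gnum p q P Q = num0_at p q P Q.
  have -> : p.[xc P] * p.[xc Q] * Gnum p q P Q = (xc P - xc Q) *
    (yr P * (ys Q * p.[xc Q]) * (2 * q^`().[xc Q] * p.[xc Q] + q.[xc Q] * p^`().[xc Q]) * p.[xc P] +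
     (ys P * p.[xc P]) * yr Q * (2 * p^`().[xc Q] * q.[xc Q] + p.[xc Q] * q^`().[xc Q]) * p.[xc Q])
    + 3 * (yr Q * ys Q) * (yr P * (ys P * p.[xc P]) * p.[xc Q] +
      yr P * (ys Q * p.[xc Q]) * p.[xc P] + (ys P * p.[xc P]) * yr Q * p.[xc Q]).
    by rewrite /Gnum; ring.
  by rewrite -P1 -Q1 Q2 /num0_at /num0 ep; ring.
have E1 : (yr P - yr Q) * num0_at p q P Q = (xc P - xc Q) * num1_at p q P Q.
  exact: num0_eq ha hc.
have E2 : (yr P - yr Q) * num1_at p q P Q = (xc P - xc Q) * num2_at p q P Q.
  exact: num1_eq ha hc hp hq.
have -> : xc Q ^+ M * yr P - xc P ^+ M * yr Q =
    xc P ^+ M * (yr P - yr Q) - (xc P - xc Q) * ddX M (xc P) (xc Q) * yr P.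
  by rewrite -ddXE; ring.
rewrite E0 /diag_num; set n0 := num0_at _ _ _ _ in E1 *; set n1 := num1_at _ _ _ _ in E1 E2 *.
set n2 := num2_at _ _ _ _ in E2 *; set X := xc P ^+ M; set d := xc P - xc Q in E1 E2 *.
set D := ddX _ _ _; set y := yr P - yr Q in E1 E2 *.
have -> : (X * y - d * D * yr P) ^+ 2 * n0 = X ^+ 2 * (y * (y * n0))
   - 2 * X * d * D * yr P * (y * n0) + d ^+ 2 * D ^+ 2 * yr P ^+ 2 * n0 by ring.
rewrite E1 [y * (d * n1)]mulrCA E2; ring.
Qed.

Lemma curve_eq p q P Q : curve_of p q P -> curve_of p q Q -> yr P != 0 ->
  xc P = xc Q -> yr P = yr Q -> P = Q.
Proof.
move=> [_ h2 _] [_ k2 _] y0 ex ey; have : yr P * ys P = yr P * ys Q.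
  by rewrite h2 ex -k2 ey.
move/(mulfI y0); case: P Q {h2 k2 y0} ex ey => [[a b] c] [[a' b'] c'].
by rewrite /xc /yr /ys /= => -> -> ->.
Qed.

Lemma conj_sheet p q P Q : curve_of p q P -> curve_of p q Q -> yr P != 0 ->
  xc P = xc Q -> P <> Q -> yr P * ys P + yr P * ys Q + ys P * yr Q = 0.
Proof.
move=> cP cQ y0 ex PQ; have [h1 h2 _] := cP; have [k1 _ _] := cQ.
have ne : yr P - yr Q != 0.
  by apply/eqP => /eqP; rewrite subr_eq0 => /eqP ey; apply: PQ; exact: curve_eq cP cQ y0 ex ey.
have p0 : p.[xc P] != 0.
  by apply: contra_neq y0 => p0; move: h1; rewrite p0 mulr0 => /eqP; rewrite expf_eq0 => /eqP.
have e3 : yr P ^+ 3 = yr Q ^+ 3 by rewrite (curve_yr3 cP) (curve_yr3 cQ) ex.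
apply: (mulfI (mulf_neq0 ne p0)).
have -> : (yr P - yr Q) * p.[xc P] * (yr P * ys P + yr P * ys Q + ys P * yr Q) =
   (yr P - yr Q) * (yr P * (ys P * p.[xc P]) + yr P * (ys Q * p.[xc P])
     + (ys P * p.[xc P]) * yr Q) by ring.
rewrite -h1 ex -k1 mulr0.
have -> : (yr P - yr Q) * (yr P * yr P ^+ 2 + yr P * yr Q ^+ 2 + yr P ^+ 2 * yr Q) =
  yr P * (yr P ^+ 3 - yr Q ^+ 3) by ring.
by rewrite e3 subrr mulr0.
Qed.

End CurveAlgebra.

(** * The derivative of Sigma along the curve *)

Lemma cvg_near_eq (K : numFieldType) (T : Type) (F : set_system T) {FF : Filter F}
    (f g : T -> K) (l : K) : (\forall x \near F, f x = g x) ->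
  f x @[x --> F] --> l -> g x @[x --> F] --> l.
Proof.
move=> fg /cvgrPdist_lt fl; apply/cvgrPdist_lt => e e0.
by apply: filterS2 fg (fl e e0) => x ->.
Qed.

Lemma is_derive_horner (K : numFieldType) (p : {poly K}) (x : K) :
  is_derive x (1 : K) (horner p) p^`().[x].
Proof.
elim/poly_ind: p => [|p c IH].
  have -> : horner (0 : {poly K}) = cst 0 by apply/funext => y; rewrite horner0.
  by rewrite deriv0 horner0; exact: is_derive_cst.
have -> : horner (p * 'X + c%:P) = horner p * id + cst c.
  by apply/funext => y; rewrite hornerMXaddC.
apply: is_derive_eq.
have scaleE (a b : K) : a *: (b : K^o) = a * b by [].
by rewrite !scaleE derivD derivM derivX derivC !hornerE /=; ring.
Qed.

Lemma horner_cvg (K : numFieldType) (p : {poly K}) (x : K) : p.[s] @[s --> x^'] --> p.[x].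
Proof. exact: is_derive_cvg (is_derive_horner p x). Qed.

Lemma horner_cvg_nbhs (K : numFieldType) (p : {poly K}) (x : K) : p.[s] @[s --> x] --> p.[x].
Proof. by apply/continuous_withinNx; exact: horner_cvg. Qed.

Arguments horner_cvg {K} p x.
Arguments horner_cvg_nbhs {K} p x.

Section DiffAlong.
Variables (K : numFieldType) (croot : forall a : K, exists y, y ^+ 3 = a)
  (om : K) (omE : om ^+ 2 + om + 1 = 0).
Variables (p q : {poly K}) (Q : pt K).
Hypotheses (cQ : curve_of p q Q) (yQ : yr Q * ys Q != 0).

Let C := curve_of p q.
Let F := within C Q^'.

Local Instance along_filter : Filter F := within_filter _ _.

Lemma yr_neq0 : yr Q != 0. Proof. by move: yQ; rewrite mulf_eq0 negb_or => /andP []. Qed.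
Lemma ys_neq0 : ys Q != 0. Proof. by move: yQ; rewrite mulf_eq0 negb_or => /andP []. Qed.

Lemma along_nbhs : F --> Q.
Proof. exact: cvg_trans (cvg_within _) (cvg_within _). Qed.

Lemma cvg_xc : xc P @[P --> F] --> xc Q.
Proof.
apply: (cvg_comp _ _ along_nbhs); apply: (cvg_comp fst fst); exact: cvg_fst.
Qed.

Lemma cvg_yr : yr P @[P --> F] --> yr Q.
Proof.
apply: (cvg_comp _ _ along_nbhs); apply: (cvg_comp fst snd); [exact: cvg_fst|exact: cvg_snd].
Qed.

Lemma cvg_ys : ys P @[P --> F] --> ys Q.
Proof. apply: (cvg_comp _ _ along_nbhs); exact: cvg_snd. Qed.

Lemma near_curve : \forall P \near F, C P.
Proof. by rewrite /F near_withinE; near=> P. Unshelve. all: by end_near. Qed.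

Lemma near_neq : \forall P \near F, P <> Q.
Proof.
have : \forall P \near Q^', P != Q by exact: nbhs_dnbhs_neq.
by apply: filterS => P /eqP. 
Qed.

Lemma quad_neq0 (w : pt K -> K) : w P @[P --> F] --> w Q -> w Q != 0 ->
  w P ^+ 2 + w P * w Q + w Q ^+ 2 @[P --> F] --> 3 * w Q ^+ 2.
Proof.
move=> cw w0; have -> : 3 * w Q ^+ 2 = w Q ^+ 2 + w Q * w Q + w Q ^+ 2 by ring.
apply: cvgD; last exact: cvg_cst.
apply: cvgD; last by apply: cvgMl.
by rewrite expr2; under eq_fun do rewrite expr2; apply: cvgM.
Qed.

Lemma near_xneq : \forall P \near F, xc P != xc Q.
Proof.
have h := quad_neq0 cvg_yr yr_neq0.
have n3 : 3 * yr Q ^+ 2 != 0 by rewrite mulf_neq0 ?expf_neq0 ?yr_neq0// pnatr_eq0.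
have h3 : \forall P \near F, yr P ^+ 2 + yr P * yr Q + yr Q ^+ 2 != 0 by exact: cvgr_neq0 h n3.
have h4 : \forall P \near F, yr P != 0 by exact: cvgr_neq0 cvg_yr yr_neq0.
near=> P.
have cP : C P by near: P; exact: near_curve.
have PQ : P <> Q by near: P; exact: near_neq.
apply/eqP => ex; apply: PQ; apply: (curve_eq cP cQ _ ex _); last first.
  have : (yr P - yr Q) * (yr P ^+ 2 + yr P * yr Q + yr Q ^+ 2) = 0.
    have -> : (yr P - yr Q) * (yr P ^+ 2 + yr P * yr Q + yr Q ^+ 2) = yr P ^+ 3 - yr Q ^+ 3 by ring.
    by rewrite (curve_yr3 cP) (curve_yr3 cQ) ex subrr.
  move/eqP; rewrite mulf_eq0 subr_eq0 => /orP [/eqP //|].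
  by apply: contraTeq => _; near: P.
near: P.
Unshelve. all: by end_near. Qed.

Lemma cvg_xc' : xc P @[P --> F] --> (xc Q)^'.
Proof.
move=> U /nbhs_ballP [e /= e0 hU].
have /cvgrPdist_lt /(_ e e0) h := cvg_xc.
near=> P; apply: hU; last by near: P; exact: near_xneq.
by near: P.
Unshelve. all: by end_near.
Qed.

Lemma slope_along (w : pt K -> K) (k : {poly K}) : w P @[P --> F] --> w Q -> w Q != 0 ->
  (forall P, C P -> w P ^+ 3 = k.[xc P]) ->
  (w P - w Q) / (xc P - xc Q) @[P --> F] --> k^`().[xc Q] / (3 * w Q ^+ 2).
Proof.
move=> cw w0 wk.
have n3 : 3 * w Q ^+ 2 != 0 by rewrite mulf_neq0 ?expf_neq0// pnatr_eq0.
have h1 : (k.[xc P] - k.[xc Q]) / (xc P - xc Q) @[P --> F] --> k^`().[xc Q].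
  have /is_derive_slope h := is_derive_horner k (xc Q).
  exact: (cvg_comp _ _ cvg_xc' h).
have h2 := quad_neq0 cw w0.
pose proof (cvgM h1 (cvgV n3 h2)) as h3.
apply: (cvg_near_eq _ h3).
have h4 : \forall P \near F, w P ^+ 2 + w P * w Q + w Q ^+ 2 != 0 by exact: cvgr_neq0 h2 n3.
near=> P.
have cP : C P by near: P; exact: near_curve.
have xn : xc P != xc Q by near: P; exact: near_xneq.
have qn : w P ^+ 2 + w P * w Q + w Q ^+ 2 != 0 by near: P.
rewrite /= -!wk//; field; rewrite subr_eq0 xn /=.
by apply: contraNneq qn => <-; rewrite -subr_eq0; apply/eqP; ring.
Unshelve. all: by end_near. Qed.

Lemma nearby_root (k : {poly K}) (y x : K) (d : K) : 0 < d -> y ^+ 3 = k.[x] ->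
  \forall x' \near x^', exists y', y' ^+ 3 = k.[x'] /\ `|y - y'| < d.
Proof.
move=> d0 yk.
have h : \forall x' \near x^', `|k.[x] - k.[x']| < d ^+ 3.
  have /cvgrPdist_lt := horner_cvg k x; apply; exact: exprn_gt0.
apply: filterS h => x' hx'; have [y0 y0E] := croot k.[x'].
have om3 : om ^+ 3 = 1.
  have -> : om ^+ 3 = 1 + (om - 1) * (om ^+ 2 + om + 1) by ring.
  by rewrite omE mulr0 addr0.
have [h1|h1] := real_ltP (normr_real (y - y0)) (gtr0_real d0); first by exists y0.
have [h2|h2] := real_ltP (normr_real (y - om * y0)) (gtr0_real d0).
  by exists (om * y0); rewrite exprMn om3 mul1r.
have [h3|h3] := real_ltP (normr_real (y - om ^+ 2 * y0)) (gtr0_real d0).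
  by exists (om ^+ 2 * y0); rewrite exprMn -exprM mulnC exprM om3 expr1n mul1r.
exfalso; move: hx'; rewrite -yk -y0E.
have -> : y ^+ 3 - y0 ^+ 3 = (y - y0) * (y - om * y0) * (y - om ^+ 2 * y0).
  have -> : (y - y0) * (y - om * y0) * (y - om ^+ 2 * y0) = y ^+ 3 - om ^+ 3 * y0 ^+ 3
     + (om ^+ 2 + om + 1) * (om * y * y0 ^+ 2 - y ^+ 2 * y0) by ring.
  by rewrite om3 omE mul0r addr0 mul1r.
rewrite !normrM => hh; have : d ^+ 3 < d ^+ 3.
  apply: le_lt_trans hh; have -> : d ^+ 3 = d * d * d by ring.
  by have d0' := ltW d0; apply: ler_pM => //; [exact: mulr_ge0|exact: ler_pM].
by rewrite ltxx.
Qed.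

Lemma along_proper : ProperFilter F.
Proof.
split; last exact: along_filter.
move=> /nbhs_ballP [e /= e0 he].
have [_ h2 _] := cQ.
have p0 : p.[xc Q] != 0.
  by apply: contraNneq yQ => p0; rewrite h2 p0 mul0r.
have cg : z.2 ^+ 2 / p.[z.1] @[z --> (xc Q, yr Q)] --> yr Q ^+ 2 / p.[xc Q].
  apply: cvgM.
    by under eq_fun do rewrite expr2; rewrite expr2; apply: cvgM; exact: cvg_snd.
  apply: cvgV => //.
  have h : z.1 @[z --> (xc Q, yr Q)] --> xc Q by exact: cvg_fst.
  exact: (cvg_comp _ _ h (horner_cvg_nbhs p (xc Q))).
have ysE : yr Q ^+ 2 / p.[xc Q] = ys Q by have [-> _ _] := cQ; rewrite mulfK.
move/cvgrPdist_lt: cg => /(_ e e0) /nbhs_ballP [d /= d0 hd].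
have [m [m0 me md]] := gt0_min2 e0 d0.
have yk : yr Q ^+ 3 = (p ^+ 2 * q).[xc Q] by rewrite (curve_yr3 cQ) hornerM horner_exp.
have h1 := nearby_root m0 yk.
have h3 : \forall x \near (xc Q)^', `|xc Q - x| < m.
  by apply/nbhs_ballP; exists m => // x; rewrite /ball /= => hx _.
have h4 : \forall x \near (xc Q)^', p.[x] != 0 by exact: cvgr_neq0 (horner_cvg p (xc Q)) p0.
have h5 : \forall x \near (xc Q)^', x != xc Q by exact: nbhs_dnbhs_neq.
have [x [[y [y3 ym]] xm px xn]] : exists x, [/\ exists y', y' ^+ 3 = (p ^+ 2 * q).[x] /\ `|yr Q - y'| < m,
    `|xc Q - x| < m, p.[x] != 0 & x != xc Q].
  apply: (@filter_ex _ (xc Q)^'); near=> x; split; by near: x.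
pose P : pt K := (x, y, y ^+ 2 / p.[x]).
apply: (he P).
- split; [split|]; rewrite /ball /=.
  + exact: lt_le_trans xm me.
  + exact: lt_le_trans ym me.
  + have := hd (x, y); rewrite ysE; apply; split; rewrite /ball /=.
      exact: lt_le_trans xm md.
    exact: lt_le_trans ym md.
- by apply: contra_neq xn => <-.
- move: y3; rewrite hornerM horner_exp => y3; split; rewrite /P /xc /yr /ys /=.
  + by rewrite mulfVK.
  + by rewrite mulrA -exprS y3; field.
  + have -> : (y ^+ 2 / p.[x]) ^+ 2 = y * (y ^+ 3 / p.[x] ^+ 2).
      by rewrite expr_div_n; ring.
    by rewrite y3 mulrAC mulfV ?mul1r// expf_neq0.
Unshelve. all: by end_near. Qed.

Lemma dx_along_lim f l :
  (f P - f Q) / (xc P - xc Q) @[P --> F] --> l ->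
  lim ((f P - f Q) / (xc P - xc Q) @[P --> F]) = l.
Proof.
move=> h; apply: cvg_lim h; [exact: norm_hausdorff|exact: along_proper].
Qed.

Let A := 2 * q^`().[xc Q] * p.[xc Q] + q.[xc Q] * p^`().[xc Q].
Let B := 2 * p^`().[xc Q] * q.[xc Q] + p.[xc Q] * q^`().[xc Q].

Lemma slope_yr : (yr P - yr Q) / (xc P - xc Q) @[P --> F] --> B / (3 * ys Q).
Proof.
have -> : B / (3 * ys Q) = (p ^+ 2 * q)^`().[xc Q] / (3 * yr Q ^+ 2).
  have [-> h2 _] := cQ; rewrite /B.
  have p0 : p.[xc Q] != 0 by apply: contraNneq yQ => p0; rewrite h2 p0 mul0r.
  rewrite derivM expr2 derivM !hornerE /=; field.
  by rewrite p0 ys_neq0.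
apply: slope_along => //; [exact: cvg_yr|exact: yr_neq0|].
by move=> P /curve_yr3 ->; rewrite hornerM horner_exp.
Qed.

Lemma slope_ys : (ys P - ys Q) / (xc P - xc Q) @[P --> F] --> A / (3 * yr Q).
Proof.
have -> : A / (3 * yr Q) = (q ^+ 2 * p)^`().[xc Q] / (3 * ys Q ^+ 2).
  have [_ h2 ->] := cQ; rewrite /A.
  have q0 : q.[xc Q] != 0 by apply: contraNneq yQ => q0; rewrite h2 q0 mulr0.
  rewrite derivM expr2 derivM !hornerE /=; field.
  by rewrite q0 yr_neq0.
apply: slope_along => //; [exact: cvg_ys|exact: ys_neq0|].
by move=> P /curve_ys3 ->; rewrite hornerM horner_exp.
Qed.

Lemma Sigma_slope P : xc P != xc Q -> yr P * ys P != 0 ->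
  (Sigma P Q' - Sigma P Q) / (xc Q' - xc Q) @[Q' --> F] -->
  Gnum p q P Q / (9 * (xc P - xc Q) ^+ 2 * yr P * ys P * yr Q * ys Q).
Proof.
move=> xPQ yP; have xn : xc P - xc Q != 0 by rewrite subr_eq0.
have cx : xc P - xc Q' @[Q' --> F] --> xc P - xc Q by apply: cvgB; [exact: cvg_cst|exact: cvg_xc].
have c0 : 3 * yr P * ys P * (xc P - xc Q) * (xc P - xc Q) != 0.
  by rewrite !mulf_neq0 ?pnatr_eq0//; move: yP; rewrite mulf_eq0 negb_or => /andP [].
have ha : yr P * ((ys Q' - ys Q) / (xc Q' - xc Q)) + ys P * ((yr Q' - yr Q) / (xc Q' - xc Q))
    @[Q' --> F] --> yr P * (A / (3 * yr Q)) + ys P * (B / (3 * ys Q)).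
  by apply: cvgD; apply: cvgMr; [exact: slope_ys|exact: slope_yr].
have hn : (yr P * ((ys Q' - ys Q) / (xc Q' - xc Q)) + ys P * ((yr Q' - yr Q) / (xc Q' - xc Q)))
    * (xc P - xc Q) + (yr P * ys P + (yr P * ys Q + ys P * yr Q)) @[Q' --> F] -->
    (yr P * (A / (3 * yr Q)) + ys P * (B / (3 * ys Q))) * (xc P - xc Q)
    + (yr P * ys P + (yr P * ys Q + ys P * yr Q)).
  by apply: cvgD; [apply: cvgMl|exact: cvg_cst].
have hd : 3 * yr P * ys P * (xc P - xc Q') * (xc P - xc Q) @[Q' --> F] -->
    3 * yr P * ys P * (xc P - xc Q) * (xc P - xc Q).
  by apply: cvgMl; apply: cvgMr.
pose proof (cvgM hn (cvgV c0 hd)) as hh.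
have -> : Gnum p q P Q / (9 * (xc P - xc Q) ^+ 2 * yr P * ys P * yr Q * ys Q) =
  ((yr P * (A / (3 * yr Q)) + ys P * (B / (3 * ys Q))) * (xc P - xc Q) +
   (yr P * ys P + (yr P * ys Q + ys P * yr Q))) / (3 * yr P * ys P * (xc P - xc Q) * (xc P - xc Q)).
  move: yP; rewrite mulf_eq0 negb_or => /andP [yP1 yP2].
  by rewrite /Gnum /A /B; field; rewrite xn yr_neq0 ys_neq0 yP1 yP2.
apply: (cvg_near_eq _ hh).
have cn : \forall Q' \near F, xc P - xc Q' != 0 by exact: cvgr_neq0 cx xn.
near=> Q'.
have x1 : xc P - xc Q' != 0 by near: Q'.
have x2 : xc Q' - xc Q != 0 by rewrite subr_eq0; near: Q'; exact: near_xneq.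
move: yP; rewrite mulf_eq0 negb_or => /andP [yP1 yP2].
rewrite /Sigma /=; field.
by rewrite xn x1 x2 yP1 yP2.
Unshelve. all: by end_near. Qed.

End DiffAlong.

Lemma dSigmaE (K : numFieldType) (croot : forall a : K, exists y, y ^+ 3 = a)
    (om : K) (omE : om ^+ 2 + om + 1 = 0) (r s : nat) (b : 'I_(s + r) -> K) (P Q : pt K) :
  generic b P Q -> dSigma b P Q =
    Gnum (k_r b) (k_s b) P Q / (9 * (xc P - xc Q) ^+ 2 * yr P * ys P * yr Q * ys Q).
Proof.
move=> [cP cQ yP yQ xPQ]; rewrite /dSigma /dx_along.
exact: (dx_along_lim croot omE cQ yQ (Sigma_slope cQ yQ xPQ yP)).
Qed.

(** * The shape of the second-kind differentials *)

Section HatBasis.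
Variables (r s : nat).
Hypotheses (r0 : (0 < r)%N) (rs : (r < s)%N) (rs3 : (r != s %[mod 3])%N).
Variables (phi : nat -> monom) (phiB : hat_basis r s phi).

Lemma phi_ltn i j : (i < j)%N -> (monom_order r s (phi i) < monom_order r s (phi j))%N.
Proof.
have [_ h _] := phiB; elim: j => // j IH; rewrite ltnS leq_eqVlt => /orP [/eqP -> //|/IH ij].
exact: ltn_trans ij (h j).
Qed.

Lemma phi_inj : injective phi.
Proof.
move=> i j e; case: (ltngtP i j) => // /phi_ltn; by rewrite e ltnn.
Qed.

Lemma phi_order i : (i < genus r s)%N ->
  (monom_order r s (phi i) + 4 <= 3 * (r + s))%N.
Proof.
move=> ig; rewrite leqNgt; apply/negP => hi.
pose n1 := ((r + 2 * s - 1) %/ 3)%N; pose n2 := ((2 * r + s - 1) %/ 3)%N.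
pose L : seq monom := [seq (a, true, false) | a <- iota 0 n1] ++
  [seq (a, false, true) | a <- iota 0 n2].
have sL : size L = genus r s.
  rewrite size_cat !size_map !size_iota /n1 /n2 /genus; lia.
have uL : uniq L.
  rewrite cat_uniq !map_inj_uniq ?iota_uniq /=; last 2 first.
  - by move=> ? ? [].
  - by move=> ? ? [].
  by rewrite andbT; apply/hasPn => _ /mapP [a _ ->]; apply/mapP => -[].
have LL m : m \in L -> m \in [seq phi j | j <- iota 0 i].
  move=> mL; have [hm om] : hat_monom m /\ (monom_order r s m + 4 <= 3 * (r + s))%N.
    move: mL; rewrite mem_cat => /orP [] /mapP [a]; rewrite mem_iota /= add0n => al ->;
      split=> //; rewrite /monom_order /= /rhat /shat; move: al; rewrite /n1 /n2; lia.
  have [_ _ /(_ m hm) [j ej]] := phiB; apply/mapP; exists j => //.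
  rewrite mem_iota /= add0n ltnNge; apply/negP => ij.
  have : (monom_order r s (phi i) <= monom_order r s (phi j))%N.
    by move: ij; rewrite leq_eqVlt => /orP [/eqP -> //|/phi_ltn /ltnW].
  by rewrite ej; lia.
have := uniq_leq_size uL LL; rewrite size_map size_iota sL => /(leq_trans _).
by move=> /(_ _ ig); rewrite ltnn.
Qed.

Lemma phi_shape i : (i < genus r s)%N -> exists a e, phi i = (a, e, ~~ e).
Proof.
move=> ig; have := phi_order ig; have [h _ _] := phiB.
have := h i; case: (phi i) => [[a e] f]; rewrite /hat_monom /monom_order /rhat /shat /=.
case: e; case: f => //= _; [lia|exists a, true => //|exists a, false => //].
Qed.

End HatBasis.

Section IndependentPoints.
Variables (K : fieldType) (T : Type) (n : nat) (f : 'I_n -> T -> K) (S : T -> Prop).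
Hypothesis indep : forall c : 'rV[K]_n,
  (forall t, S t -> \sum_i c 0 i * f i t = 0) -> c = 0.

Let M m (Q : 'I_m -> T) : 'M[K]_(n, m) := \matrix_(i, j) f i (Q j).

Lemma points_rank k : (k <= n)%N ->
  exists m (Q : 'I_m -> T), (forall j, S (Q j)) /\ (k <= \rank (M Q))%N.
Proof.
elim: k => [|k IH] kn.
  have Q0 : 'I_0 -> T by case.
  by exists 0%N, Q0; split=> // -[].
have [m [Q [SQ kQ]]] := IH (ltnW kn).
case: (ltnP k (\rank (M Q))) => [h|h]; first by exists m, Q.
have rk : \rank (M Q) = k by apply/eqP; rewrite eqn_leq h kQ.
have ker0 : kermx (M Q) != 0.
  by rewrite -mxrank_eq0 mxrank_ker rk subn_eq0 -ltnNge.
have /rowV0Pn [c cK c0] := ker0.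
have cM : c *m M Q = 0 by apply/sub_kermxP.
have [t [St ct]] : exists t, S t /\ \sum_i c 0 i * f i t != 0.
  apply: contrapT => hN; move/eqP: c0; apply; apply: indep => t St.
  by apply/eqP/negPn/negP => h1; apply: hN; exists t.
pose Q' (j : 'I_(m + 1)) := match fintype.split j with inl j => Q j | inr _ => t end.
exists (m + 1)%N, Q'; split; first by move=> j; rewrite /Q'; case: (fintype.split j).
have MQ' : M Q' = row_mx (M Q) (\col_i f i t).
  apply/matrixP => i j; rewrite !mxE /Q'; case: (fintype.split j) => j'; by rewrite !mxE.
rewrite ltnNge MQ'; apply/negP => h'.
have kk : (kermx (row_mx (M Q) (\col_i f i t)) <= kermx (M Q))%MS.
  apply/sub_kermxP; have : kermx (row_mx (M Q) (\col_i f i t)) *m row_mx (M Q) (\col_i f i t) = 0.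
    by apply/sub_kermxP.
  by rewrite mul_mx_row -row_mx0 => /eq_row_mx [].
have [le1 le2] := mxrank_leqif_sup kk.
have eqr : \rank (kermx (row_mx (M Q) (\col_i f i t))) == \rank (kermx (M Q)).
  by rewrite eqn_leq le1 !mxrank_ker leq_sub2l// rk.
rewrite le2 in eqr; have : c *m row_mx (M Q) (\col_i f i t) = 0.
  by apply/sub_kermxP; exact: submx_trans cK eqr.
rewrite mul_mx_row -row_mx0 => /eq_row_mx [_] /matrixP /(_ 0 0).
rewrite !mxE => h1; move/eqP: ct; apply; rewrite -[RHS]h1.
by apply: eq_bigr => i _; rewrite mxE.
Qed.

Lemma dual_points : exists m (Q : 'I_m -> T) (C : 'M[K]_(m, n)),
  (forall j, S (Q j)) /\
  forall i k, \sum_j f i (Q j) * C j k = (i == k)%:R.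
Proof.
have [m [Q [SQ nQ]]] := points_rank (leqnn n).
exists m, Q, (pinvmx (M Q)); split=> // i k.
have fr : row_free (M Q) by rewrite /row_free eqn_leq rank_leq_row.
have /matrixP /(_ i k) := mulmxVp fr; rewrite !mxE => <-.
by apply: eq_bigr => j _; rewrite [M Q i j]mxE.
Qed.

End IndependentPoints.

Section PolynomialFunctions.
Variable K : fieldType.
Implicit Types (f g : K -> K) (p q : {poly K}).

Definition polyfun f := exists p : {poly K}, forall x, f x = p.[x].

Lemma polyfun_cst c : polyfun (fun _ => c).
Proof. by exists c%:P => x; rewrite hornerC. Qed.

Lemma polyfun_id : polyfun (fun x => x).
Proof. by exists 'X => x; rewrite hornerX. Qed.

Lemma polyfunD f g : polyfun f -> polyfun g -> polyfun (fun x => f x + g x).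
Proof. by move=> [p fp] [q gq]; exists (p + q) => x; rewrite hornerD fp gq. Qed.

Lemma polyfunM f g : polyfun f -> polyfun g -> polyfun (fun x => f x * g x).
Proof. by move=> [p fp] [q gq]; exists (p * q) => x; rewrite hornerM fp gq. Qed.

Lemma polyfunX f n : polyfun f -> polyfun (fun x => f x ^+ n).
Proof. by move=> [p fp]; exists (p ^+ n) => x; rewrite horner_exp fp. Qed.

Lemma polyfun_sum (I : Type) (s : seq I) (f : I -> K -> K) :
  (forall i, polyfun (f i)) -> polyfun (fun x => \sum_(i <- s) f i x).
Proof.
move=> hf; elim: s => [|i s IH].
  by under eq_fun do rewrite big_nil; exact: polyfun_cst.
by under eq_fun do rewrite big_cons; exact: polyfunD.
Qed.

Lemma polyfun_dd2 p y : polyfun (fun x => dd2 p x y).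
Proof.
apply: polyfun_sum => i; apply: polyfunM; first exact: polyfun_cst.
apply: polyfun_sum => j; apply: polyfunM; first exact: polyfun_cst.
apply: polyfun_sum => k; apply: polyfunM; last exact: polyfun_cst.
by apply: polyfunX; exact: polyfun_id.
Qed.

Lemma polyfun_dd p y : polyfun (fun x => dd p x y).
Proof.
apply: polyfun_sum => i; apply: polyfunM; first exact: polyfun_cst.
apply: polyfun_sum => k; apply: polyfunM; last exact: polyfun_cst.
by apply: polyfunX; exact: polyfun_id.
Qed.

End PolynomialFunctions.

Lemma poly_zero (K : numFieldType) (p : {poly K}) : (forall x, p.[x] = 0) -> p = 0.
Proof.
move=> h; apply/eqP; apply/negPn/negP => p0.
pose s := [seq (i%:R : K) | i <- iota 0 (size p)].
have : (size s < size p)%N.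
  apply: max_poly_roots => //; first by apply/allP => x _; apply/eqP.
  rewrite map_inj_uniq ?iota_uniq// => i j /eqP; by rewrite eqr_nat => /eqP.
by rewrite size_map size_iota ltnn.
Qed.

Section NuII.
Variables (K : numFieldType) (croot : forall a : K, exists y, y ^+ 3 = a).
Variables (om : K) (omE : om ^+ 2 + om + 1 = 0).
Variables (p q : {poly K}).
Hypothesis pq0 : p * q != 0.
Implicit Types (P Q : pt K) (u v d : {poly K}).

Let C := curve_of p q.

Lemma curve_over x : (p * q).[x] != 0 -> exists P, [/\ C P, xc P = x & yr P * ys P != 0].
Proof.
move=> k0; have [y yE] := croot (p.[x] ^+ 2 * q.[x]).
have [p0 q0] : p.[x] != 0 /\ q.[x] != 0.
  by move: k0; rewrite hornerM mulf_eq0 negb_or => /andP.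
have y0 : y != 0.
  by apply: contraNneq k0 => y0; move: yE; rewrite y0 expr0n /= => /esym/eqP; rewrite mulf_eq0 expf_eq0 /= hornerM mulf_eq0.
exists (x, y, y ^+ 2 / p.[x]); rewrite /xc /yr /ys /=; split=> //; last first.
  by rewrite !mulf_neq0 ?expf_neq0 ?invr_eq0.
split; rewrite /xc /yr /ys /=.
- by rewrite mulfVK.
- by rewrite mulrA -exprS yE; field.
- have -> : (y ^+ 2 / p.[x]) ^+ 2 = y * (y ^+ 3 / p.[x] ^+ 2) by rewrite expr_div_n; ring.
  by rewrite yE mulrAC mulfV ?mul1r// expf_neq0.
Qed.

Definition rotate_sheet P : pt K := (xc P, om * yr P, om ^+ 2 * ys P).

Lemma om_cube : om ^+ 3 = 1.
Proof.
have -> : om ^+ 3 = 1 + (om - 1) * (om ^+ 2 + om + 1) by ring.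
by rewrite omE mulr0 addr0.
Qed.

Lemma curve_rot P : C P -> C (rotate_sheet P).
Proof.
move=> [h1 h2 h3]; split; rewrite /rotate_sheet /xc /yr /ys /= in h1 h2 h3 *.
- by rewrite exprMn h1 mulrA.
- by have := om_cube; rewrite -h2 => o3; ring: o3.
- have -> : (om ^+ 2 * P.2) ^+ 2 = om ^+ 3 * om * P.2 ^+ 2 by ring.
  by rewrite om_cube h3; ring.
Qed.

Lemma om_neq : om != 0 /\ om - 1 != 0.
Proof.
split; apply/eqP => h.
  by move/eqP: omE; rewrite h expr0n /= !add0r oner_eq0.
move/eqP: h; rewrite subr_eq0 => /eqP h; move/eqP: omE; rewrite h expr1n.
have -> : (1 + 1 + 1 : K) = 3%:R by ring.
by rewrite pnatr_eq0.
Qed.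

(* 1, y_r, y_s are independent over K(x): use the sheets y_r, om y_r, om^2 y_r. *)
Lemma sheets_indep u v d : d != 0 ->
  (forall P, C P -> yr P * ys P != 0 -> d.[xc P] != 0 ->
     u.[xc P] * yr P + v.[xc P] * ys P = 0) -> u = 0 /\ v = 0.
Proof.
move=> d0 h.
have E x : (p * q).[x] != 0 -> d.[x] != 0 -> u.[x] = 0 /\ v.[x] = 0.
  move=> kx dx; have [P [cP xP yP]] := curve_over kx.
  have e1 := h P cP yP; rewrite xP in e1; move: (e1 dx) => {}e1.
  have yP' : yr (rotate_sheet P) * ys (rotate_sheet P) != 0.
    rewrite /rotate_sheet /yr /ys /=; have -> : om * P.1.2 * (om ^+ 2 * P.2) = om ^+ 3 * (P.1.2 * P.2) by ring.
    by rewrite om_cube mul1r.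
  have e2 := h _ (curve_rot cP) yP'; rewrite [xc (rotate_sheet P)]xP in e2; move: (e2 dx) => {}e2.
  rewrite /rotate_sheet [yr _]/= [ys _]/= in e2.
  have [n0 n1] := om_neq.
  move: yP; rewrite mulf_eq0 negb_or => /andP [y1 y2].
  have v0 : v.[x] = 0.
    apply: (mulIf y2); apply: (mulfI n0); apply: (mulfI n1).
    have -> : (om - 1) * (om * (v.[x] * ys P)) =
      (u.[x] * (om * yr P) + v.[x] * (om ^+ 2 * ys P)) - om * (u.[x] * yr P + v.[x] * ys P) by ring.
    by rewrite e1 e2; ring.
  split=> //; apply: (mulIf y1); by rewrite mul0r -e1 v0 mul0r addr0.
have Z w : (forall x, (p * q).[x] != 0 -> d.[x] != 0 -> w.[x] = 0) -> w = 0.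
  move=> hw; have : w * ((p * q) * d) = 0.
    apply: poly_zero => x; rewrite hornerM hornerM.
    have [->|kx] := eqVneq (p * q).[x] 0; first by rewrite mul0r mulr0.
    have [->|dx] := eqVneq d.[x] 0; first by rewrite !mulr0.
    by rewrite hw// mul0r.
  by move/eqP; rewrite mulf_eq0 (negPf (mulf_neq0 pq0 d0)) orbF => /eqP.
by split; apply: Z => x kx dx; case: (E x kx dx).
Qed.

Definition lin_y (f : pt K -> K) := exists u v, forall P,
  f P = u.[xc P] * yr P + v.[xc P] * ys P.

Lemma lin_yD f g : lin_y f -> lin_y g -> lin_y (fun P => f P + g P).
Proof.
move=> [u [v fE]] [u' [v' gE]]; exists (u + u'), (v + v') => P.
by rewrite fE gE !hornerD; ring.
Qed.

Lemma lin_yZ (c : K) f : lin_y f -> lin_y (fun P => c * f P).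
Proof.
move=> [u [v fE]]; exists (c *: u), (c *: v) => P.
by rewrite fE !hornerZ; ring.
Qed.

Lemma lin_y_sum (I : Type) (s : seq I) (f : I -> pt K -> K) :
  (forall i, lin_y (f i)) -> lin_y (fun P => \sum_(i <- s) f i P).
Proof.
move=> hf; elim: s => [|i s IH].
  under eq_fun do rewrite big_nil; exists 0, 0 => P; rewrite !horner0; ring.
by under eq_fun do rewrite big_cons; exact: lin_yD.
Qed.

Definition UV_poly (w : {poly K}) (x y : K) : K := dd w x y - 3 * dd2 (p * q) x y.

Definition dys_num := 2 *: (q^`() * p) + q * p^`().
Definition dyr_num := 2 *: (p^`() * q) + p * q^`().

Lemma Gnum_antisym P Q : C P -> C Q ->
  Gnum p q P Q - Gnum p q Q P = (xc P - xc Q) ^+ 2 *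
    (yr P * ys Q * UV_poly dyr_num (xc P) (xc Q) + ys P * yr Q * UV_poly dys_num (xc P) (xc Q)).
Proof.
move=> cP cQ; set d := xc P - xc Q.
have eB : d * dd dyr_num (xc P) (xc Q) = dyr_num.[xc P] - dyr_num.[xc Q] by rewrite ddE.
have eA : d * dd dys_num (xc P) (xc Q) = dys_num.[xc P] - dys_num.[xc Q] by rewrite ddE.
have ek : d ^+ 2 * dd2 (p * q) (xc P) (xc Q) =
    (p * q).[xc P] - (p * q).[xc Q] - d * (p * q)^`().[xc Q].
  by rewrite ddE dd2E -/d; ring.
have -> : d ^+ 2 * (yr P * ys Q * UV_poly dyr_num (xc P) (xc Q) + ys P * yr Q * UV_poly dys_num (xc P) (xc Q))
  = yr P * ys Q * (d * (d * dd dyr_num (xc P) (xc Q)) - 3 * (d ^+ 2 * dd2 (p * q) (xc P) (xc Q)))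
  + ys P * yr Q * (d * (d * dd dys_num (xc P) (xc Q)) - 3 * (d ^+ 2 * dd2 (p * q) (xc P) (xc Q))).
  by rewrite /UV_poly; ring.
rewrite eB eA ek; have [_ k2 _] := cP; have [_ l2 _] := cQ.
by rewrite /Gnum k2 l2 /dys_num /dyr_num derivM !(hornerD, hornerM, hornerZ) /d; ring.
Qed.

End NuII.

Section NuIIForm.
Variables (K : numFieldType) (croot : forall a : K, exists y, y ^+ 3 = a).
Variables (om : K) (omE : om ^+ 2 + om + 1 = 0).
Variables (r s : nat) (b : 'I_(s + r) -> K).
Hypotheses (r0 : (0 < r)%N) (rs : (r < s)%N) (rs3 : (r != s %[mod 3])%N).
Variables (phi : nat -> monom) (phiB : hat_basis r s phi).
Variable nuII : 'I_(genus r s) -> pt K -> K.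
Hypothesis nuII_rel : second_kind_relation b phi nuII.
Implicit Types (P Q : pt K) (u v d : {poly K}).

Let p := k_r b.
Let q := k_s b.

Lemma k_neq0 : p * q != 0.
Proof.
by rewrite mulf_neq0 ?monic_neq0 ?monic_prod_XsubC//; apply: rpred_prod => i _; exact: monicXsubC.
Qed.

Lemma lin_y_monom i : (i < genus r s)%N -> lin_y (fun P => monom_eval (phi i) P).
Proof.
move=> ig; have [a [e pe]] := phi_shape r0 rs rs3 phiB ig.
exists ((e%:R : K) *: 'X^a), ((~~ e)%:R *: 'X^a) => P.
rewrite pe /monom_eval /= !hornerZ hornerXn.
by case: e pe => _ /=; ring.
Qed.

Lemma nuI_indep d (c : 'rV[K]_(genus r s)) : d != 0 ->
  (forall P, [/\ curve b P, yr P * ys P != 0 & d.[xc P] != 0] ->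
     \sum_i c 0 i * nuI phi i P = 0) -> c = 0.
Proof.
move=> d0 h.
pose u : {poly K} := \sum_(i < genus r s) ((phi i).1.2%:R * c 0 i) *: 'X^((phi i).1.1).
pose v : {poly K} := \sum_(i < genus r s) ((phi i).2%:R * c 0 i) *: 'X^((phi i).1.1).
have [u0 v0] : u = 0 /\ v = 0.
  apply: (sheets_indep croot omE k_neq0 d0) => P cP yP dP.
  have := h P (And3 cP yP dP); move/(congr1 ( *%R (3 * yr P * ys P))).
  rewrite mulr0 => <-; rewrite mulr_sumr /u /v !horner_sum !mulr_suml -big_split.
  apply: eq_bigr => i _ /=; have [a [e pe]] := phi_shape r0 rs rs3 phiB (ltn_ord i).
  rewrite !hornerZ hornerXn /nuI /monom_eval pe /=.
  move: yP; rewrite mulf_eq0 negb_or => /andP [y1 y2].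
  by case: e pe => _ /=; field; rewrite y1 y2.
apply/rowP => i; rewrite [RHS]mxE.
have [a [e pe]] := phi_shape r0 rs rs3 phiB (ltn_ord i).
have inj (j : 'I_(genus r s)) : phi i = phi j -> j = i.
  by move=> /(phi_inj phiB) /val_inj.
have hu : u`_a = 0 by rewrite u0 coef0.
have hv : v`_a = 0 by rewrite v0 coef0.
have key (j : 'I_(genus r s)) : j != i -> (phi j).1.2 = e -> ((phi j).2 = ~~ e) ->
    (a == (phi j).1.1) = false.
  move=> /eqP ji e1 e2; apply/eqP => ea; apply: ji; apply: inj.
  by rewrite pe ea; case: (phi j) e1 e2 => [[? ?] ?] /= -> ->.
case: e pe key => pe key; [move: hu|move: hv];
  rewrite coef_sum (bigD1 i) //= pe /= coefZ coefXn eqxx mul1r mulr1;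
  rewrite big1 ?addr0// => j ji; rewrite coefZ coefXn;
  have [a' [e' pe']] := phi_shape r0 rs rs3 phiB (ltn_ord j);
  move: (key j ji); rewrite pe' /=; case: e' {pe'} => /=; rewrite ?mul0r// => -> //; by rewrite mulr0.
Qed.

Lemma nuII_exchange P Q : generic b P Q ->
  \sum_(k < genus r s) nuI phi k Q * nuII k P =
  (yr P * ys Q * UV_poly p q (dyr_num p q) (xc P) (xc Q) + ys P * yr Q * UV_poly p q (dys_num p q) (xc P) (xc Q))
    / (9 * yr P * ys P * yr Q * ys Q) + \sum_(k < genus r s) nuI phi k P * nuII k Q.
Proof.
move=> gPQ; have [cP cQ yP yQ xPQ] := gPQ.
have gQP : generic b Q P by split=> //; rewrite eq_sym.
have := nuII_rel gPQ; rewrite sumrB => /eqP; rewrite eq_sym subr_eq => /eqP ->.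
congr (_ + _); rewrite (dSigmaE croot omE gPQ) (dSigmaE croot omE gQP).
move: yP yQ; rewrite !mulf_eq0 !negb_or => /andP [a1 a2] /andP [b1 b2].
have x0 : xc P - xc Q != 0 by rewrite subr_eq0.
have := Gnum_antisym cP cQ => /eqP; rewrite subr_eq => /eqP ->.
rewrite -/p -/q; field.
by rewrite x0 a1 a2 b1 b2 -[xc Q - xc P]opprB oppr_eq0 x0.
Qed.

Lemma nuII_form_away d : d != 0 -> exists2 d',
  d' != 0 /\ (forall x, d'.[x] = 0 -> d.[x] != 0) &
  forall i, exists u v, forall P, curve b P -> yr P * ys P != 0 -> d'.[xc P] != 0 ->
    yr P * ys P * nuII i P = u.[xc P] * yr P + v.[xc P] * ys P.
Proof.
move=> d0.
have [m [Q [W [SQ QW]]]] := dual_points (fun c => @nuI_indep d c d0).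
exists (\prod_(j < m) ('X - (xc (Q j))%:P)).
  split; first by rewrite monic_neq0//; apply: rpred_prod => i _; exact: monicXsubC.
  move=> x /eqP; rewrite horner_prod prodf_seq_eq0 => /hasP [j _ /=].
  by rewrite !hornerE subr_eq0 => /eqP ->; case: (SQ j).
move=> i.
pose E j P : K := 9^-1 * (yr (Q j) * ys (Q j))^-1 *
   (yr P * ys (Q j) * UV_poly p q (dyr_num p q) (xc P) (xc (Q j))
    + ys P * yr (Q j) * UV_poly p q (dys_num p q) (xc P) (xc (Q j)))
   + \sum_(k < genus r s) 3^-1 * nuII k (Q j) * monom_eval (phi k) P.
have [u [v uvE]] : lin_y (fun P => \sum_j W j i * E j P).
  apply: lin_y_sum => j; apply: lin_yZ; apply: lin_yD; last first.
    by apply: lin_y_sum => k; apply: lin_yZ; exact: lin_y_monom.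
  apply: lin_yZ.
  have Uf w : polyfun (fun x => UV_poly p q w x (xc (Q j))).
    apply: polyfunD; first exact: polyfun_dd.
    have -> : (fun x => - (3 * dd2 (p * q) x (xc (Q j)))) = (fun x => - 3 * dd2 (p * q) x (xc (Q j))).
      by apply/funext => x; rewrite mulNr.
    by apply: polyfunM; [exact: polyfun_cst|exact: polyfun_dd2].
  have [w1 w1E] := Uf (dyr_num p q); have [w2 w2E] := Uf (dys_num p q).
  exists (ys (Q j) *: w1), (yr (Q j) *: w2) => P.
  by rewrite w1E w2E !hornerZ; ring.
exists u, v => P cP yP dP; rewrite -uvE.
have gPQ j : generic b P (Q j).
  have [cQ yQ _] := SQ j; split=> //.
  apply: contraNneq dP => ->; rewrite horner_prod; apply/eqP.
  by rewrite (bigD1 j) //= !hornerE subrr mul0r.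
have EE j : E j P = yr P * ys P * \sum_(k < genus r s) nuI phi k (Q j) * nuII k P.
  have [_ yQ _] := SQ j.
  rewrite (nuII_exchange (gPQ j)) mulrDr; congr (_ + _).
    move: yP yQ; rewrite !mulf_eq0 !negb_or => /andP [a1 a2] /andP [b1 b2].
    by field; rewrite a1 a2 b1 b2.
  rewrite mulr_sumr; apply: eq_bigr => k _; rewrite /nuI.
  move: yP; rewrite !mulf_eq0 !negb_or => /andP [a1 a2].
  by field; rewrite a1 a2.
under eq_bigr => j _ do rewrite EE mulrCA.
rewrite -mulr_sumr; congr (_ * _).
under eq_bigr => j _ do rewrite mulr_sumr.
rewrite exchange_big /= (bigD1 i) //= [X in _ + X]big1 ?addr0 => [|k ki].
  under eq_bigr => j _ do rewrite mulrA [W j i * _]mulrC.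
  by rewrite -mulr_suml QW eqxx mul1r.
under eq_bigr => j _ do rewrite mulrA [W j i * _]mulrC.
by rewrite -mulr_suml QW (negPf ki) mul0r.
Qed.

Lemma nuII_form i : exists u v, forall P, curve b P -> yr P * ys P != 0 ->
  yr P * ys P * nuII i P = u.[xc P] * yr P + v.[xc P] * ys P.
Proof.
have [d1 [d10 _] /(_ i) [u1 [v1 h1]]] := nuII_form_away (oner_neq0 _).
have [d2 [d20 d21] /(_ i) [u2 [v2 h2]]] := nuII_form_away d10.
have [eu ev] : u1 - u2 = 0 /\ v1 - v2 = 0.
  apply: (sheets_indep croot omE k_neq0 (mulf_neq0 d10 d20)) => P cP yP.
  rewrite hornerM mulf_eq0 negb_or => /andP [n1 n2].
  rewrite !hornerD !hornerN.
  transitivity ((u1.[xc P] * yr P + v1.[xc P] * ys P) - (u2.[xc P] * yr P + v2.[xc P] * ys P)).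
    by ring.
  by rewrite -h1// -h2// subrr.
exists u1, v1 => P cP yP; have [e|n1] := eqVneq d1.[xc P] 0; last exact: h1.
have n2 : d2.[xc P] != 0.
  by apply: contraTneq (eqxx d1.[xc P]) => /d21; rewrite e eqxx.
by rewrite h2// (subr0_eq eu) (subr0_eq ev).
Qed.

End NuIIForm.

(** * Local forms of the curve *)

Section Leading.
Variables (K : numFieldType) (Kc : abs_complete K).
Implicit Types (f g u : K -> K).

(* [f = c t^m + higher order terms]; [c] may vanish. *)
Definition lead (m : int) f (c : K) := exists u,
  [/\ analytic_at0 u, u 0 = c & \forall t \near (0 : K)^', f t = u t * t ^ m].

Lemma lead_order m f c : c != 0 -> lead m f c -> has_order m f.
Proof. by move=> c0 [u [ua u0 fu]]; exists u; split; rewrite ?u0. Qed.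

Lemma lead_near m f g c : (\forall t \near (0 : K)^', f t = g t) -> lead m f c -> lead m g c.
Proof.
move=> fg [u [ua u0 fu]]; exists u; split=> //; near=> t.
by rewrite -(near fg t)// (near fu t).
Unshelve. all: by end_near. Qed.

Lemma leadM m n f g c d : lead m f c -> lead n g d -> lead (m + n) (fun t => f t * g t) (c * d).
Proof.
move=> [u [ua u0 fu]] [v [va v0 gv]]; exists (fun t => u t * v t); split.
- exact: an1M.
- by rewrite u0 v0.
- near=> t; have t0 : t != 0 by near: t; exact: near0'_neq0.
  by rewrite (near fu t)// (near gv t)// expfzDr// mulrACA.
Unshelve. all: by end_near. Qed.

Lemma leadV m f c : c != 0 -> lead m f c -> lead (- m) (fun t => (f t)^-1) c^-1.
Proof.
move=> c0 [u [ua u0 fu]]; exists (fun t => (u t)^-1); split.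
- by apply: an1V; rewrite ?u0.
- by rewrite u0.
- by near=> t; rewrite (near fu t)// invfM invr_expz.
Unshelve. all: by end_near. Qed.

Lemma lead_an1 f : analytic_at0 f -> lead 0 f (f 0).
Proof.
by move=> fa; exists f; split=> //; near=> t; rewrite expr0z mulr1.
Unshelve. all: by end_near. Qed.

Lemma lead_pole f c : lead (-1) f c ->
  exists2 h, analytic_at0 h & \forall t \near (0 : K)^', f t = c / t + h t.
Proof.
move=> [u [ua u0 fu]]; have [h ha hu] := simple_pole_split Kc ua.
exists h => //; near=> t; rewrite (near fu t)// -u0 -(near hu t)//.
Unshelve. all: by end_near. Qed.

Lemma an1_shift_derive f : analytic_at0 f -> exists g,
  [/\ analytic_at0 g, derive1 f 0 = g 0 & \forall t \near (0 : K), f t = f 0 + t * g t].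
Proof.
move=> fa; have [g ga /near0P [e e0 fg]] := an1_shift Kc fa.
exists g; split=> //; last by apply/near0P; exists e.
apply: is_derive1; apply/is_derive_slope.
have /near0P [d d0 hd] := an1_cvg Kc ga.
have /cvg_dnbhsP gc : g s @[s --> (0 : K)^'] --> g 0 by apply: hd; rewrite normr0.
apply/cvg_dnbhsP => eps /gc [c c0 hc].
have [w [w0 wc we]] := gt0_min2 c0 e0.
exists w => // s sw s0; have sw' : `|s| < w by rewrite -[s]subr0.
rewrite fg ?(lt_le_trans sw')// addrAC subrr add0r subr0 mulrAC mulfV// mul1r.
by apply: hc => //; exact: lt_le_trans sw wc.
Qed.

Lemma an1_eq0 f g : analytic_at0 f -> analytic_at0 g ->
  (\forall t \near (0 : K)^', f t = g t) -> f 0 = g 0.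
Proof.
move=> fa ga fg; apply/eqP; rewrite -subr_eq0; apply/eqP.
apply: (an1_at0 Kc (an1B Kc fa ga)); near=> t.
by apply/eqP; rewrite subr_eq0; apply/eqP; near: t.
Unshelve. all: by end_near. Qed.

Lemma an1_horner (p : {poly K}) f : analytic_at0 f -> analytic_at0 (fun t => p.[f t]).
Proof.
move=> fa; elim/poly_ind: p => [|p c IH].
  by under eq_fun do rewrite horner0; exact: an1_cst.
under eq_fun do rewrite hornerMXaddC.
by apply: (an1D Kc); [exact: an1M|exact: an1_cst].
Qed.

End Leading.

Section LocalForms.
Variables (K : numFieldType) (Kc : abs_complete K).
Variables (p q : {poly K}).
Implicit Types (P Q : pt K) (gam : K -> pt K).

Definition simple_roots (p q : {poly K}) := forall x, p.[x] = 0 ->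
  q.[x] != 0 /\ exists2 p1, p = ('X - x%:P) * p1 & p1.[x] != 0.

Lemma curve_root P : curve_of p q P -> yr P * ys P = 0 -> yr P = 0 /\ ys P = 0.
Proof.
move=> [h1 h2 h3] /eqP; rewrite mulf_eq0 => /orP [] /eqP e.
  by split=> //; move: h3; rewrite e mul0r => /eqP; rewrite expf_eq0 => /eqP.
by split=> //; move: h1; rewrite e mul0r => /eqP; rewrite expf_eq0 => /eqP.
Qed.

Variables (gam : K -> pt K) (P : pt K).
Hypothesis gC : \forall t \near (0 : K)^', curve_of p q (gam t).
Hypothesis g0 : gam 0 = P.
Hypotheses (ax : analytic_at0 (@xc K \o gam)) (ar : analytic_at0 (@yr K \o gam))
  (as_ : analytic_at0 (@ys K \o gam)).
Hypothesis vel : [\/ derive1 (@xc K \o gam) 0 != 0, derive1 (@yr K \o gam) 0 != 0 |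
  derive1 (@ys K \o gam) 0 != 0].
Hypothesis cP : curve_of p q P.

Lemma cube_velocity (w : pt K -> K) (k : {poly K}) : analytic_at0 (w \o gam) ->
  (forall Q, curve_of p q Q -> w Q ^+ 3 = k.[xc Q]) -> w P != 0 ->
  derive1 (@xc K \o gam) 0 = 0 -> derive1 (w \o gam) 0 = 0.
Proof.
move=> aw wk w0.
have [X [Xa X0 Xe]] := an1_shift_derive Kc ax; have [Y [Ya Y0 Ye]] := an1_shift_derive Kc aw.
rewrite X0 Y0 => X00.
have [dk dkE] := polyfun_dd k (xc P).
have E : Y 0 * (w (gam 0) ^+ 2 + w (gam 0) * w P + w P ^+ 2) = X 0 * dk.[xc (gam 0)].
  apply: (an1_eq0 Kc (f := fun t => Y t * (w (gam t) ^+ 2 + w (gam t) * w P + w P ^+ 2))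
    (g := fun t => X t * dk.[xc (gam t)])).
  - apply: (an1M Kc) => //; apply: (an1D Kc); last exact: an1_cst.
    apply: (an1D Kc); first exact: (an1X Kc 2 aw).
    by apply: (an1M Kc) => //; exact: an1_cst.
  - by apply: (an1M Kc) => //; exact: (an1_horner Kc dk ax).
  rewrite /= g0 in Xe; rewrite /= g0 in Ye.
  have Xe' := near0_near0' Xe; have Ye' := near0_near0' Ye.
  near=> t; have t0 : t != 0 by near: t; exact: near0'_neq0.
  have cg : curve_of p q (gam t) by near: t.
  have Xt : xc (gam t) - xc P = t * X t.
    have -> : xc (gam t) = xc P + t * X t by near: t.
    by rewrite addrC addKr.
  have Yt : w (gam t) - w P = t * Y t.
    have -> : w (gam t) = w P + t * Y t by near: t.
    by rewrite addrC addKr.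
  apply: (mulfI t0); rewrite !mulrA -Xt -Yt -dkE -ddE -!wk//.
  by ring.
move: E; rewrite X00 mul0r g0 => /eqP; rewrite mulf_eq0 => /orP [/eqP //|].
have -> : w P ^+ 2 + w P * w P + w P ^+ 2 = 3 * w P ^+ 2 by ring.
by rewrite mulf_eq0 expf_eq0 (negPf w0) pnatr_eq0.
Unshelve. all: by end_near. Qed.

Lemma local_unramified : yr P * ys P != 0 -> exists u,
  [/\ analytic_at0 u, u 0 != 0 & \forall t \near (0 : K), xc (gam t) = xc P + u t * t].
Proof.
rewrite mulf_eq0 negb_or => /andP [y1 y2].
have [X [Xa X0 Xe]] := an1_shift_derive Kc ax.
exists X; split=> //; last first.
  by rewrite /= g0 in Xe; apply: filterS Xe => t ->; rewrite mulrC.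
rewrite -X0; apply/eqP => h; case: vel => /eqP; apply=> //.
  apply: (cube_velocity ar (k := p ^+ 2 * q)) => // Q /curve_yr3 ->.
  by rewrite hornerM horner_exp.
apply: (cube_velocity as_ (k := q ^+ 2 * p)) => // Q /curve_ys3 ->.
by rewrite hornerM horner_exp.
Qed.

Lemma local_ramified (q1 : {poly K}) : p.[xc P] != 0 -> q = ('X - (xc P)%:P) * q1 ->
  q1.[xc P] != 0 -> exists u v w,
  [/\ analytic_at0 u, analytic_at0 v & analytic_at0 w] /\
  [/\ u 0 != 0, v 0 != 0 & w 0 != 0] /\
  \forall t \near (0 : K)^', [/\ xc (gam t) = xc P + u t * t ^+ 3,
    yr (gam t) = v t * t & ys (gam t) = w t * t ^+ 2].
Proof.
move=> p0 qE q10; have [h1 h2 h3] := cP.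
have qP : q.[xc P] = 0 by rewrite qE hornerM !hornerE subrr mul0r.
have [yr0 ys0] : yr P = 0 /\ ys P = 0 by apply: curve_root; rewrite // h2 qP mulr0.
have [X [Xa X0 /near0_near0' Xe]] := an1_shift_derive Kc ax.
have [Y [Ya Y0 /near0_near0' Ye]] := an1_shift_derive Kc ar.
have [W [Wa W0 /near0_near0' We]] := an1_shift_derive Kc as_.
rewrite /= g0 yr0 in Ye; rewrite /= g0 ys0 in We; rewrite /= g0 in Xe.
have W00 : W 0 = 0.
  have : W 0 * p.[xc (gam 0)] = 0 * Y 0 ^+ 2.
    apply: (an1_eq0 Kc (f := fun t => W t * p.[xc (gam t)]) (g := fun t => t * Y t ^+ 2)).
    - by apply: (an1M Kc) => //; exact: (an1_horner Kc p ax).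
    - by apply: (an1M Kc); [exact: an1_id|exact: an1X].
    near=> t; have t0 : t != 0 by near: t; exact: near0'_neq0.
    have [k1 _ _] : curve_of p q (gam t) by near: t.
    apply: (mulfI t0); rewrite mulrA.
    have <- : ys (gam t) = t * W t by rewrite -[RHS]add0r; near: t.
    rewrite -k1; have -> : yr (gam t) = t * Y t by rewrite -[RHS]add0r; near: t.
    by ring.
  by rewrite mul0r g0 => /eqP; rewrite mulf_eq0 (negPf p0) orbF => /eqP.
have [V Va /near0_near0' Ve] := an1_shift Kc Wa; rewrite W00 in Ve.
pose U t := Y t * V t / (p.[xc (gam t)] * q1.[xc (gam t)]).
have pq1a : analytic_at0 (fun t => p.[xc (gam t)] * q1.[xc (gam t)]).
  by apply: (an1M Kc); apply: (an1_horner Kc) => //; exact: ax.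
have pq10 : p.[xc (gam 0)] * q1.[xc (gam 0)] != 0 by rewrite g0 mulf_neq0.
have Ua : analytic_at0 U.
  by apply: (an1M Kc); [exact: an1M|exact: an1V].
have E : \forall t \near (0 : K)^', [/\ xc (gam t) = xc P + U t * t ^+ 3,
    yr (gam t) = Y t * t, ys (gam t) = V t * t ^+ 2, Y t ^+ 2 = V t * p.[xc (gam t)] & X t = U t * t ^+ 2].
  have pqn := near0_near0' (an1_neq0 Kc pq1a pq10).
  near=> t; have t0 : t != 0 by near: t; exact: near0'_neq0.
  have [k1 k2 _] : curve_of p q (gam t) by near: t.
  have yE : yr (gam t) = Y t * t by rewrite mulrC -[RHS]add0r; near: t.
  have wE : ys (gam t) = V t * t ^+ 2.
    have -> : ys (gam t) = t * W t by rewrite -[RHS]add0r; near: t.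
    have -> : W t = t * V t by rewrite -[RHS]add0r; near: t.
    by ring.
  have n : p.[xc (gam t)] * q1.[xc (gam t)] != 0 by near: t.
  have xE : xc (gam t) = xc P + U t * t ^+ 3.
    rewrite /U mulrAC; apply/eqP; rewrite addrC -subr_eq; apply/eqP.
    apply: (mulIf n); rewrite mulfVK// mulrC.
    have -> : p.[xc (gam t)] * q1.[xc (gam t)] * (xc (gam t) - xc P) = p.[xc (gam t)] * q.[xc (gam t)].
      by rewrite qE hornerM hornerXsubC; ring.
    by rewrite -k2 yE wE; ring.
  split=> //.
    apply: (mulfI (expf_neq0 2 t0)).
    by transitivity (yr (gam t) ^+ 2); [rewrite yE|rewrite k1 wE]; ring.
  apply: (mulIf t0).
  have -> : X t * t = xc (gam t) - xc P.
    have -> : xc (gam t) = xc P + t * X t by near: t.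
    by ring.
  by rewrite xE; ring.
have X00 : X 0 = 0.
  have -> : X 0 = U 0 * 0 ^+ 2; last by rewrite expr0n /= mulr0.
  apply: (an1_eq0 Kc Xa (g := fun t => U t * t ^+ 2)).
    by apply: (an1M Kc) => //; apply: (an1X Kc); exact: an1_id.
  by apply: filterS E => t [].
have Y00 : Y 0 != 0.
  by case: vel; rewrite ?X0 ?Y0 ?W0 ?X00 ?W00 ?eqxx.
have V00 : V 0 != 0.
  apply: contraNneq Y00 => V00; rewrite -[_ == 0](expf_eq0 _ 2).
  have -> : Y 0 ^+ 2 = V 0 * p.[xc (gam 0)].
    apply: (an1_eq0 Kc (f := fun t => Y t ^+ 2) (g := fun t => V t * p.[xc (gam t)])).
    - exact: an1X.
    - by apply: (an1M Kc) => //; exact: (an1_horner Kc p ax).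
    by apply: filterS E => t [].
  by rewrite V00 mul0r.
exists U, Y, V; split; first by [].
split; first by split=> //; rewrite /U !mulf_neq0 ?invr_eq0.
by apply: filterS E => t [].
Unshelve. all: by end_near. Qed.

End LocalForms.

Section LocalPackage.
Variables (K : numFieldType) (Kc : abs_complete K).
Variables (p q : {poly K}).
Hypotheses (sp : simple_roots p q) (sq : simple_roots q p).
Implicit Types (P Q : pt K) (gam : K -> pt K).

Record good_gam gam (er es ed : int) : Prop := GoodGam {
  gg_curve : \forall t \near (0 : K)^', curve_of p q (gam t);
  gg_yr : has_order er (@yr K \o gam);
  gg_ys : has_order es (@ys K \o gam);
  gg_dx : has_order ed (derive1 (@xc K \o gam)) }.

Lemma gg_y_neq0 gam er es ed : good_gam gam er es ed ->
  \forall t \near (0 : K)^', yr (gam t) != 0 /\ ys (gam t) != 0.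
Proof.
move=> g; have h1 := order_neq0 Kc (gg_yr g); have h2 := order_neq0 Kc (gg_ys g).
by near=> t; split; near: t.
Unshelve. all: by end_near. Qed.

Record affine_form gam P (er es ed : int) (e : nat) (u : K -> K) : Prop := AffineForm {
  af_good : good_gam gam er es ed;
  af_at0 : gam 0 = P;
  af_x : analytic_at0 (@xc K \o gam);
  af_yr : analytic_at0 (@yr K \o gam);
  af_ys : analytic_at0 (@ys K \o gam);
  af_u : analytic_at0 u;
  af_u0 : u 0 != 0;
  af_xE : \forall t \near (0 : K)^', xc (gam t) = xc P + u t * t ^ e;
  af_dx : lead ed (derive1 (@xc K \o gam)) (e%:~R * u 0);
  af_cases : ([/\ yr P * ys P != 0, er = 0, es = 0, e = 1%N & ed = 0] \/
    [/\ yr P = 0, ys P = 0, e = 3%N & ed = 2]) /\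
    (e = 3%N -> (er = 1 /\ es = 2) \/ (er = 2 /\ es = 1)) }.

Lemma lead_derive_x gam (c : K) u (m : int) : analytic_at0 u -> u 0 != 0 -> m != 0 ->
  (\forall t \near (0 : K)^', xc (gam t) = c + u t * t ^ m) ->
  lead (m - 1) (derive1 (@xc K \o gam)) (m%:~R * u 0).
Proof.
move=> ua u0 m0 xE.
have [w [wa w0 wE]] := order_derive Kc (f := @xc K \o gam) ua u0 m0 xE.
by exists w.
Qed.

Lemma affine_formP gam P : curve_of p q P ->
  (\forall t \near (0 : K)^', curve_of p q (gam t)) -> gam 0 = P ->
  [/\ analytic_at0 (@xc K \o gam), analytic_at0 (@yr K \o gam) & analytic_at0 (@ys K \o gam)] ->
  [\/ derive1 (@xc K \o gam) 0 != 0, derive1 (@yr K \o gam) 0 != 0 |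
     derive1 (@ys K \o gam) 0 != 0] ->
  exists er es ed e u, affine_form gam P er es ed e u.
Proof.
move=> cP gC g0 [ax ar as_] vel; have [h1 h2 h3] := cP.
have [yP|yP] := eqVneq (yr P * ys P) 0; last first.
  have [u [ua u0 /near0_near0' uE]] := local_unramified Kc gC g0 ax ar as_ vel cP yP.
  have dx : lead 0 (derive1 (@xc K \o gam)) (1%N%:~R * u 0).
    by have := @lead_derive_x gam (xc P) u 1 ua u0 isT uE; rewrite subrr.
  move: (yP); rewrite mulf_eq0 negb_or => /andP [y1 y2].
  exists 0, 0, 0, 1%N, u; split=> //; last by split=> //; left; split.
  split=> //; last by apply: lead_order dx; rewrite mul1r.
  - by apply: order_an1; rewrite //= g0.
  - by apply: order_an1; rewrite //= g0.
have [yr0 ys0] := curve_root cP yP.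
have R (w z f : K -> K) : analytic_at0 w -> w 0 != 0 ->
    (\forall t \near (0 : K)^', f t = w t * t ^ 1) -> has_order 1 f by move=> ? ? ?; exists w.
move: h2; rewrite yP => /esym /eqP; rewrite mulf_eq0 => /orP [] /eqP k0.
  have [q0 [p1 pE p10]] := sp k0.
  have gC' : \forall t \near (0 : K)^', curve_of q p ((@swap_y K \o gam) t).
    by apply: filterS gC => t; exact: curve_swap.
  have g0' : (@swap_y K \o gam) 0 = swap_y P by rewrite /= g0.
  have vel' : [\/ derive1 (@xc K \o (@swap_y K \o gam)) 0 != 0,
      derive1 (@yr K \o (@swap_y K \o gam)) 0 != 0 | derive1 (@ys K \o (@swap_y K \o gam)) 0 != 0].
    by case: vel => v; [apply: Or31|apply: Or33|apply: Or32]; exact: v.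
  have [u [v [w [[ua va wa] [[u0 v0 w0] E]]]]] :=
    local_ramified Kc gC' g0' ax as_ ar vel' (curve_swap cP) q0 pE p10.
  have xE : \forall t \near (0 : K)^', xc (gam t) = xc P + u t * t ^ 3 by apply: filterS E => t [].
  have dx := lead_derive_x ua u0 (isT : (3 : int) != 0) xE.
  exists 2, 1, 2, 3%N, u; split=> //; last by split; [right; split|right; split].
  split=> //; last by apply: lead_order dx; rewrite mulf_neq0// pnatr_eq0.
  - by exists w; split=> //; apply: filterS E => t [].
  - by exists v; split=> //; apply: filterS E => t [].
have [p0 [q1 qE q10]] := sq k0.
have [u [v [w [[ua va wa] [[u0 v0 w0] E]]]]] :=
    local_ramified Kc gC g0 ax ar as_ vel cP p0 qE q10.
have xE : \forall t \near (0 : K)^', xc (gam t) = xc P + u t * t ^ 3 by apply: filterS E => t [].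
have dx := lead_derive_x ua u0 (isT : (3 : int) != 0) xE.
exists 1, 2, 2, 3%N, u; split=> //; last by split; [right; split|left; split].
split=> //; last by apply: lead_order dx; rewrite mulf_neq0// pnatr_eq0.
- by exists v; split=> //; apply: filterS E => t [].
- by exists w; split=> //; apply: filterS E => t [].
Qed.

Record infty_form gam (er es : nat) (u : K -> K) : Prop := InftyForm {
  if_good : good_gam gam (- er%:Z) (- es%:Z) (-4);
  if_u : analytic_at0 u;
  if_u0 : u 0 != 0;
  if_xE : \forall t \near (0 : K)^', xc (gam t) = u t * t ^ (-3) ;
  if_dx : lead (-4) (derive1 (@xc K \o gam)) (- 3 * u 0) }.

Lemma pole_order n (f : K -> K) : pole_of_order n f -> has_order (- n%:Z) f.
Proof. by move=> [h [ha [h0 fE]]]; exists h; split=> //; apply: filterS fE => t ->; rewrite exprnN. Qed.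

Lemma infty_formP gam er es : (\forall t \near (0 : K)^', curve_of p q (gam t)) ->
  [/\ pole_of_order 3 (@xc K \o gam), pole_of_order er (@yr K \o gam) &
      pole_of_order es (@ys K \o gam)] -> exists u, infty_form gam er es u.
Proof.
move=> gC [/pole_order [u [ua u0 uE]] /pole_order hr /pole_order hs].
have xE : \forall t \near (0 : K)^', xc (gam t) = 0 + u t * t ^ (-3).
  by apply: filterS uE => t; rewrite add0r.
have dx := lead_derive_x ua u0 (isT : (-3 : int) != 0) xE.
have e3 : (-3%:Z)%:~R = -3 :> K by rewrite intrN.
rewrite e3 in dx.
exists u; split=> //; split=> //.
by apply: lead_order dx; rewrite mulf_neq0// oppr_eq0 pnatr_eq0.
Qed.

Lemma order_x_infty gam er es u : infty_form gam er es u -> has_order (-3) (@xc K \o gam).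
Proof. by move=> h; exists u; split; [exact: if_u h|exact: if_u0 h|exact: if_xE h]. Qed.

Lemma lead_x_infty gam er es u c : infty_form gam er es u ->
  lead (-3) (fun t => xc (gam t) - c) (u 0).
Proof.
move=> h; exists (fun t => u t - c * t ^+ 3); split.
- apply: (an1B Kc); first exact: if_u h.
  by apply: (an1M Kc); [exact: an1_cst|apply: (an1X Kc); exact: an1_id].
- by rewrite expr0n /= mulr0 subr0.
- have hx := if_xE h; near=> t; have t0 : t != 0 by near: t; exact: near0'_neq0.
  rewrite mulrBl -mulrA -[t ^+ 3]/(t ^ 3) -expfzDr// addrN expr0z mulr1.
  by congr (_ - _); near: t.
Unshelve. all: by end_near. Qed.

Lemma order_x_affine gam P er es ed e u c : affine_form gam P er es ed e u -> xc P != c ->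
  has_order 0 (fun t => xc (gam t) - c).
Proof.
move=> h xc0; apply: order_an1.
  by apply: (an1B Kc); [exact: af_x h|exact: an1_cst].
by rewrite (af_at0 h) subr_eq0.
Qed.

Lemma lead_x_affine gam P er es ed e u : affine_form gam P er es ed e u ->
  lead e (fun t => xc (gam t) - xc P) (u 0).
Proof.
move=> h; exists u; split=> //; first exact: af_u h.
by apply: filterS (af_xE h) => t ->; rewrite addrAC subrr add0r.
Qed.

End LocalPackage.

(** * The differential of the third kind *)

Section SigmaPoles.
Variables (K : numFieldType) (Kc : abs_complete K).
Variables (p q : {poly K}).
Implicit Types (P Q : pt K) (gam : K -> pt K) (f g : K -> K).

Definition simple_pole (c : K) f := exists h : K -> K, analytic_at0 h /\
  \forall t \near (0 : K)^', f t = c / t + h t.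

Lemma lead_simple_pole c f : lead (-1) f c -> simple_pole c f.
Proof. by move=> /(lead_pole Kc) [h ha hE]; exists h. Qed.

Lemma hol_simple_pole f : hol f -> simple_pole 0 f.
Proof. by move=> [h ha hE]; exists h; split=> //; apply: filterS hE => t ->; rewrite mul0r add0r. Qed.

Lemma simple_pole_near c f g : (\forall t \near (0 : K)^', f t = g t) ->
  simple_pole c f -> simple_pole c g.
Proof.
move=> fg [h [ha hE]]; exists h; split=> //; near=> t.
by rewrite -(near fg t)//; near: t.
Unshelve. all: by end_near. Qed.

Lemma simple_poleD c f g : simple_pole c f -> hol g -> simple_pole c (fun t => f t + g t).
Proof.
move=> [h [ha hE]] [k ka kE]; exists (fun t => h t + k t); split; first exact: an1D.
by near=> t; rewrite addrA; congr (_ + _); near: t.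
Unshelve. all: by end_near. Qed.

Lemma simple_poleB c d f g : simple_pole c f -> simple_pole d g ->
  simple_pole (c - d) (fun t => f t - g t).
Proof.
move=> [h [ha hE]] [k [ka kE]]; exists (fun t => h t - k t); split; first exact: an1B.
near=> t; have -> : f t = c / t + h t by near: t.
have -> : g t = d / t + k t by near: t.
by rewrite mulrBl; ring.
Unshelve. all: by end_near. Qed.

Definition Sigma_dt gam Q t := Sigma (gam t) Q * derive1 (@xc K \o gam) t.

Definition Sigma_terms gam Q t :=
    derive1 (@xc K \o gam) t * (3 * (xc (gam t) - xc Q))^-1
    + (ys Q * (derive1 (@xc K \o gam) t * (ys (gam t))^-1 * (3 * (xc (gam t) - xc Q))^-1)
    + yr Q * (derive1 (@xc K \o gam) t * (yr (gam t))^-1 * (3 * (xc (gam t) - xc Q))^-1)).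

Lemma Sigma_dtE gam Q er es ed : good_gam p q gam er es ed ->
  \forall t \near (0 : K)^', Sigma_terms gam Q t = Sigma_dt gam Q t.
Proof.
move=> g; have y0 := gg_y_neq0 Kc g; near=> t.
have [y1 y2] : yr (gam t) != 0 /\ ys (gam t) != 0 by near: t.
rewrite /Sigma_terms /Sigma_dt /Sigma; have [->|x0] := eqVneq (xc (gam t) - xc Q) 0.
  by rewrite !(mulr0, mul0r) invr0 !(mulr0, mul0r, addr0).
by field; rewrite x0 y1 y2.
Unshelve. all: by end_near. Qed.

Lemma three_neq0 : (3 : K) != 0. Proof. by rewrite pnatr_eq0. Qed.

Lemma Sigma_infty gam Q (er es : nat) u : (0 < er)%N -> (0 < es)%N ->
  infty_form p q gam er es u -> simple_pole (-1) (Sigma_dt gam Q).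
Proof.
move=> er0 es0 g; have gg := if_good g; have u0 := if_u0 g.
apply: (simple_pole_near (Sigma_dtE Q gg)).
have lx := leadM Kc (lead_an1 (an1_cst Kc 3)) (lead_x_infty Kc (xc Q) g).
have c0 : 3 * u 0 != 0 by rewrite mulf_neq0// three_neq0.
have lx' := leadV Kc c0 lx.
apply: simple_poleD.
  apply: lead_simple_pole; have := leadM Kc (if_dx g) lx'.
  have -> : - 3 * u 0 * (3 * u 0)^-1 = -1 by field; rewrite u0.
  by rewrite add0r opprK.
have ox := lead_order (invr_neq0 c0) lx'; rewrite add0r opprK in ox.
have H (y : pt K -> K) (e : nat) : (0 < e)%N -> has_order (- e%:Z) (y \o gam) ->
    hol (fun t => derive1 (@xc K \o gam) t * (y (gam t))^-1 * (3 * (xc (gam t) - xc Q))^-1).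
  move=> e0 oy; have := orderM Kc (orderM Kc (gg_dx gg) (orderV Kc oy)) ox.
  by move=> /(hol_order Kc); apply; lia.
by apply: (holD Kc); apply: (holM Kc); rewrite ?H//; do ?[exact: hol_cst]; [apply: H es0 (gg_ys gg)|apply: H er0 (gg_yr gg)].
Qed.

Lemma Sigma_affine gam P Q er es ed e u : curve_of p q P -> curve_of p q Q ->
  affine_form p q gam P er es ed e u -> simple_pole (P == Q)%:R (Sigma_dt gam Q).
Proof.
move=> cP cQ g; have gg := af_good g; have u0 := af_u0 g.
have E := Sigma_dtE Q gg; have [cs cs3] := af_cases g.
have le_ed : [/\ er <= ed, es <= ed & 0 <= ed].
  by case: cs => [[_ -> -> _ ->] //|[_ _ e3 ->]]; case: (cs3 e3) => [[-> ->]|[-> ->]].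
have [le_r le_s le_0] := le_ed.
have [xPQ|xPQ] := eqVneq (xc P) (xc Q); last first.
  have -> : (P == Q) = false by apply: contra_neqF xPQ => /eqP ->.
  apply: hol_simple_pole; apply: (hol_near E).
  have ox := orderV Kc (orderM Kc (order_cst Kc three_neq0) (order_x_affine Kc g xPQ)).
  have hx : hol (fun t => (3 * (xc (gam t) - xc Q))^-1) by exact: (hol_order Kc ox).
  have hr := hol_order Kc (orderM Kc (gg_dx gg) (orderV Kc (gg_yr gg))).
  have hs := hol_order Kc (orderM Kc (gg_dx gg) (orderV Kc (gg_ys gg))).
  rewrite !subr_ge0 in hr hs.
  apply: (holD Kc); first by apply: (holM Kc) => //; exact: hol_order (gg_dx gg) _.
  by apply: (holD Kc); apply: (holM Kc); do ?[exact: hol_cst]; apply: (holM Kc) => //; [exact: hs|exact: hr].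
have lx := leadM Kc (lead_an1 (an1_cst Kc 3)) (lead_x_affine g).
have c0 : 3 * u 0 != 0 by rewrite mulf_neq0// three_neq0.
have lx' := leadV Kc c0 lx; rewrite xPQ in lx'.
case: cs => [[yP er0 es0 e1 ed0]|[yr0 ys0 e3 ed2]].
  move: (yP); rewrite mulf_eq0 negb_or => /andP [y1 y2].
  pose N t := yr (gam t) * ys (gam t) + yr (gam t) * ys Q + ys (gam t) * yr Q.
  have aN : analytic_at0 N.
    apply: (an1D Kc); [apply: (an1D Kc)|]; apply: (an1M Kc); do ?[exact: an1_cst];
      by [exact: (af_yr g)|exact: (af_ys g)].
  pose Y t := yr (gam t) * ys (gam t).
  have aY : analytic_at0 Y by apply: (an1M Kc); [exact: (af_yr g)|exact: (af_ys g)].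
  have Y0 : Y 0 = yr P * ys P by rewrite /Y (af_at0 g).
  have lY := leadV Kc (_ : Y 0 != 0) (lead_an1 aY); rewrite Y0 in lY.
  have := leadM Kc (leadM Kc (lead_an1 aN) (lY yP)) (leadM Kc (af_dx g) lx').
  rewrite ed0 e1 ?(add0r, oppr0) => L.
  have -> : (P == Q)%:R = N 0 * (yr P * ys P)^-1 * (1%N%:~R * u 0 * (3 * u 0)^-1).
    rewrite /N (af_at0 g); case: eqP => [<-|PQ].
      by rewrite -[true%:R]/(1 : K) mulr1z mul1r; field; rewrite u0 y1 y2.
    by rewrite (conj_sheet cP cQ y1 xPQ PQ) !mul0r.
  apply: lead_simple_pole; apply: lead_near L.
  have hy := gg_y_neq0 Kc gg.
  have hx := order_neq0 Kc (lead_order u0 (lead_x_affine g)).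
  near=> t.
  have [a1 a2] : yr (gam t) != 0 /\ ys (gam t) != 0 by near: t.
  have a3 : xc (gam t) - xc Q != 0 by rewrite -xPQ; near: t.
  rewrite /Sigma_dt /Sigma /N /Y; field.
  by rewrite a1 a2 a3.
have kQ : yr Q * ys Q = 0.
  have [_ -> _] := cQ; have [_ h _] := cP; by rewrite -xPQ -h yr0 mul0r.
have [yrQ ysQ] := curve_root cQ kQ.
have PQ : P = Q.
  rewrite (surjective_pairing P) (surjective_pairing P.1) (surjective_pairing Q) (surjective_pairing Q.1).
  by move: xPQ yr0 ys0 yrQ ysQ; rewrite /xc /yr /ys => -> -> -> -> ->.
rewrite PQ eqxx; apply: (simple_pole_near E).
rewrite /Sigma_terms yrQ ysQ; apply: lead_simple_pole; have := leadM Kc (af_dx g) lx'.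
have -> : e%:~R * u 0 * (3 * u 0)^-1 = 1.
  by rewrite e3 -[(3%N)%:~R]/(3%:R); field; rewrite u0.
rewrite ed2 e3 add0r; apply: lead_near; near=> t; rewrite !mul0r !addr0//.
Unshelve. all: by end_near. Qed.

End SigmaPoles.

Lemma prod_XsubC_root (K : fieldType) (I : finType) (c : I -> K) (x : K) :
  injective c -> (\prod_i ('X - (c i)%:P)).[x] = 0 ->
  exists i p1, [/\ x = c i, \prod_i ('X - (c i)%:P) = ('X - x%:P) * p1 & p1.[x] != 0].
Proof.
move=> c_inj /eqP; rewrite horner_prod prodf_seq_eq0 => /hasP [i _ /=].
rewrite hornerXsubC subr_eq0 => /eqP xi; exists i, (\prod_(j | j != i) ('X - (c j)%:P)).
split=> //; first by rewrite (bigD1 i) //= xi.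
rewrite horner_prod prodf_seq_neq0; apply/allP => j _; apply/implyP => ji.
by rewrite hornerXsubC subr_eq0 xi (inj_eq c_inj) eq_sym.
Qed.

Lemma simple_roots_kr (K : numFieldType) r s (b : 'I_(s + r) -> K) :
  injective b -> simple_roots (k_r b) (k_s b) /\ simple_roots (k_s b) (k_r b).
Proof.
move=> b_inj.
have b_injr : injective (fun i => b (rshift s i)) by move=> i j /b_inj /rshift_inj.
have b_injs : injective (fun i => b (lshift r i)) by move=> i j /b_inj /lshift_inj.
have lr i j : b (lshift r i) != b (rshift s j).
  by rewrite (inj_eq b_inj) eq_lrshift.
split=> x /prod_XsubC_root.
  move=> /(_ b_injr) [i [p1 [xi pE p10]]]; split; last by exists p1.
  rewrite xi horner_prod prodf_seq_neq0; apply/allP => j _ /=.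
  by rewrite hornerXsubC subr_eq0 eq_sym.
move=> /(_ b_injs) [i [p1 [xi pE p10]]]; split; last by exists p1.
rewrite xi horner_prod prodf_seq_neq0; apply/allP => j _ /=.
by rewrite hornerXsubC subr_eq0.
Qed.

Section ThirdKind.
Variables (K : numFieldType) (Kc : abs_complete K).
Variables (r s : nat) (b : 'I_(s + r) -> K).
Hypotheses (r0 : (0 < r)%N) (rs : (r < s)%N) (b_inj : injective b).
Implicit Types (P Q : pt K) (gam : K -> pt K) (o : option (pt K)).

Let p := k_r b.
Let q := k_s b.

Lemma local_affine P gam : local_coord b (Some P) gam ->
  exists er es ed e u, affine_form p q gam P er es ed e u.
Proof.
have [sp sq] := simple_roots_kr b_inj.
by move=> [gC [cP g0 an vel]]; exact: (affine_formP Kc sp sq cP gC g0 an vel).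
Qed.

Lemma local_infty gam : local_coord b None gam ->
  exists u, infty_form p q gam (rhat r s) (shat r s) u.
Proof. by move=> [gC an]; exact: (infty_formP Kc gC an). Qed.

Definition Sigma_res Q o : K := if o is Some P then (P == Q)%:R else -1.

Lemma Sigma_pole Q o gam : curve b Q -> surface b o -> local_coord b o gam ->
  simple_pole (Sigma_res Q o) (Sigma_dt gam Q).
Proof.
move=> cQ; case: o => [P|] /= cP.
  by move=> /local_affine [er [es [ed [e [u h]]]]]; exact: (Sigma_affine Kc cP cQ h).
move=> /local_infty [u h]; apply: (Sigma_infty Kc _ _ _ h); rewrite /rhat /shat; lia.
Qed.

Lemma Pi3_pole P1 P2 o : curve b P1 -> curve b P2 -> surface b o ->
  simple_pole_at b (Pi3 P1 P2) o (Sigma_res P1 o - Sigma_res P2 o).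
Proof.
move=> c1 c2 so gam lg.
have [h [ha hE]] := simple_poleB Kc (Sigma_pole c1 so lg) (Sigma_pole c2 so lg).
exists h; split=> //; apply: filterS hE => t <-.
by rewrite /pullback /Pi3 /Sigma_dt mulrBl.
Qed.

Lemma Pi3_third_kind P1 P2 : curve b P1 -> curve b P2 -> P1 <> P2 ->
  [/\ third_kind b (Pi3 P1 P2),
      forall o, surface b o -> o <> Some P1 -> o <> Some P2 ->
        holomorphic_at b (Pi3 P1 P2) o,
      simple_pole_at b (Pi3 P1 P2) (Some P1) 1 &
      simple_pole_at b (Pi3 P1 P2) (Some P2) (-1)].
Proof.
move=> c1 c2 ne; have ne' : (P1 == P2) = false by apply/eqP.
split.
- by move=> o so; exists (Sigma_res P1 o - Sigma_res P2 o); exact: Pi3_pole.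
- move=> o so o1 o2 gam lg; have := Pi3_pole c1 c2 so lg.
  have -> : Sigma_res P1 o - Sigma_res P2 o = 0.
    case: o so o1 o2 lg => [P|] _ o1 o2 _ /=; last by rewrite subrr.
    case: eqP => [e|_]; first by rewrite e in o1.
    case: eqP => [e|_]; first by rewrite e in o2.
    by rewrite subrr.
  move=> [h [ha hE]]; exists h; split=> //.
  by apply: filterS hE => t ->; rewrite mul0r add0r.
- have := @Pi3_pole P1 P2 (Some P1) c1 c2 c1.
  by rewrite /= eqxx ne' subr0.
- have := @Pi3_pole P1 P2 (Some P2) c1 c2 c2.
  by rewrite /= eqxx eq_sym ne' sub0r.
Qed.

End ThirdKind.

(** * The fundamental differential *)

Section MerToAnalytic.
Variables (K : numFieldType) (Kc : abs_complete K).
Implicit Types (F h : K * K -> K) (f g : K -> K).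

Lemma hol_bounded f : hol f -> exists C, \forall t \near (0 : K)^', `|f t| <= C.
Proof.
move=> [g /(an1P Kc) /(an2_bounded Kc) [C /near00P [e e0 hC]] /near0'P [d d0 fg]].
have [c [c0 ce cd]] := gt0_min2 e0 d0.
exists C; apply/near0'P; exists c => // t tc t0; rewrite fg ?(lt_le_trans tc)//.
by apply: (hC (t, 0)); rewrite /= ?normr0// (lt_le_trans tc).
Qed.

(* A meromorphic germ with possible poles only on the axes, whose restrictions
   to the generic horizontal and vertical lines are holomorphic, is analytic. *)
Lemma mer2_analytic F : mer2 F ->
  (\forall y \near (0 : K)^', exists2 g, hol g & \forall x \near (0 : K)^', F (x, y) = g x) ->
  (\forall x \near (0 : K)^', exists2 g, hol g & \forall y \near (0 : K)^', F (x, y) = g y) ->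
  exists2 k, analytic2_at0 k &
    \forall z \near ((0, 0) : K * K), z.1 != 0 -> z.2 != 0 -> F z = k z.
Proof.
move=> [n [h [ah /near00P [e e0 hF]]]] /near0'P [e1 e10 H1] /near0'P [e2 e20 H2].
have [k1 ak1 /near00P [d d0 hk1]] : exists2 k, analytic2_at0 k &
    \forall z \near ((0, 0) : K * K), h z = z.1 ^+ n * k z.
  apply: (an2_clear Kc ah).
  have [c [c0 ce ce1]] := gt0_min2 e0 e10.
  apply/near0'P; exists c => // y yc y0.
  have [g /hol_bounded [C /near0'P [v v0 gC]] /near0'P [w w0 Fg]] := H1 y (lt_le_trans yc ce1) y0.
  exists (C * `|y| ^+ n); have [c' [c'0 c'v c'w]] := gt0_min2 v0 w0.
  have [u [u0 uc' uc]] := gt0_min2 c'0 c0.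
  apply/near0'P; exists u => // x xu x0.
  have := hF (x, y) (lt_le_trans xu (le_trans uc ce)) (lt_le_trans yc ce) x0 y0.
  rewrite Fg ?(lt_le_trans xu (le_trans uc' c'w))//=.
  move=> Fe; have -> : h (x, y) = g x * (x * y) ^+ n.
    by rewrite Fe mulfVK// expf_neq0// mulf_neq0.
  rewrite normrM normrX normrM exprMn [`|x| ^+ n * _]mulrC mulrA.
  rewrite ler_wpM2r ?exprn_ge0// ler_wpM2r ?exprn_ge0// gC//.
  exact: lt_le_trans xu (le_trans uc' c'v).
have [k2 ak2 /near00P [d2 d20 hk2]] : exists2 k, analytic2_at0 k &
    \forall z \near ((0, 0) : K * K), k1 (z.2, z.1) = z.1 ^+ n * k z.
  apply: (an2_clear Kc (an2_swap Kc ak1)).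
  have [c [c0 ce ce1]] := gt0_min2 e0 e20; have [c1 [c10 c1c c1d]] := gt0_min2 c0 d0.
  apply/near0'P; exists c1 => // x xc x0.
  have xc' := lt_le_trans xc c1c.
  have [g /hol_bounded [C /near0'P [v v0 gC]] /near0'P [w w0 Fg]] := H2 x (lt_le_trans xc' ce1) x0.
  exists C; have [c' [c'0 c'v c'w]] := gt0_min2 v0 w0.
  have [u [u0 uc' uc]] := gt0_min2 c'0 c10.
  apply/near0'P; exists u => // y yu y0.
  have yc := lt_le_trans yu uc.
  have := hF (x, y) (lt_le_trans xc' ce) (lt_le_trans (lt_le_trans yc c1c) ce) x0 y0.
  rewrite hk1 ?(lt_le_trans xc c1d) ?(lt_le_trans yc c1d)//.
  rewrite Fg ?(lt_le_trans yu (le_trans uc' c'w))//= => E.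
  have -> : k1 (x, y) = g y * y ^+ n.
    by rewrite E exprMn; field; rewrite !expf_neq0.
  rewrite normrM normrX ler_wpM2r ?exprn_ge0// gC//.
  exact: lt_le_trans yu (le_trans uc' c'v).
exists (fun z => k2 (z.2, z.1)); first exact: an2_swap.
have [c [c0 ce cd]] := gt0_min2 e0 d0; have [c1 [c10 c1c c1d]] := gt0_min2 c0 d20.
apply/near00P; exists c1 => // z zx zy z1 z2.
have L (a : K) : a < c1 -> [/\ a < e, a < d & a < d2].
  by move=> ac; split; apply: lt_le_trans ac _ => //; apply: le_trans c1c _.
have [x1 x2 x3] := L _ zx; have [y1 y2 y3] := L _ zy.
rewrite hF// hk1//; have := hk2 (z.2, z.1) y3 x3; rewrite /= -surjective_pairing => ->.
by rewrite exprMn; field; rewrite !expf_neq0.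
Qed.

End MerToAnalytic.

Section MerNumerators.
Variables (K : numFieldType) (Kc : abs_complete K).
Implicit Types (P Q : pt K) (gam del : K -> pt K) (F G : K * K -> K) (f g : K -> K).

Lemma mer2_dd (p : {poly K}) F G : mer2 F -> mer2 G -> mer2 (fun z => dd p (F z) (G z)).
Proof.
move=> mF mG; apply: (mer2_sum Kc) => i; apply: (mer2M Kc); first exact: mer2_cst.
apply: (mer2_sum Kc) => j; by apply: (mer2M Kc); exact: mer2X.
Qed.

Lemma mer2_ddX n F G : mer2 F -> mer2 G -> mer2 (fun z => ddX n (F z) (G z)).
Proof.
by move=> mF mG; apply: (mer2_sum Kc) => j; apply: (mer2M Kc); exact: mer2X.
Qed.

Lemma mer2_dd2 (p : {poly K}) F G : mer2 F -> mer2 G -> mer2 (fun z => dd2 p (F z) (G z)).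
Proof.
move=> mF mG; apply: (mer2_sum Kc) => i; apply: (mer2M Kc); first exact: mer2_cst.
apply: (mer2_sum Kc) => j; apply: (mer2M Kc); first exact: mer2X.
exact: mer2_ddX.
Qed.

Definition mero f := hol f \/ exists m, has_order m f.

Record mero_pt gam : Prop := MeroPt {
  mp_x : mero (@xc K \o gam);
  mp_yr : exists m, has_order m (@yr K \o gam);
  mp_ys : exists m, has_order m (@ys K \o gam);
  mp_dx : exists m, has_order m (derive1 (@xc K \o gam)) }.

Ltac mer2_tac := repeat first
  [ assumption | exact: (mer2_cst Kc) | apply: mer2_dd | apply: mer2_dd2 | apply: mer2_ddX
  | apply: (mer2B Kc) | apply: (mer2D Kc) | apply: (mer2M Kc) | apply: (mer2X Kc) | apply: (mer2_poly Kc) ].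

Variables (gam del : K -> pt K).
Hypotheses (mg : mero_pt gam) (md : mero_pt del).

Lemma mer2_xc_fst : mer2 (fun z => xc (gam z.1)). Proof. exact: (mer2_fst Kc (mp_x mg)). Qed.
Lemma mer2_xc_snd : mer2 (fun z => xc (del z.2)). Proof. exact: (mer2_snd Kc (mp_x md)). Qed.
Lemma mer2_yr_fst : mer2 (fun z => yr (gam z.1)). Proof. exact: (mer2_fst Kc (or_intror (mp_yr mg))). Qed.
Lemma mer2_yr_snd : mer2 (fun z => yr (del z.2)). Proof. exact: (mer2_snd Kc (or_intror (mp_yr md))). Qed.
Lemma mer2_ys_fst : mer2 (fun z => ys (gam z.1)). Proof. exact: (mer2_fst Kc (or_intror (mp_ys mg))). Qed.
Lemma mer2_ys_snd : mer2 (fun z => ys (del z.2)). Proof. exact: (mer2_snd Kc (or_intror (mp_ys md))). Qed.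

Lemma mer2_Gnum (p q : {poly K}) : mer2 (fun z => Gnum p q (gam z.1) (del z.2)).
Proof.
have := mer2_xc_fst; have := mer2_xc_snd; have := mer2_yr_fst; have := mer2_yr_snd; have := mer2_ys_fst; have := mer2_ys_snd => *.
by rewrite /Gnum; mer2_tac.
Qed.

Lemma mer2_opp F : mer2 F -> mer2 (fun z => - F z).
Proof.
move=> /(mer2M Kc (mer2_cst Kc (-1))); apply: mer2_near.
by apply/near00P; exists 1 => // z _ _ _ _; rewrite mulN1r.
Qed.

Lemma mer2_diag_num (p q : {poly K}) M : mer2 (fun z => diag_num p q M (gam z.1) (del z.2)).
Proof.
have := mer2_xc_fst; have := mer2_xc_snd; have := mer2_yr_fst; have := mer2_yr_snd; have := mer2_ys_fst; have := mer2_ys_snd => *.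
rewrite /diag_num /num2_at /num1_at /num0_at /num0 /num1 /num2 /=.
by repeat first [apply: mer2_opp | progress mer2_tac].
Qed.

End MerNumerators.

Section OmegaLocal.
Variables (K : numFieldType) (Kc : abs_complete K).
Variables (croot : forall a : K, exists y, y ^+ 3 = a).
Variables (om : K) (omE : om ^+ 2 + om + 1 = 0).
Variables (r s : nat) (b : 'I_(s + r) -> K).
Hypotheses (r0 : (0 < r)%N) (rs : (r < s)%N) (rs3 : (r != s %[mod 3])%N).
Hypothesis b_inj : injective b.
Variables (phi : nat -> monom) (phiB : hat_basis r s phi).
Variable nuII : 'I_(genus r s) -> pt K -> K.
Hypothesis nuII_rel : second_kind_relation b phi nuII.
Implicit Types (P Q : pt K) (gam del : K -> pt K) (o : option (pt K)).

Let p := k_r b.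
Let q := k_s b.
Let W := Omega b phi nuII.

Lemma Omega_sym P Q : generic b P Q -> W P Q = W Q P.
Proof.
move=> g; rewrite /W /Omega; have := nuII_rel g; rewrite sumrB => /eqP.
by rewrite subr_eq addrAC eq_sym subr_eq eq_sym addrC => /eqP <-; rewrite addrC.
Qed.

Lemma nuII_forms : exists U V : 'I_(genus r s) -> {poly K}, forall i P, curve b P ->
  yr P * ys P != 0 -> nuII i P = ((U i).[xc P] * yr P + (V i).[xc P] * ys P) / (yr P * ys P).
Proof.
have /fin_all_exists [U /fin_all_exists [V h]] :
    forall i, exists u, exists v, forall P, curve b P -> yr P * ys P != 0 ->
    yr P * ys P * nuII i P = u.[xc P] * yr P + v.[xc P] * ys P.
  by move=> i; exact: (nuII_form croot omE r0 rs rs3 phiB nuII_rel).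
exists U, V => i P cP yP; rewrite -h// mulrAC mulfV// mul1r//.
Qed.

Lemma Omega_generic P Q : generic b P Q -> W P Q =
  Gnum p q P Q / (9 * (xc P - xc Q) ^+ 2 * yr P * ys P * yr Q * ys Q) +
  \sum_(i < genus r s) nuI phi i P * nuII i Q.
Proof. by move=> g; rewrite /W /Omega (dSigmaE croot omE g). Qed.

Lemma local_pack o gam : surface b o -> local_coord b o gam ->
  (\forall t \near (0 : K)^', curve b (gam t) /\ yr (gam t) * ys (gam t) != 0) /\
  mero_pt gam /\
  (forall c, (exists m, has_order m (fun t => xc (gam t) - c))).
Proof.
case: o => [P|] /= cP lg.
  have [er [es [ed [e [u h]]]]] := local_affine Kc b_inj lg.
  have gg := af_good h; split; last split.
  - have h1 := gg_y_neq0 Kc gg; have h2 := gg_curve gg; near=> t; split; first by near: t.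
    by have [? ?] : yr (gam t) != 0 /\ ys (gam t) != 0; [near: t|rewrite mulf_neq0].
  - split; [by left; apply: hol_an1; exact: af_x h|by exists er; case: gg|by exists es; case: gg|by exists ed; case: gg].
  - move=> c; have [<-|xc0] := eqVneq (xc P) c.
      by exists e; apply: lead_order (af_u0 h) (lead_x_affine h).
    by exists 0; exact: (order_x_affine Kc h xc0).
have [u h] := local_infty Kc lg; have gg := if_good h; split; last split.
- have h1 := gg_y_neq0 Kc gg; have h2 := gg_curve gg; near=> t; split; first by near: t.
  by have [? ?] : yr (gam t) != 0 /\ ys (gam t) != 0; [near: t|rewrite mulf_neq0].
- split; [by right; exists (-3); exact: order_x_infty h| | |]; case: gg => *; by eexists; eassumption.
- by move=> c; exists (-3); exact: lead_order (if_u0 h) (lead_x_infty Kc c h).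
Unshelve. all: by end_near. Qed.

Lemma x_avoid o gam c : surface b o -> local_coord b o gam ->
  \forall t \near (0 : K)^', xc (gam t) != c.
Proof.
move=> so lg; have [_ [_ /(_ c) [m /(order_neq0 Kc) h]]] := local_pack so lg.
by apply: filterS h => t; rewrite subr_eq0.
Qed.

Definition x_away o (c : K) : bool := if o is Some P then xc P != c else true.

Lemma Omega_hol o gam Q : surface b o -> local_coord b o gam -> curve b Q ->
  yr Q * ys Q != 0 -> x_away o (xc Q) ->
  hol (fun t => W (gam t) Q * derive1 (@xc K \o gam) t).
Proof.
move=> so lg cQ yQ oQ.
have [near_c [_ /(_ (xc Q)) [mx ox]]] := local_pack so lg.
pose dx := derive1 (@xc K \o gam).
pose T (k : nat) (y : K -> K) t : K := dx t * (xc (gam t) - xc Q)^-1 ^+ k * (y t)^-1.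
have E : \forall t \near (0 : K)^',
    ((2 * q^`().[xc Q] * p.[xc Q] + q.[xc Q] * p^`().[xc Q]) * ys Q * (9 * (yr Q * ys Q))^-1) * T 1%N (@ys K \o gam) t
  + ((2 * p^`().[xc Q] * q.[xc Q] + p.[xc Q] * q^`().[xc Q]) * yr Q * (9 * (yr Q * ys Q))^-1) * T 1%N (@yr K \o gam) t
  + 3^-1 * T 2%N (fun => 1) t + ys Q * 3^-1 * T 2%N (@ys K \o gam) t + yr Q * 3^-1 * T 2%N (@yr K \o gam) t
  + \sum_(i < genus r s) nuII i Q * 3^-1 * (monom_eval (phi i) (gam t) * dx t * (yr (gam t))^-1 * (ys (gam t))^-1)
  = W (gam t) Q * derive1 (@xc K \o gam) t.
  have x0 := x_avoid (xc Q) so lg; near=> t.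
  have [ct yt] : curve b (gam t) /\ yr (gam t) * ys (gam t) != 0 by near: t.
  have xt : xc (gam t) != xc Q by near: t.
  have gPQ : generic b (gam t) Q by split.
  rewrite (Omega_generic gPQ) [RHS]mulrDl; congr (_ + _).
    have xt' : xc (gam t) - xc Q != 0 by rewrite subr_eq0.
    move: yt yQ; rewrite !mulf_eq0 !negb_or => /andP [a1 a2] /andP [b1 b2].
    by rewrite /T /Gnum /dx /=; field; rewrite xt' a1 a2 b1 b2.
  rewrite mulr_suml; apply: eq_bigr => i _; rewrite /nuI /dx.
  move: yt; rewrite !mulf_eq0 !negb_or => /andP [a1 a2].
  by field; rewrite a1 a2.
apply: (hol_near E).
suff [h1 h2] : [/\ forall k y, (k = 1%N /\ (y = @ys K \o gam \/ y = @yr K \o gam)) \/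
    (k = 2%N /\ (y = (fun=> 1) \/ y = @ys K \o gam \/ y = @yr K \o gam)) -> hol (T k y) &
   forall i : 'I_(genus r s),
     hol (fun t => monom_eval (phi i) (gam t) * dx t * (yr (gam t))^-1 * (ys (gam t))^-1)].
  have hc (c : K) (f : K -> K) : hol f -> hol (fun t => c * f t).
    by move=> hf; exact: (holM Kc (hol_cst Kc c) hf).
  have hsum : hol (fun t => \sum_(i < genus r s) nuII i Q * 3^-1 *
      (monom_eval (phi i) (gam t) * dx t * (yr (gam t))^-1 * (ys (gam t))^-1)).
    by apply: (hol_sum Kc) => i; apply: hc; exact: h2.
  have k1 : hol (T 1%N (@ys K \o gam)) by apply: h1; left; split=> //; left.
  have k2 : hol (T 1%N (@yr K \o gam)) by apply: h1; left; split=> //; right.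
  have k3 : hol (T 2%N (fun=> 1)) by apply: h1; right; split=> //; left.
  have k4 : hol (T 2%N (@ys K \o gam)) by apply: h1; right; split=> //; right; left.
  have k5 : hol (T 2%N (@yr K \o gam)) by apply: h1; right; split=> //; right; right.
  exact: (holD Kc (holD Kc (holD Kc (holD Kc (holD Kc (hc _ _ k1) (hc _ _ k2)) (hc _ _ k3))
    (hc _ _ k4)) (hc _ _ k5)) hsum).
have o1 : has_order 0 (fun _ : K => 1 : K) by exact: (order_cst Kc (oner_neq0 K)).
case: o so lg oQ => [P|] /= so lg oQ.
  have [er [es [ed [e [u h]]]]] := local_affine Kc b_inj lg.
  have gg := af_good h; have [cs cs3] := af_cases h.
  have le_ed : [/\ er <= ed, es <= ed & 0 <= ed].
    by case: cs => [[_ -> -> _ ->] //|[_ _ e3 ->]]; case: (cs3 e3) => [[-> ->]|[-> ->]].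
  have [le_r le_s le_0] := le_ed.
  have ox0 := orderV Kc (order_x_affine Kc h oQ).
  have hT k y ey : has_order ey y -> ey <= ed -> hol (T k y).
    move=> oy le; have := orderM Kc (orderM Kc (gg_dx gg) (orderX Kc k ox0)) (orderV Kc oy).
    by move=> /(hol_order Kc); apply; rewrite oppr0 mul0r addr0 subr_ge0.
  split.
    move=> k y [[_ [->|->]]|[_ [->|[->|->]]]]; [exact: hT (gg_ys gg) _|exact: hT (gg_yr gg) _|exact: hT o1 _|
       exact: hT (gg_ys gg) _|exact: hT (gg_yr gg) _].
  move=> i; have [a [ee pe]] := phi_shape r0 rs rs3 phiB (ltn_ord i).
  have hx : hol (fun t => xc (gam t) ^+ a) by apply: (holX Kc); apply: hol_an1; exact: af_x h.
  pose y := if ee then (@ys K \o gam) else (@yr K \o gam).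
  have hD f ef : has_order ef f -> ef <= ed -> hol (fun t => dx t * (f t)^-1).
    by move=> hf le; apply: (hol_order Kc (orderM Kc (gg_dx gg) (orderV Kc hf))); rewrite subr_ge0.
  apply: (@hol_near _ (fun t => xc (gam t) ^+ a * (dx t * (y t)^-1))); last first.
    by apply: (holM Kc) => //; rewrite /y; case: (ee); [apply: hD (gg_ys gg) _|apply: hD (gg_yr gg) _].
  near=> t; have [ct yt] : curve b (gam t) /\ yr (gam t) * ys (gam t) != 0 by near: t.
  move: yt; rewrite !mulf_eq0 !negb_or => /andP [a1 a2].
  have F1 (X c d v : K) : c != 0 -> d != 0 -> X * (v * d^-1) = X * c * 1 * v * c^-1 * d^-1.
    by move=> c0 d0; field; rewrite c0 d0.
  have F2 (X c d v : K) : c != 0 -> d != 0 -> X * (v * c^-1) = X * 1 * d * v * c^-1 * d^-1.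
    by move=> c0 d0; field; rewrite c0 d0.
  by rewrite /monom_eval pe /y; case: (ee); [exact: F1|exact: F2].
have [u h] := local_infty Kc lg; have gg := if_good h.
have ox3 := orderV Kc (lead_order (if_u0 h) (lead_x_infty Kc (xc Q) h)); rewrite opprK in ox3.
have hT k y ey : has_order ey y -> 0 <= -4 + 3 * k%:Z - ey -> hol (T k y).
  move=> oy le; have := orderM Kc (orderM Kc (gg_dx gg) (orderX Kc k ox3)) (orderV Kc oy).
  by move=> /(hol_order Kc); apply.
have [gr gs] : (0 < rhat r s)%N /\ (0 < shat r s)%N by rewrite /rhat /shat; lia.
split.
  move=> k y [[-> [->|->]]|[-> [->|[->|->]]]]; [apply: hT (gg_ys gg) _|apply: hT (gg_yr gg) _|apply: hT o1 _|
       apply: hT (gg_ys gg) _|apply: hT (gg_yr gg) _] => //; lia.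
move=> i; have := phi_order r0 rs rs3 phiB (ltn_ord i).
case pe : (phi i) => [[a e] f]; rewrite /monom_order /= => le.
have omon := orderM Kc (orderM Kc (orderX Kc a (order_x_infty h)) (orderX Kc e (gg_yr gg))) (orderX Kc f (gg_ys gg)).
have := orderM Kc (orderM Kc (orderM Kc omon (gg_dx gg)) (orderV Kc (gg_yr gg))) (orderV Kc (gg_ys gg)).
move=> /(hol_order Kc); apply.
move: le; rewrite /rhat /shat; case: e {pe omon} => /=; case: f => /=; lia.
Unshelve. all: by end_near. Qed.

End OmegaLocal.

Section DoublePole.
Variables (K : numFieldType) (Kc : abs_complete K).
Variables (p q : {poly K}).
Implicit Types (P Q : pt K) (gam del : K -> pt K) (F : K * K -> K).

Lemma near00_fst (A : K -> Prop) : (\forall t \near (0 : K)^', A t) ->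
  \forall z \near ((0, 0) : K * K), z.1 != 0 -> A z.1.
Proof. by move=> /near0'P [e e0 h]; apply/near00P; exists e => // z z1 _; exact: h. Qed.

Lemma near00_snd (A : K -> Prop) : (\forall t \near (0 : K)^', A t) ->
  \forall z \near ((0, 0) : K * K), z.2 != 0 -> A z.2.
Proof. by move=> /near0'P [e e0 h]; apply/near00P; exists e => // z _ z2; exact: h. Qed.

Lemma an2_neq0 h : analytic2_at0 h -> h (0, 0) != 0 ->
  \forall z \near ((0, 0) : K * K), h z != 0.
Proof.
move=> ah h0.
have [qs [ds [aqs ads hqs hds]]] := an2_shift Kc ah.
have [qt [dt [aqt adt hqt hdt]]] := an2_shift Kc (an2_swap Kc ah).
have [B1 /near00P [e1 e10 hB1]] := an2_bounded Kc aqs.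
have [B2 /near00P [e2 e20 hB2]] := an2_bounded Kc aqt.
move: hqs hqt => /near00P [e3 e30 hqs] /near00P [e4 e40 hqt].
have [c1 [c10 c1a c1b]] := gt0_min2 e10 e20; have [c2 [c20 c2a c2b]] := gt0_min2 e30 e40.
have [c3 [c30 c3a c3b]] := gt0_min2 c10 c20.
have P1 : 0 < `|h (0, 0)| by rewrite normr_gt0.
have B10 : 0 <= B1 by apply: le_trans (hB1 (0, 0) _ _); rewrite /= ?normr0.
have B20 : 0 <= B2 by apply: le_trans (hB2 (0, 0) _ _); rewrite /= ?normr0.
have BB : 0 < B1 + B2 + 1 by rewrite ltr_wpDl// addr_ge0.
have f0 : 0 < `|h (0, 0)| / (B1 + B2 + 1) by rewrite divr_gt0.
have [c [cgt cc cf]] := gt0_min2 c30 f0.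
apply/near00P; exists c => // z z1 z2.
have L (a w : K) : c3 <= a -> `|w| < c -> `|w| < a.
  by move=> ca wc; apply: lt_le_trans wc (le_trans cc ca).
have E1 := hqs z (L _ _ (le_trans c3b c2a) z1) (L _ _ (le_trans c3b c2a) z2).
have E2 := hqt (z.2, 0) (L _ _ (le_trans c3b c2b) z2).
rewrite /= normr0 e40 in E2; have {}E2 := E2 isT.
have N1 := hB1 z (L _ _ (le_trans c3a c1a) z1) (L _ _ (le_trans c3a c1a) z2).
have N2 := hB2 (z.2, 0) (L _ _ (le_trans c3a c1b) z2).
rewrite /= normr0 e20 in N2; have {}N2 := N2 isT.
apply/eqP => hz.
have : `|h (0, 0)| < `|h (0, 0)|.
  have e00 : h (0, 0) = - (z.1 * qs z + z.2 * qt (z.2, 0)).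
    by rewrite -E1 -E2 hz; ring.
  rewrite {1}e00 normrN; apply: le_lt_trans (ler_normD _ _) _; rewrite !normrM.
  apply: (@le_lt_trans _ _ (c * B1 + c * B2)).
    by apply: lerD; apply: ler_pM => //; exact: ltW.
  rewrite -mulrDr; apply: (@lt_le_trans _ _ (c * (B1 + B2 + 1))).
    by rewrite ltr_pM2l// ltrDl.
  by rewrite -ler_pdivlMr.
by rewrite ltxx.
Qed.

Lemma order1_quot u : analytic_at0 u -> u 0 != 0 -> exists k,
  [/\ analytic2_at0 k, k (0, 0) != 0 &
    \forall z \near ((0, 0) : K * K), u z.1 * z.1 - u z.2 * z.2 = (z.1 - z.2) * k z].
Proof.
move=> ua u0; pose f t := u t * t.
have fa : analytic_at0 f by apply: (an1M Kc) => //; exact: an1_id.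
have [k [_ [ka _ /near00P [e e0 kE] _]]] := an2_diag Kc (h := fun z => f z.1) ((an1P Kc f).1 fa).
exists k; split=> //; last by apply/near00P; exists e.
suff -> : k (0, 0) = u 0 by [].
apply: (an1_eq0 Kc (f := fun t => k (t, 0)) (g := u)) => //; first exact: an2_slice1.
apply/near0'P; exists e => // t te t0; apply: (mulfI t0).
have := kE (t, 0) te; rewrite /= normr0 => /(_ e0).
by rewrite /f mulr0 !subr0 => <-; rewrite mulrC.
Qed.

Section Cases.
Variables (gam del : K -> pt K).
Hypotheses (mg : mero_pt gam) (md : mero_pt del).

Lemma double_pole_inv : (exists2 F, mer2 F & \forall z \near ((0, 0) : K * K),
    z.1 != 0 -> z.2 != 0 -> (xc (gam z.1) - xc (del z.2))^-1 = F z) ->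
  exists2 E, mer2 E & \forall z \near ((0, 0) : K * K), z.1 != 0 -> z.2 != 0 ->
    1 * (Gnum p q (gam z.1) (del z.2) / (xc (gam z.1) - xc (del z.2)) ^+ 2) = E z.
Proof.
move=> [F mF FE]; exists (fun z => Gnum p q (gam z.1) (del z.2) * F z ^+ 2).
  by apply: (mer2M Kc); [exact: mer2_Gnum|exact: mer2X].
by near=> z => z1 z2; rewrite mul1r -exprVn; congr (_ * _ ^+ 2); apply: (near FE z).
Unshelve. all: by end_near. Qed.

Hypotheses (cg : \forall t \near (0 : K)^', curve_of p q (gam t) /\ yr (gam t) * ys (gam t) != 0)
  (cd : \forall t \near (0 : K)^', curve_of p q (del t) /\ yr (del t) * ys (del t) != 0).

Lemma mer2_inv_yr2 : mer2 (fun z => ys (gam z.1) * (yr (gam z.1))^-1 ^+ 2) /\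
  mer2 (fun z => ys (del z.2) * (yr (del z.2))^-1 ^+ 2).
Proof.
split; apply: (mer2M Kc); [exact: mer2_ys_fst|apply: (mer2X Kc)|exact: mer2_ys_snd|apply: (mer2X Kc)].
  have [m o] := mp_yr mg; apply: (mer2_fst Kc (f := fun t => (yr (gam t))^-1)).
  by right; exists (- m); exact: orderV.
have [m o] := mp_yr md; apply: (mer2_snd Kc (f := fun t => (yr (del t))^-1)).
by right; exists (- m); exact: orderV.
Qed.

Lemma curve_inv_p P : curve_of p q P -> yr P * ys P != 0 ->
  p.[xc P] != 0 /\ ys P * (yr P)^-1 ^+ 2 = p.[xc P]^-1.
Proof.
move=> [h1 h2 _]; rewrite mulf_eq0 negb_or => /andP [y1 y2].
have p0 : p.[xc P] != 0.
  by apply: contra_neq y1 => p0; move: h1; rewrite p0 mulr0 => /eqP; rewrite expf_eq0 => /eqP.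
by split=> //; rewrite exprVn h1; field; rewrite p0 y2.
Qed.

Lemma double_pole_param M D : mer2 D ->
  (exists2 F, mer2 F & \forall z \near ((0, 0) : K * K), z.1 != 0 -> z.2 != 0 ->
    xc (gam z.1) != xc (del z.2) ->
    xc (del z.2) ^+ M * yr (gam z.1) - xc (gam z.1) ^+ M * yr (del z.2) != 0 /\
    D z / (xc (del z.2) ^+ M * yr (gam z.1) - xc (gam z.1) ^+ M * yr (del z.2)) ^+ 2 = F z) ->
  exists2 E, mer2 E & \forall z \near ((0, 0) : K * K), z.1 != 0 -> z.2 != 0 ->
    xc (gam z.1) != xc (del z.2) ->
    D z * (Gnum p q (gam z.1) (del z.2) / (xc (gam z.1) - xc (del z.2)) ^+ 2) = E z.
Proof.
move=> mD [F mF FE]; have [i1 i2] := mer2_inv_yr2.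
exists (fun z => F z * diag_num p q M (gam z.1) (del z.2) *
  ((ys (gam z.1) * (yr (gam z.1))^-1 ^+ 2) * (ys (del z.2) * (yr (del z.2))^-1 ^+ 2))).
  by apply: (mer2M Kc); apply: (mer2M Kc) => //; exact: mer2_diag_num.
have c1 := near00_fst cg; have c2 := near00_snd cd.
near=> z => z1 z2 xx.
have [cP yP] : curve_of p q (gam z.1) /\ yr (gam z.1) * ys (gam z.1) != 0 by apply: (near c1 z).
have [cQ yQ] : curve_of p q (del z.2) /\ yr (del z.2) * ys (del z.2) != 0 by apply: (near c2 z).
have [n0 <-] : xc (del z.2) ^+ M * yr (gam z.1) - xc (gam z.1) ^+ M * yr (del z.2) != 0 /\
    D z / (xc (del z.2) ^+ M * yr (gam z.1) - xc (gam z.1) ^+ M * yr (del z.2)) ^+ 2 = F z.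
  by apply: (near FE z).
have [p1 ->] := curve_inv_p cP yP; have [p2 ->] := curve_inv_p cQ yQ.
have := Gnum_diag M cP cQ; set A := _ - _ in n0 *; set G := Gnum _ _ _ _; set J := diag_num _ _ _ _ _.
set d := xc _ - xc _ => EJ; have d0 : d != 0 by rewrite subr_eq0.
have -> : J = A ^+ 2 * (p.[xc (gam z.1)] * p.[xc (del z.2)] * G) / d ^+ 2.
  by rewrite EJ mulrAC mulfV ?mul1r// expf_neq0.
by field; rewrite n0 p1 p2 d0.
Unshelve. all: by end_near. Qed.

End Cases.
End DoublePole.

Section DoublePoleCases.
Variables (K : numFieldType) (Kc : abs_complete K).
Implicit Types (P Q : pt K) (gam del : K -> pt K) (p q : {poly K}).

Definition double_pole p q gam del (D : K * K -> K) := exists2 E, mer2 E &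
  \forall z \near ((0, 0) : K * K), z.1 != 0 -> z.2 != 0 -> xc (gam z.1) != xc (del z.2) ->
    D z * (Gnum p q (gam z.1) (del z.2) / (xc (gam z.1) - xc (del z.2)) ^+ 2) = E z.

Lemma an2_sub : analytic2_at0 (fun z : K * K => z.1 - z.2).
Proof. by apply: (an2B Kc); [exact: an2_fst|exact: an2_snd]. Qed.

Lemma double_pole_unramified p q gam u (c : K) : mero_pt gam -> analytic_at0 u -> u 0 != 0 ->
  (\forall t \near (0 : K)^', xc (gam t) = c + u t * t) ->
  double_pole p q gam gam (fun z => (z.1 - z.2) ^+ 2).
Proof.
move=> mg ua u0 xE; have [k [ka k0 kE]] := order1_quot Kc ua u0.
have kV := an2V Kc ka k0; have kn := an2_neq0 Kc ka k0.
exists (fun z => Gnum p q (gam z.1) (gam z.2) * (k z)^-1 ^+ 2).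
  by apply: (mer2M Kc); [exact: mer2_Gnum|apply: (mer2X Kc); exact: mer2_an2].
have x1 := near00_fst xE; have x2 := near00_snd xE.
near=> z => z1 z2 xx.
have e1 : xc (gam z.1) = c + u z.1 * z.1 by apply: (near x1 z).
have e2 : xc (gam z.2) = c + u z.2 * z.2 by apply: (near x2 z).
have e3 : xc (gam z.1) - xc (gam z.2) = (z.1 - z.2) * k z.
  have <- : u z.1 * z.1 - u z.2 * z.2 = (z.1 - z.2) * k z by near: z.
  by rewrite e1 e2; ring.
have kz : k z != 0 by near: z.
have zz : z.1 - z.2 != 0.
  by apply: contra_neq xx => zz; apply/eqP; rewrite -subr_eq0 e3 zz mul0r.
by rewrite e3; field; rewrite kz zz.
Unshelve. all: by end_near. Qed.

Lemma double_pole_param1 p q gam M : mero_pt gam ->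
  (\forall t \near (0 : K)^', curve_of p q (gam t) /\ yr (gam t) * ys (gam t) != 0) ->
  (exists m, has_order m (fun t => xc (gam t) ^+ M)) ->
  has_order 1 (fun t => yr (gam t) * (xc (gam t) ^+ M)^-1) ->
  double_pole p q gam gam (fun z => (z.1 - z.2) ^+ 2).
Proof.
move=> mg cg [m ox] [u [ua u0 uE]].
have [k [ka k0 kE]] := order1_quot Kc ua u0.
have kV := an2V Kc ka k0; have kn := an2_neq0 Kc ka k0.
apply: (double_pole_param Kc mg mg cg cg (M := M)).
  by apply: mer2_an2; apply: (an2X Kc); exact: an2_sub.
have i1 : mer2 (fun z => (xc (gam z.1) ^+ M)^-1).
  apply: (mer2_fst Kc (f := fun t => (xc (gam t) ^+ M)^-1)); right; exists (- m); exact: orderV.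
have i2 : mer2 (fun z => (xc (gam z.2) ^+ M)^-1).
  apply: (mer2_snd Kc (f := fun t => (xc (gam t) ^+ M)^-1)); right; exists (- m); exact: orderV.
exists (fun z => ((xc (gam z.1) ^+ M)^-1 * (xc (gam z.2) ^+ M)^-1 * (k z)^-1) ^+ 2).
  by apply: (mer2X Kc); apply: (mer2M Kc); [exact: mer2M|exact: mer2_an2].
have xn := order_neq0 Kc ox.
have y1 := near00_fst uE; have y2 := near00_snd uE.
have n1 := near00_fst xn; have n2 := near00_snd xn.
near=> z => z1 z2 xx.
have x1 : xc (gam z.1) ^+ M != 0 by apply: (near n1 z).
have x2 : xc (gam z.2) ^+ M != 0 by apply: (near n2 z).
have e1 : yr (gam z.1) * (xc (gam z.1) ^+ M)^-1 = u z.1 * z.1 ^ 1 by apply: (near y1 z).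
have e2 : yr (gam z.2) * (xc (gam z.2) ^+ M)^-1 = u z.2 * z.2 ^ 1 by apply: (near y2 z).
have e3 : xc (gam z.2) ^+ M * yr (gam z.1) - xc (gam z.1) ^+ M * yr (gam z.2) =
    xc (gam z.1) ^+ M * xc (gam z.2) ^+ M * ((z.1 - z.2) * k z).
  have <- : u z.1 * z.1 - u z.2 * z.2 = (z.1 - z.2) * k z by near: z.
  rewrite -[u z.1 * z.1]e1 -[u z.2 * z.2]e2; field; by rewrite x1 x2.
have kz : k z != 0 by near: z.
have zz : z.1 - z.2 != 0 by apply: contra_neq xx => /eqP; rewrite subr_eq0 => /eqP ->.
rewrite e3; split; first by rewrite !mulf_neq0.
by field; rewrite kz zz x1 x2.
Unshelve. all: by end_near. Qed.

Lemma double_pole_swap p q gam del D :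
  double_pole q p (@swap_y K \o gam) (@swap_y K \o del) D -> double_pole p q gam del D.
Proof.
move=> [E mE EE]; exists E => //; near=> z => z1 z2 xx.
have <- : D z * (Gnum q p (swap_y (gam z.1)) (swap_y (del z.2)) /
    (xc (gam z.1) - xc (del z.2)) ^+ 2) = E z by apply: (near EE z).
by rewrite Gnum_swap.
Unshelve. all: by end_near. Qed.

Lemma mero_swap gam : mero_pt gam -> mero_pt (@swap_y K \o gam).
Proof. by case=> a1 a2 a3 a4; split. Qed.

Lemma double_pole_sheets p q gam del : mero_pt gam -> mero_pt del ->
  (\forall t \near (0 : K)^', curve_of p q (gam t) /\ yr (gam t) * ys (gam t) != 0) ->
  (\forall t \near (0 : K)^', curve_of p q (del t) /\ yr (del t) * ys (del t) != 0) ->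
  analytic_at0 (@yr K \o gam) -> analytic_at0 (@yr K \o del) ->
  yr (gam 0) != yr (del 0) -> double_pole p q gam del (fun _ => 1).
Proof.
move=> mg md cg cd ag ad ne.
pose k z := yr (gam z.1) - yr (del z.2).
have ka : analytic2_at0 k.
  by apply: (an2B Kc); [exact: ((an1P Kc _).1 ag)|exact: ((an1_snd Kc _).1 ad)].
have k0 : k (0, 0) != 0 by rewrite /k subr_eq0.
have kV := an2V Kc ka k0; have kn := an2_neq0 Kc ka k0.
apply: (double_pole_param Kc mg md cg cd (M := 0%N)); first exact: mer2_cst.
exists (fun z => (k z)^-1 ^+ 2); first by apply: (mer2X Kc); exact: mer2_an2.
near=> z => z1 z2 xx; rewrite !mul1r; split; first by near: z.
by rewrite exprVn.
Unshelve. all: by end_near. Qed.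

Lemma double_pole_inv' p q gam del : mero_pt gam -> mero_pt del ->
  (exists2 F, mer2 F & \forall z \near ((0, 0) : K * K),
    z.1 != 0 -> z.2 != 0 -> (xc (gam z.1) - xc (del z.2))^-1 = F z) ->
  double_pole p q gam del (fun _ => 1).
Proof.
move=> mg md /(double_pole_inv Kc p q mg md) [E mE EE]; exists E => //.
by near=> z => z1 z2 _; apply: (near EE z).
Unshelve. all: by end_near. Qed.

Lemma inv_aff_aff (f g : K -> K) : analytic_at0 f -> analytic_at0 g -> f 0 != g 0 ->
  mer2 (fun z => (f z.1 - g z.2)^-1).
Proof.
move=> fa ga ne; apply: mer2_an2; apply: (an2V Kc (h := fun z => f z.1 - g z.2)).
  by apply: (an2B Kc); [exact: ((an1P Kc _).1 fa)|exact: ((an1_snd Kc _).1 ga)].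
by rewrite subr_eq0.
Qed.

Lemma inv_aff_infty (f g u : K -> K) : analytic_at0 f -> analytic_at0 u -> u 0 != 0 ->
  (\forall t \near (0 : K)^', g t = u t * t ^ (-3)) ->
  exists2 F, mer2 F & \forall z \near ((0, 0) : K * K),
    z.1 != 0 -> z.2 != 0 -> (f z.1 - g z.2)^-1 = F z.
Proof.
move=> fa ua u0 gE; pose xi t : K := (u t)^-1 * t ^+ 3.
have xa : analytic_at0 xi.
  by apply: (an1M Kc); [exact: an1V|apply: (an1X Kc); exact: an1_id].
pose k z := f z.1 * xi z.2 - 1.
have ka : analytic2_at0 k.
  apply: (an2B Kc); last exact: an2_cst.
  by apply: (an2M Kc); [exact: ((an1P Kc _).1 fa)|exact: ((an1_snd Kc _).1 xa)].
have k0 : k (0, 0) != 0 by rewrite /k /xi /= expr0n /= !mulr0 sub0r oppr_eq0 oner_neq0.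
exists (fun z => xi z.2 * (k z)^-1).
  by apply: mer2_an2; apply: (an2M Kc); [exact: ((an1_snd Kc _).1 xa)|exact: an2V].
have g2 := near00_snd gE; have u2 := near00_snd (near0_near0' (an1_neq0 Kc ua u0)).
have kn := an2_neq0 Kc ka k0.
near=> z => z1 z2.
have e : g z.2 = u z.2 * (z.2 ^+ 3)^-1 by apply: (near g2 z).
have un : u z.2 != 0 by apply: (near u2 z).
have kz : k z != 0 by near: z.
have e2 : f z.1 - g z.2 = (u z.2 * (z.2 ^+ 3)^-1) * k z.
  by rewrite e /k /xi; field; rewrite un z2.
by rewrite e2 /xi; field; rewrite un z2 kz.
Unshelve. all: by end_near. Qed.

Lemma inv_infty_aff (f g u : K -> K) : analytic_at0 f -> analytic_at0 u -> u 0 != 0 ->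
  (\forall t \near (0 : K)^', g t = u t * t ^ (-3)) ->
  exists2 F, mer2 F & \forall z \near ((0, 0) : K * K),
    z.1 != 0 -> z.2 != 0 -> (g z.1 - f z.2)^-1 = F z.
Proof.
move=> fa ua u0 gE; have [F mF /near00P [e e0 FE]] := inv_aff_infty fa ua u0 gE.
exists (fun z => - F (z.2, z.1)); first exact: (mer2_opp Kc (mer2_swap Kc mF)).
apply/near00P; exists e => // z zx zy z1 z2.
by rewrite -(FE (z.2, z.1) zy zx z2 z1) /= -invrN opprB.
Qed.

End DoublePoleCases.

Section OmegaGlobal.
Variables (K : numFieldType) (Kc : abs_complete K).
Variables (croot : forall a : K, exists y, y ^+ 3 = a).
Variables (om : K) (omE : om ^+ 2 + om + 1 = 0).
Variables (r s : nat) (b : 'I_(s + r) -> K).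
Hypotheses (r0 : (0 < r)%N) (rs : (r < s)%N) (rs3 : (r != s %[mod 3])%N).
Hypothesis b_inj : injective b.
Variables (phi : nat -> monom) (phiB : hat_basis r s phi).
Variable nuII : 'I_(genus r s) -> pt K -> K.
Hypothesis nuII_rel : second_kind_relation b phi nuII.
Implicit Types (P Q : pt K) (gam del : K -> pt K) (o : option (pt K)).

Let p := k_r b.
Let q := k_s b.
Let W := Omega b phi nuII.

Lemma double_pole_local o o' gam del : surface b o -> surface b o' ->
  local_coord b o gam -> local_coord b o' del -> o <> o' ->
  double_pole p q gam del (fun _ => 1).
Proof.
move=> so so' lg ld ne.
have [cg [mg _]] := local_pack Kc b_inj so lg.
have [cd [md _]] := local_pack Kc b_inj so' ld.
case: o so lg ne => [P|] /= cP lg ne; case: o' so' ld ne => [Q|] /= cQ ld ne.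
- have [er [es [ed [e [u h]]]]] := local_affine Kc b_inj lg.
  have [er' [es' [ed' [e' [u' h']]]]] := local_affine Kc b_inj ld.
  have [xPQ|xPQ] := eqVneq (xc P) (xc Q); last first.
    apply: double_pole_inv' => //.
    exists (fun z => (xc (gam z.1) - xc (del z.2))^-1); last by near=> z.
    apply: (inv_aff_aff Kc (af_x h) (af_x h')).
    by rewrite /= (af_at0 h) (af_at0 h').
  have PQ : P <> Q by move=> e0; apply: ne; rewrite e0.
  have yP : yr P != 0.
    apply/eqP => yP; apply: PQ.
    have k0 : yr P * ys P = 0 by rewrite yP mul0r.
    have [_ ysP] := curve_root cP k0.
    have kQ : yr Q * ys Q = 0.
      by have [_ -> _] := cQ; have [_ k0' _] := cP; rewrite -xPQ -k0'.
    have [yrQ ysQ] := curve_root cQ kQ.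
    rewrite (surjective_pairing P) (surjective_pairing P.1) (surjective_pairing Q) (surjective_pairing Q.1).
    by move: xPQ yP ysP yrQ ysQ; rewrite /xc /yr /ys => -> -> -> -> ->.
  apply: (double_pole_sheets Kc mg md cg cd (af_yr h) (af_yr h')).
  rewrite (af_at0 h) (af_at0 h'); apply/eqP => ey; apply: PQ.
  exact: (curve_eq cP cQ yP xPQ ey).
- have [er [es [ed [e [u h]]]]] := local_affine Kc b_inj lg.
  have [u' h'] := local_infty Kc ld.
  apply: double_pole_inv' => //.
  exact: (inv_aff_infty Kc (af_x h) (if_u h') (if_u0 h') (if_xE h')).
- have [er [es [ed [e [u h]]]]] := local_affine Kc b_inj ld.
  have [u' h'] := local_infty Kc lg.
  apply: double_pole_inv' => //.
  exact: (inv_infty_aff Kc (af_x h) (if_u h') (if_u0 h') (if_xE h')).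
- by case: ne.
Unshelve. all: by end_near. Qed.

Lemma order_expr0 (f : K -> K) : exists m, has_order m (fun t => f t ^+ 0).
Proof. by exists 0; apply: (order_cst Kc (oner_neq0 K)). Qed.

Lemma double_pole_diag o gam : surface b o -> local_coord b o gam ->
  double_pole p q gam gam (fun z => (z.1 - z.2) ^+ 2).
Proof.
move=> so lg; have [cg [mg _]] := local_pack Kc b_inj so lg.
have cg' : \forall t \near (0 : K)^', curve_of q p ((@swap_y K \o gam) t) /\
    yr ((@swap_y K \o gam) t) * ys ((@swap_y K \o gam) t) != 0.
  apply: filterS cg => t [ct yt]; split; first exact: curve_swap.
  by rewrite mulrC.
case: o so lg => [P|] /= cP lg.
  have [er [es [ed [e [u h]]]]] := local_affine Kc b_inj lg.
  have gg := af_good h; have [cs cs3] := af_cases h.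
  case: cs => [[_ _ _ e1 _]|[_ _ e3 _]].
    apply: (double_pole_unramified Kc p q mg (af_u h) (af_u0 h) (c := xc P)).
    by apply: filterS (af_xE h) => t ->; rewrite e1.
  have O y : has_order 1 y -> has_order 1 (fun t => y t * (xc (gam t) ^+ 0)^-1).
    by apply: order_near; near=> t; rewrite expr0 invr1 mulr1.
  case: (cs3 e3) => [[er1 es2]|[er2 es1]].
    apply: (double_pole_param1 Kc mg cg (M := 0%N)); first exact: order_expr0.
    by apply: (O (@yr K \o gam)); rewrite -er1; exact: gg_yr gg.
  apply: double_pole_swap.
  apply: (double_pole_param1 Kc (mero_swap mg) cg' (M := 0%N)); first exact: order_expr0.
  by apply: (O (@ys K \o gam)); rewrite -es1; exact: gg_ys gg.
have [u h] := local_infty Kc lg; have gg := if_good h.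
have ox M := orderX Kc M (order_x_infty h).
have : (rhat r s %% 3 = 2)%N \/ (shat r s %% 3 = 2)%N.
  by move/eqP: rs3; rewrite /rhat /shat; lia.
case=> m3.
  pose M := ((rhat r s).+1 %/ 3)%N.
  apply: (double_pole_param1 Kc mg cg (M := M)); first by exists (-3 * M%:Z); exact: ox.
  have := orderM Kc (gg_yr gg) (orderV Kc (ox M)).
  have -> // : - (rhat r s)%:Z + - (-3 * M%:Z) = 1 by rewrite /M; lia.
pose M := ((shat r s).+1 %/ 3)%N.
apply: double_pole_swap.
apply: (double_pole_param1 Kc (mero_swap mg) cg' (M := M)); first by exists (-3 * M%:Z); exact: ox.
have := orderM Kc (gg_ys gg) (orderV Kc (ox M)).
have -> // : - (shat r s)%:Z + - (-3 * M%:Z) = 1 by rewrite /M; lia.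
Unshelve. all: by end_near. Qed.

Lemma generic_near2 o o' gam del : surface b o -> surface b o' ->
  local_coord b o gam -> local_coord b o' del ->
  \forall y \near (0 : K)^', \forall x \near (0 : K)^', generic b (gam x) (del y).
Proof.
move=> so so' lg ld.
have [cg [mg _]] := local_pack Kc b_inj so lg.
have [cd [md _]] := local_pack Kc b_inj so' ld.
apply: filterS cd => y [cy yy]; have xy := x_avoid Kc b_inj (xc (del y)) so lg.
near=> x; have [cx yx] : curve b (gam x) /\ yr (gam x) * ys (gam x) != 0 by near: x.
by split=> //; near: x.
Unshelve. all: by end_near. Qed.

Lemma genericC P Q : generic b P Q -> generic b Q P.
Proof. by move=> [cP cQ yP yQ xPQ]; split=> //; rewrite eq_sym. Qed.

Lemma Omega_mer2 gam del (D : K * K -> K) : mero_pt gam -> mero_pt del ->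
  mer2 D -> double_pole p q gam del D -> exists2 F, mer2 F &
  \forall z \near ((0, 0) : K * K), z.1 != 0 -> z.2 != 0 ->
    generic b (gam z.1) (del z.2) -> D z * pullback2 W gam del z = F z.
Proof.
move=> mg md mD [E mE EE].
have [U [V UV]] := nuII_forms croot omE r0 rs rs3 phiB nuII_rel.
have := mer2_xc_fst Kc mg; have := mer2_xc_snd Kc md; have := mer2_yr_fst Kc mg; have := mer2_yr_snd Kc md.
have := mer2_ys_fst Kc mg; have := mer2_ys_snd Kc md => ms2 ms1 mr2 mr1 mx2 mx1.
have inv1 (f : K -> K) : (exists m, has_order m f) -> mer2 (fun z => (f z.1)^-1).
  by move=> [m o]; apply: (mer2_fst Kc (f := fun t => (f t)^-1)); right; exists (- m); exact: orderV.
have inv2 (f : K -> K) : (exists m, has_order m f) -> mer2 (fun z => (f z.2)^-1).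
  by move=> [m o]; apply: (mer2_snd Kc (f := fun t => (f t)^-1)); right; exists (- m); exact: orderV.
have ir1 := inv1 _ (mp_yr mg); have is1 := inv1 _ (mp_ys mg).
have ir2 := inv2 _ (mp_yr md); have is2 := inv2 _ (mp_ys md).
have d1 := mer2_fst Kc (or_intror (mp_dx mg)); have d2 := mer2_snd Kc (or_intror (mp_dx md)).
pose A (z : K * K) := (yr (gam z.1))^-1 * (ys (gam z.1))^-1.
pose B (z : K * K) := (yr (del z.2))^-1 * (ys (del z.2))^-1.
have mA : mer2 A by exact: mer2M.
have mB : mer2 B by exact: mer2M.
pose dx2 (z : K * K) := derive1 (@xc K \o gam) z.1 * derive1 (@xc K \o del) z.2.
have mdx : mer2 dx2 by exact: mer2M.
exists (fun z => (E z * (9^-1 * (A z * B z)) + D z * \sum_(i < genus r s)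
   3^-1 * (xc (gam z.1) ^+ (phi i).1.1 * yr (gam z.1) ^+ (phi i).1.2 * ys (gam z.1) ^+ (phi i).2 * A z) *
     (((U i).[xc (del z.2)] * yr (del z.2) + (V i).[xc (del z.2)] * ys (del z.2)) * B z)) * dx2 z).
  apply: (mer2M Kc) => //; apply: (mer2D Kc); apply: (mer2M Kc) => //.
    by apply: (mer2M Kc); [exact: mer2_cst|exact: mer2M].
  apply: (mer2_sum Kc) => i; apply: (mer2M Kc); apply: (mer2M Kc) => //.
  - exact: mer2_cst.
  - by apply: (mer2M Kc) => //; apply: (mer2M Kc); [apply: (mer2M Kc)|]; exact: mer2X.
  - by apply: (mer2D Kc); apply: (mer2M Kc) => //; exact: (mer2_poly Kc).
near=> z => z1 z2 g; have [cP cQ yP yQ xPQ] := g.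
rewrite /pullback2 -mulrA -/(dx2 z) mulrA; congr (_ * _).
rewrite /W (Omega_generic croot omE phi nuII g) mulrDr; congr (_ + _).
  have <- : D z * (Gnum p q (gam z.1) (del z.2) / (xc (gam z.1) - xc (del z.2)) ^+ 2) = E z.
    by apply: (near EE z).
  have x0 : xc (gam z.1) - xc (del z.2) != 0 by rewrite subr_eq0.
  move: yP yQ; rewrite !mulf_eq0 !negb_or => /andP [a1 a2] /andP [b1 b2].
  by rewrite /A /B -/p -/q; field; rewrite x0 a1 a2 b1 b2.
congr (_ * _); apply: eq_bigr => i _; rewrite (UV i _ cQ yQ) /nuI /monom_eval.
move: yP yQ; rewrite !mulf_eq0 !negb_or => /andP [a1 a2] /andP [b1 b2].
by rewrite /A /B; field; rewrite a1 a2 b1 b2.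
Unshelve. all: by end_near. Qed.

Lemma Omega_analytic o o' gam del (D : K * K -> K) : surface b o -> surface b o' ->
  local_coord b o gam -> local_coord b o' del -> analytic2_at0 D ->
  (forall y, hol (fun x => D (x, y))) -> (forall x, hol (fun y => D (x, y))) ->
  double_pole p q gam del D -> exists2 k, analytic2_at0 k &
  \forall z \near ((0, 0) : K * K), z.1 != 0 -> z.2 != 0 ->
    generic b (gam z.1) (del z.2) -> D z * pullback2 W gam del z = k z.
Proof.
move=> so so' lg ld aD D1 D2 dp.
have [cg [mg _]] := local_pack Kc b_inj so lg.
have [cd [md _]] := local_pack Kc b_inj so' ld.
have [F mF FE] := Omega_mer2 mg md (mer2_an2 aD) dp.
have av o1 o1' del1 : surface b o1' -> local_coord b o1' del1 ->
    \forall y \near (0 : K)^', x_away o1 (xc (del1 y)).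
  case: o1 => [P|] so1 l1; last by near=> y.
  by apply: filterS (x_avoid Kc b_inj (xc P) so1 l1) => y; rewrite eq_sym.
have /near00P [e e0 FE'] := FE.
have [k ak kE] : exists2 k, analytic2_at0 k &
    \forall z \near ((0, 0) : K * K), z.1 != 0 -> z.2 != 0 -> F z = k z.
  apply: (mer2_analytic Kc mF).
    have g2 := generic_near2 so so' lg ld; have avy := av o o' del so' ld.
    have /near0'P [e1 e10 H] : \forall y \near (0 : K)^', [/\ curve b (del y),
        yr (del y) * ys (del y) != 0, x_away o (xc (del y)) &
        \forall x \near (0 : K)^', generic b (gam x) (del y)].
      by apply: filterS3 cd avy g2 => y [cy yy] a1 a2; split.
    have [c [c0 ce ce1]] := gt0_min2 e0 e10.
    apply/near0'P; exists c => // y yc y0.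
    have [cy yy oy gy] := H y (lt_le_trans yc ce1) y0.
    have h := Omega_hol Kc croot omE r0 rs rs3 b_inj phiB nuII so lg cy yy oy.
    exists (fun x => D (x, y) * (W (gam x) (del y) * derive1 (@xc K \o gam) x) *
      derive1 (@xc K \o del) y).
      by apply: (holM Kc); [apply: (holM Kc)|exact: hol_cst].
    have /near0'P [e2 e20 gy'] := gy; have [d [d0 de de2]] := gt0_min2 e0 e20.
    apply/near0'P; exists d => // x xd x0.
    rewrite -(FE' (x, y) (lt_le_trans xd de) (lt_le_trans yc ce) x0 y0 (gy' x (lt_le_trans xd de2) x0)).
    by rewrite /pullback2 /= !mulrA.
  have g2 := generic_near2 so' so ld lg; have avy := av o' o gam so lg.
  have /near0'P [e1 e10 H] : \forall y \near (0 : K)^', [/\ curve b (gam y),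
        yr (gam y) * ys (gam y) != 0, x_away o' (xc (gam y)) &
        \forall x \near (0 : K)^', generic b (del x) (gam y)].
    by apply: filterS3 cg avy g2 => y [cy yy] a1 a2; split.
  have [c [c0 ce ce1]] := gt0_min2 e0 e10.
  apply/near0'P; exists c => // x xc0 x0.
  have [cx yx ox gx] := H x (lt_le_trans xc0 ce1) x0.
  have h := Omega_hol Kc croot omE r0 rs rs3 b_inj phiB nuII so' ld cx yx ox.
  exists (fun y => D (x, y) * (W (del y) (gam x) * derive1 (@xc K \o del) y) *
      derive1 (@xc K \o gam) x).
    by apply: (holM Kc); [apply: (holM Kc)|exact: hol_cst].
  have /near0'P [e2 e20 gx'] := gx; have [d [d0 de de2]] := gt0_min2 e0 e20.
  apply/near0'P; exists d => // y yd y0.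
  have g := genericC (gx' y (lt_le_trans yd de2) y0).
  rewrite -(FE' (x, y) (lt_le_trans xc0 ce) (lt_le_trans yd de) x0 y0 g).
  by rewrite /pullback2 /= /W (Omega_sym nuII_rel g); ring.
exists k => //; near=> z => z1 z2 g.
have <- : F z = k z by apply: (near kE z).
by apply: (near FE z).
Unshelve. all: by end_near. Qed.

End OmegaGlobal.

Section Fundamental.
Variables (K : numFieldType) (Kc : abs_complete K).
Implicit Types (P Q : pt K) (gam del : K -> pt K) (o : option (pt K)).

Lemma near0'_near (A : K -> Prop) : (\forall t \near (0 : K)^', A t) ->
  \forall t \near (0 : K)^', \forall s \near t^', A s.
Proof.
move=> /near0'P [e e0 h]; apply/near0'P; exists e => // t te t0.
have d0 : 0 < e - `|t| by rewrite subr_gt0.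
have n0 : 0 < `|t| by rewrite normr_gt0.
have [c [c0 cd cn]] := gt0_min2 d0 n0.
apply/nbhs_ballP; exists c => // s; rewrite /ball /= => ts _; apply: h.
  rewrite -[s](subrK t); apply: le_lt_trans (ler_normD _ _) _.
  by rewrite -ltrBrDr distrC; exact: lt_le_trans ts cd.
by apply: contraTneq ts => ->; rewrite subr0 le_gtF.
Qed.

Lemma near00_near (A : K * K -> Prop) : (\forall z \near ((0, 0) : K * K), A z) ->
  \forall t \near (0 : K)^', \forall s \near t^', A (s, t).
Proof.
move=> /near00P [e e0 h]; apply/near0'P; exists e => // t te t0.
have d0 : 0 < e - `|t| by rewrite subr_gt0.
apply/nbhs_ballP; exists (e - `|t|) => // s; rewrite /ball /= => ts _; apply: h => //.
rewrite /= -[s](subrK t); apply: le_lt_trans (ler_normD _ _) _.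
by rewrite -ltrBrDr distrC.
Qed.

Lemma mero_is_derive (f : K -> K) : mero f ->
  \forall t \near (0 : K)^', is_derive (t : K) (1 : K) f (derive1 f t).
Proof.
move=> mf; have [u [m [ua uE]]] : exists u (m : int), analytic_at0 u /\
    \forall t \near (0 : K)^', f t = 0 + u t * t ^ m.
  case: mf => [[g ga gE]|[m [u [ua _ uE]]]]; [exists g, 0|exists u, m]; split=> //.
    by apply: filterS gE => t ->; rewrite add0r expr0z mulr1.
  by apply: filterS uE => t ->; rewrite add0r.
have [v _ h] := order_is_derive Kc ua uE.
by apply: filterS h => t ht; rewrite (is_derive1 ht).
Qed.

Lemma cvg_pow (f : K -> K) (t : K) n : f s @[s --> t^'] --> f t ->
  f s ^+ n @[s --> t^'] --> f t ^+ n.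
Proof.
move=> cf; elim: n => [|n IH]; first by rewrite expr0; exact: cvg_cst.
by rewrite exprS; under eq_fun do rewrite exprS; exact: cvgM.
Qed.

Lemma cvg_sum_seq (I : Type) (l : seq I) (f : I -> K -> K) (t : K) :
  (forall i, f i s @[s --> t^'] --> f i t) ->
  \sum_(i <- l) f i s @[s --> t^'] --> \sum_(i <- l) f i t.
Proof.
move=> cf; elim: l => [|i l IH].
  by rewrite big_nil; under eq_fun do rewrite big_nil; exact: cvg_cst.
by rewrite big_cons; under eq_fun do rewrite big_cons; exact: cvgD.
Qed.

Variables (croot : forall a : K, exists y, y ^+ 3 = a).
Variables (om : K) (omE : om ^+ 2 + om + 1 = 0).
Variables (r s : nat) (b : 'I_(s + r) -> K).
Hypotheses (r0 : (0 < r)%N) (rs : (r < s)%N) (rs3 : (r != s %[mod 3])%N).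
Hypothesis b_inj : injective b.
Variables (phi : nat -> monom) (phiB : hat_basis r s phi).
Variable nuII : 'I_(genus r s) -> pt K -> K.
Hypothesis nuII_rel : second_kind_relation b phi nuII.

Let p := k_r b.
Let q := k_s b.
Let W := Omega b phi nuII.

Lemma generic_diag o gam : surface b o -> local_coord b o gam ->
  \forall t \near (0 : K)^', \forall u \near t^', generic b (gam u) (gam t).
Proof.
move=> so lg; have [cg [mg _]] := local_pack Kc b_inj so lg.
have [m odx] := mp_dx mg; have dxn := order_neq0 Kc odx.
have dx := mero_is_derive (mp_x mg); have cg2 := near0'_near cg.
near=> t.
have [ct yt] : curve b (gam t) /\ yr (gam t) * ys (gam t) != 0 by near: t.
have l0 : derive1 (@xc K \o gam) t != 0 by near: t.
have /is_derive_slope sl : is_derive (t : K) (1 : K) (@xc K \o gam) (derive1 (@xc K \o gam) t) by near: t.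
have h1 : \forall u \near t^', (xc (gam u) - xc (gam t)) / (u - t) != 0 by exact: cvgr_neq0 sl l0.
have h2 : \forall u \near t^', curve b (gam u) /\ yr (gam u) * ys (gam u) != 0 by near: t.
near=> u.
have [cu yu] : curve b (gam u) /\ yr (gam u) * ys (gam u) != 0 by near: u.
split=> //; have : (xc (gam u) - xc (gam t)) / (u - t) != 0 by near: u.
by apply: contra_neq => ->; rewrite subrr mul0r.
Unshelve. all: by end_near. Qed.

Lemma Omega_diag o gam (k : K * K -> K) : surface b o -> local_coord b o gam ->
  analytic2_at0 k -> (\forall z \near ((0, 0) : K * K), z.1 != 0 -> z.2 != 0 ->
    generic b (gam z.1) (gam z.2) -> (z.1 - z.2) ^+ 2 * pullback2 W gam gam z = k z) ->
  (\forall t \near (0 : K)^', k (t, t) = 1) /\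
  (\forall t \near (0 : K)^', \forall u \near t^', k (u, t) = k (t, u)).
Proof.
move=> so lg ak kE.
have gen := generic_diag so lg; have nz := near0'_near (near0'_neq0 K).
have kE1 := near00_near kE.
have kE2 : \forall t \near (0 : K)^', \forall u \near t^', t != 0 -> u != 0 ->
    generic b (gam t) (gam u) -> (t - u) ^+ 2 * pullback2 W gam gam (t, u) = k (t, u).
  apply: (near00_near (A := fun z => z.2 != 0 -> z.1 != 0 -> generic b (gam z.2) (gam z.1) ->
    (z.2 - z.1) ^+ 2 * pullback2 W gam gam (z.2, z.1) = k (z.2, z.1))).
  have /near00P [e e0 h] := kE; apply/near00P; exists e => // z zx zy z2 z1 g.
  exact: (h (z.2, z.1)).
split; last first.
  near=> t; have t0 : t != 0 by near: t; exact: near0'_neq0.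
  have h1 : \forall u \near t^', generic b (gam u) (gam t) by near: t.
  have h2 : \forall u \near t^', u != 0 by near: t.
  have h3 : \forall u \near t^', t != 0 -> u != 0 ->
    generic b (gam t) (gam u) -> (t - u) ^+ 2 * pullback2 W gam gam (t, u) = k (t, u) by near: t.
  have h4 : \forall u \near t^', (u, t).1 != 0 -> (u, t).2 != 0 ->
    generic b (gam (u, t).1) (gam (u, t).2) ->
    ((u, t).1 - (u, t).2) ^+ 2 * pullback2 W gam gam (u, t) = k (u, t) by near: t.
  near=> u.
  have g : generic b (gam u) (gam t) by near: u.
  have u0 : u != 0 by near: u.
  have <- : (u - t) ^+ 2 * pullback2 W gam gam (u, t) = k (u, t) by apply: (near h4 u).
  have <- : (t - u) ^+ 2 * pullback2 W gam gam (t, u) = k (t, u).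
    by apply: (near h3 u) => //; exact: genericC.
  by rewrite /pullback2 /= /W (Omega_sym nuII_rel g); ring.
have [cg [mg _]] := local_pack Kc b_inj so lg.
have [m odx] := mp_dx mg; have dxn := order_neq0 Kc odx.
have Dx := mero_is_derive (mp_x mg).
have Dr := mero_is_derive (or_intror (mp_yr mg)).
have Ds := mero_is_derive (or_intror (mp_ys mg)).
have Ddx := mero_is_derive (or_intror (mp_dx mg)).
have /near0_near0' kc := an2_diag_cvg Kc ak.
near=> t; have t0 : t != 0 by near: t; exact: near0'_neq0.
have [ct yt] : curve b (gam t) /\ yr (gam t) * ys (gam t) != 0 by near: t.
have l0 : derive1 (@xc K \o gam) t != 0 by near: t.
have dx : is_derive (t : K) (1 : K) (@xc K \o gam) (derive1 (@xc K \o gam) t) by near: t.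
have dr : is_derive (t : K) (1 : K) (@yr K \o gam) (derive1 (@yr K \o gam) t) by near: t.
have ds : is_derive (t : K) (1 : K) (@ys K \o gam) (derive1 (@ys K \o gam) t) by near: t.
have ddx : is_derive (t : K) (1 : K) (derive1 (@xc K \o gam)) (derive1 (derive1 (@xc K \o gam)) t) by near: t.
have h1 : \forall u \near t^', generic b (gam u) (gam t) by near: t.
have h2 : \forall u \near t^', u != 0 by near: t.
have h4 : \forall u \near t^', (u, t).1 != 0 -> (u, t).2 != 0 ->
    generic b (gam (u, t).1) (gam (u, t).2) ->
    ((u, t).1 - (u, t).2) ^+ 2 * pullback2 W gam gam (u, t) = k (u, t) by near: t.
have kct : k (u, t) @[u --> t^'] --> k (t, t) by near: t.
have cx := is_derive_cvg dx; have cr := is_derive_cvg dr; have cs := is_derive_cvg ds.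
have cdx := is_derive_cvg ddx; have /is_derive_slope sl := dx.
move: (yt); rewrite mulf_eq0 negb_or => /andP [y1 y2].
pose c9 := 9 * yr (gam t) * ys (gam t).
have c90 : c9 != 0 by rewrite !mulf_neq0 ?pnatr_eq0.
have cy : c9 * (yr (gam u) * ys (gam u)) @[u --> t^'] --> c9 * (yr (gam t) * ys (gam t)).
  by apply: cvgMr; apply: cvgM.
pose A := 2 * q^`().[xc (gam t)] * p.[xc (gam t)] + q.[xc (gam t)] * p^`().[xc (gam t)].
pose B := 2 * p^`().[xc (gam t)] * q.[xc (gam t)] + p.[xc (gam t)] * q^`().[xc (gam t)].
have cG : Gnum p q (gam u) (gam t) @[u --> t^'] --> Gnum p q (gam t) (gam t).
  rewrite /Gnum; apply: cvgD.
    apply: cvgM; first by apply: cvgB => //; exact: cvg_cst.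
    by apply: cvgD; apply: cvgMl; apply: cvgMl.
  apply: cvgMr; apply: cvgD; last exact: cvgMl.
  by apply: cvgD; [exact: cvgM|exact: cvgMl].
have GE : Gnum p q (gam t) (gam t) = c9 * (yr (gam t) * ys (gam t)).
  by rewrite /Gnum subrr mul0r add0r /c9; ring.
have cH : \sum_(i < genus r s) nuI phi i (gam u) * nuII i (gam t) @[u --> t^'] -->
    \sum_(i < genus r s) nuI phi i (gam t) * nuII i (gam t).
  refine (@cvg_sum_seq _ (index_enum 'I_(genus r s)) (fun i u => nuI phi i (gam u) * nuII i (gam t)) t _) => i.
  apply: cvgMl; rewrite /nuI /monom_eval; apply: cvgM.
    have px := @cvg_pow (@xc K \o gam) t (phi i).1.1 cx.
    have pr := @cvg_pow (@yr K \o gam) t (phi i).1.2 cr.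
    have ps := @cvg_pow (@ys K \o gam) t (phi i).2 cs.
    exact: (cvgM (cvgM px pr) ps).
  apply: cvgV; first by rewrite !mulf_neq0 ?pnatr_eq0.
  by apply: cvgM => //; apply: cvgMr.
pose dX := derive1 (@xc K \o gam).
pose S u := (xc (gam u) - xc (gam t)) / (u - t).
have cId : u - t @[u --> t^'] --> 0.
  by apply/cvg_dnbhsP => eps eps0; exists eps => // u ut _; rewrite subr0.
have L1 : (S u)^-1 * (S u)^-1 * (Gnum p q (gam u) (gam t) * (c9 * (yr (gam u) * ys (gam u)))^-1) *
   (dX u * dX t) @[u --> t^'] --> (dX t)^-1 * (dX t)^-1 * (Gnum p q (gam t) (gam t) *
   (c9 * (yr (gam t) * ys (gam t)))^-1) * (dX t * dX t).
  apply: cvgM; last exact: cvgMl.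
  apply: cvgM; first by apply: cvgM; exact: cvgV.
  apply: cvgM => //; apply: cvgV => //; exact: mulf_neq0.
have L2 : (u - t) * (u - t) * (\sum_(i < genus r s) nuI phi i (gam u) * nuII i (gam t)) *
   (dX u * dX t) @[u --> t^'] --> 0 * 0 * (\sum_(i < genus r s) nuI phi i (gam t) * nuII i (gam t)) *
   (dX t * dX t).
  by apply: cvgM; [apply: cvgM => //; apply: cvgM|exact: cvgMl].
pose proof (cvgD L1 L2) as L.
have lim1 : k (u, t) @[u --> t^'] --> (1 : K).
  have -> : (1 : K) = (dX t)^-1 * (dX t)^-1 * (Gnum p q (gam t) (gam t) *
   (c9 * (yr (gam t) * ys (gam t)))^-1) * (dX t * dX t) + 0 * 0 *
   (\sum_(i < genus r s) nuI phi i (gam t) * nuII i (gam t)) * (dX t * dX t).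
    rewrite GE mulfV ?mulf_neq0//; rewrite !mul0r addr0 mulr1 mulrACA mulVf// mulr1//.
  apply: (cvg_near_eq _ L).
  near=> u.
  have g : generic b (gam u) (gam t) by near: u.
  have u0 : u != 0 by near: u.
  have <- : (u - t) ^+ 2 * pullback2 W gam gam (u, t) = k (u, t) by apply: (near h4 u).
  rewrite /pullback2 /= /W (Omega_generic croot omE phi nuII g).
  have [_ _ yu _ xut] := g; move: yu; rewrite mulf_eq0 negb_or => /andP [v1 v2].
  have ut : u - t != 0.
    by rewrite subr_eq0; apply: contra_neq xut => ->.
  rewrite -/p -/q /S /c9 -/dX; set H := \sum_(i < _) _; set G := Gnum _ _ _ _.
  have xn : xc (gam u) - xc (gam t) != 0 by rewrite subr_eq0.
  by field; rewrite y1 y2 v1 v2 ut xn.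
by apply: cvg_unique kct lim1; exact: norm_hausdorff.
Unshelve. all: by end_near. Qed.

Lemma Omega_fundamental : fundamental_second_kind b W.
Proof.
split.
- by move=> P Q; exact: Omega_sym.
- move=> o o' gam del so so' ne lg ld.
  have dp := double_pole_local Kc b_inj so so' lg ld ne.
  have hc : forall x : K, hol (fun _ : K => 1 : K) by move=> _; exact: hol_cst.
  have [k ak kE] := Omega_analytic Kc croot omE r0 rs rs3 b_inj phiB nuII_rel so so' lg ld
    (an2_cst Kc 1) hc hc dp.
  exists k; split=> //; near=> z => z1 z2 g; rewrite add0r.
  by rewrite -[LHS]mul1r; apply: (near kE z).
- move=> o gam so lg.
  have dp := double_pole_diag Kc r0 rs rs3 b_inj so lg.
  have h1 (y : K) : hol (fun x : K => (x - y) ^+ 2).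
    by apply: (holX Kc); apply: (holB Kc); [exact: hol_an1 (an1_id Kc)|exact: hol_cst].
  have h2 (x : K) : hol (fun y : K => (x - y) ^+ 2).
    by apply: (holX Kc); apply: (holB Kc); [exact: hol_cst|exact: hol_an1 (an1_id Kc)].
  have [k ak kE] := Omega_analytic Kc croot omE r0 rs rs3 b_inj phiB nuII_rel so so lg lg
    (an2X Kc 2 (an2_sub Kc)) h1 h2 dp.
  have [k1 ksym] := Omega_diag so lg ak kE.
  have [h ah hE] := an2_diag_expand Kc ak k1 ksym.
  exists h; split=> //; near=> z => z1 z2 g.
  have [_ _ _ _ xx] := g.
  have zz : z.1 - z.2 != 0 by rewrite subr_eq0; apply: contra_neq xx => ->.
  apply: (mulfI (expf_neq0 2 zz)).
  have -> : (z.1 - z.2) ^+ 2 * pullback2 W gam gam z = k z by apply: (near kE z).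
  have -> : k z = 1 + (z.1 - z.2) ^+ 2 * h z by near: z.
  by field.
Unshelve. all: by end_near. Qed.

End Fundamental.

(** * The numerator in the tensor square *)

Section TensorSquare.
Variable K : numFieldType.
Implicit Types (f g : pt K -> pt K -> K) (c : {poly {poly {poly K}}}) (p : {poly K}).

Definition in_tensor_square f := exists F, forall P Q, f P Q = tensor_eval F P Q.

Lemma coord_evalM c c' (P : pt K) : coord_eval (c * c') P = coord_eval c P * coord_eval c' P.
Proof. by rewrite /coord_eval !hornerM. Qed.

Lemma coord_evalC (a : K) (P : pt K) : coord_eval a%:P%:P%:P P = a.
Proof. by rewrite /coord_eval !hornerC. Qed.

Lemma tensorP f c c' : (forall P Q, f P Q = coord_eval c P * coord_eval c' Q) ->
  in_tensor_square f.
Proof.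
by move=> fE; exists [:: (c, c')] => P Q; rewrite fE /tensor_eval big_seq1.
Qed.

Lemma tensorl f c : (forall P Q, f P Q = coord_eval c P) -> in_tensor_square f.
Proof.
by move=> fE; apply: (@tensorP f c 1%:P%:P%:P) => P Q; rewrite fE coord_evalC mulr1.
Qed.

Lemma tensorr f c : (forall P Q, f P Q = coord_eval c Q) -> in_tensor_square f.
Proof.
by move=> fE; apply: (@tensorP f 1%:P%:P%:P c) => P Q; rewrite fE coord_evalC mul1r.
Qed.

Lemma tensor_cst (a : K) : in_tensor_square (fun _ _ => a).
Proof. by apply: (@tensorl _ a%:P%:P%:P) => P Q; rewrite coord_evalC. Qed.

Lemma tensorD f g : in_tensor_square f -> in_tensor_square g ->
  in_tensor_square (fun P Q => f P Q + g P Q).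
Proof.
move=> [F fE] [G gE]; exists (F ++ G) => P Q.
by rewrite fE gE /tensor_eval big_cat.
Qed.

Lemma tensorM f g : in_tensor_square f -> in_tensor_square g ->
  in_tensor_square (fun P Q => f P Q * g P Q).
Proof.
move=> [F fE] [G gE].
exists [seq (u.1 * v.1, u.2 * v.2) | u <- F, v <- G] => P Q.
rewrite fE gE /tensor_eval big_allpairs_dep mulr_suml; apply: eq_bigr => u _.
rewrite mulr_sumr; apply: eq_bigr => v _.
by rewrite /= !coord_evalM mulrACA.
Qed.

Lemma tensorX f n : in_tensor_square f -> in_tensor_square (fun P Q => f P Q ^+ n).
Proof.
move=> tf; elim: n => [|n [F IH]]; first exact: tensor_cst.
have [G GE] : in_tensor_square (fun P Q => f P Q * f P Q ^+ n).
  by apply: tensorM => //; exists F.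
by exists G => P Q; rewrite exprS GE.
Qed.

Lemma tensor_sum (I : Type) (l : seq I) (f : I -> pt K -> pt K -> K) :
  (forall i, in_tensor_square (f i)) ->
  in_tensor_square (fun P Q => \sum_(i <- l) f i P Q).
Proof.
move=> tf; elim: l => [|i l [F IH]].
  by exists [::] => P Q; rewrite /tensor_eval !big_nil.
have [G GE] : in_tensor_square (fun P Q => f i P Q + \sum_(i <- l) f i P Q).
  by apply: tensorD => //; exists F.
by exists G => P Q; rewrite big_cons GE.
Qed.

Lemma coord_eval_xc p (P : pt K) : coord_eval p%:P%:P P = p.[xc P].
Proof. by rewrite /coord_eval !hornerC. Qed.

Lemma coord_eval_yr (P : pt K) : coord_eval 'X%:P P = yr P.
Proof. by rewrite /coord_eval hornerC hornerX hornerC. Qed.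

Lemma coord_eval_ys (P : pt K) : coord_eval 'X P = ys P.
Proof. by rewrite /coord_eval hornerX !hornerC. Qed.

Lemma tensor_xl p : in_tensor_square (fun P Q => p.[xc P]).
Proof. by apply: (@tensorl _ p%:P%:P) => P Q; rewrite coord_eval_xc. Qed.

Lemma tensor_xr p : in_tensor_square (fun P Q => p.[xc Q]).
Proof. by apply: (@tensorr _ p%:P%:P) => P Q; rewrite coord_eval_xc. Qed.

Lemma tensor_yl :
  in_tensor_square (fun P Q => yr P) /\ in_tensor_square (fun P Q => ys P).
Proof.
by split; [apply: (@tensorl _ 'X%:P) => P Q; rewrite coord_eval_yr
          |apply: (@tensorl _ 'X) => P Q; rewrite coord_eval_ys].
Qed.

Lemma tensor_yr :
  in_tensor_square (fun P Q => yr Q) /\ in_tensor_square (fun P Q => ys Q).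
Proof.
by split; [apply: (@tensorr _ 'X%:P) => P Q; rewrite coord_eval_yr
          |apply: (@tensorr _ 'X) => P Q; rewrite coord_eval_ys].
Qed.

Lemma tensor_xB : in_tensor_square (fun P Q => xc P - xc Q).
Proof.
have [F FE] := tensorD (tensor_xl 'X) (tensor_xr (- 'X)).
by exists F => P Q; rewrite -FE hornerN !hornerX.
Qed.

Lemma tensor_monom (m : monom) : in_tensor_square (fun P Q => monom_eval m P).
Proof.
have [F FE] := tensorM (tensorM (tensor_xl 'X^(m.1.1)) (tensorX m.1.2 tensor_yl.1))
  (tensorX m.2 tensor_yl.2).
by exists F => P Q; rewrite -FE hornerXn.
Qed.

Lemma tensor_Gnum p q : in_tensor_square (Gnum p q).
Proof.
have [[yrl ysl] [yrr ysr]] := (tensor_yl, tensor_yr).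
have T p' q' := tensorD (tensorM (tensorM (tensor_cst 2) (tensor_xr q'^`())) (tensor_xr p'))
  (tensorM (tensor_xr q') (tensor_xr p'^`())).
apply: tensorD; apply: tensorM.
- exact: tensor_xB.
- by apply: tensorD; apply: tensorM; [exact: tensorM|exact: T|exact: tensorM|exact: T].
- by apply: tensorM; [exact: tensor_cst|exact: tensorM].
- by apply: tensorD; [apply: tensorD; exact: tensorM|exact: tensorM].
Qed.

End TensorSquare.

Section OmegaTensor.
Variables (K : numFieldType).
Variables (croot : forall a : K, exists y, y ^+ 3 = a).
Variables (om : K) (omE : om ^+ 2 + om + 1 = 0).
Variables (r s : nat) (b : 'I_(s + r) -> K).
Hypotheses (r0 : (0 < r)%N) (rs : (r < s)%N) (rs3 : (r != s %[mod 3])%N).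
Variables (phi : nat -> monom) (phiB : hat_basis r s phi).
Variable nuII : 'I_(genus r s) -> pt K -> K.
Hypothesis nuII_rel : second_kind_relation b phi nuII.

Lemma Omega_tensor :
  exists F : seq ({poly {poly {poly K}}} * {poly {poly {poly K}}}),
    forall P Q : pt K, generic b P Q ->
      Omega b phi nuII P Q = tensor_eval F P Q /
        (9 * (xc P - xc Q) ^+ 2 * yr P * ys P * yr Q * ys Q).
Proof.
have [U [V UV]] := nuII_forms croot omE r0 rs rs3 phiB nuII_rel.
have [yrr ysr] := @tensor_yr K.
have [F FE] := tensorD (tensor_Gnum (k_r b) (k_s b))
  (tensorM (tensorM (tensor_cst 3) (tensorX 2 (tensor_xB K)))
    (tensor_sum (index_enum 'I_(genus r s)) (fun i => tensorM (tensor_monom K (phi i))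
      (tensorD (tensorM (tensor_xr (U i)) yrr) (tensorM (tensor_xr (V i)) ysr))))).
exists F => P Q g; rewrite -FE (Omega_generic croot omE phi nuII g).
have [_ cQ yP yQ xPQ] := g; cbv beta; rewrite [RHS]mulrDl; congr (_ + _).
have x0 : xc P - xc Q != 0 by rewrite subr_eq0.
rewrite mulr_sumr mulr_suml; apply: eq_bigr => i _; rewrite (UV i Q cQ yQ) /nuI.
move: yP yQ; rewrite !mulf_eq0 !negb_or => /andP [a1 a2] /andP [b1 b2].
by field; rewrite x0 a1 a2 b1 b2.
Qed.

End OmegaTensor.

Lemma complex_cube_root (R : realType) (a : R[i]) : exists y, y ^+ 3 = a.
Proof.
have [y yE] := @GRing.solve_monicpoly R[i] 3 (fun i => if i == 0 then a else 0) isT.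
by exists y; rewrite yE !big_ord_recl big_ord0 /= expr0; ring.
Qed.

Lemma complex_cyclotomic3 (R : realType) : exists om : R[i], om ^+ 2 + om + 1 = 0.
Proof.
have [y yE] := @GRing.solve_monicpoly R[i] 2 (fun _ => -1) isT.
by exists y; rewrite yE !big_ord_recl big_ord0 /=; ring.
Qed.

Theorem corollary3p15 (R : realType) (r s : nat)
    (r_gt0 : (0 < r)%N) (r_lt_s : (r < s)%N)
    (r_neq_s_mod3 : (r != s %[mod 3])%N)
    (b : 'I_(s + r) -> R[i]) (b_inj : injective b)
    (phi : nat -> monom) (phi_basis : hat_basis r s phi)
    (nuII : 'I_(genus r s) -> pt R[i] -> R[i])
    (nuII_second_kind : forall i, second_kind b (nuII i))
    (nuII_only_pole : forall i P,
       curve b P -> holomorphic_at b (nuII i) (Some P))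
    (nuII_rel : second_kind_relation b phi nuII) :
  (forall P1 P2 : pt R[i], curve b P1 -> curve b P2 -> P1 <> P2 ->
     [/\ third_kind b (Pi3 P1 P2),
         forall p, surface b p -> p <> Some P1 -> p <> Some P2 ->
           holomorphic_at b (Pi3 P1 P2) p,
         simple_pole_at b (Pi3 P1 P2) (Some P1) 1 &
         simple_pole_at b (Pi3 P1 P2) (Some P2) (-1)])
  /\
  fundamental_second_kind b (Omega b phi nuII)
  /\
  (exists F : seq ({poly {poly {poly R[i]}}} * {poly {poly {poly R[i]}}}),
     forall P1 P2 : pt R[i], generic b P1 P2 ->
       Omega b phi nuII P1 P2 =
       tensor_eval F P1 P2 /
         (9 * (xc P1 - xc P2) ^+ 2 * yr P1 * ys P1 * yr P2 * ys P2)).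
Proof.
have Kc := @abs_complete_complex R; have croot := @complex_cube_root R.
have [om omE] := complex_cyclotomic3 R.
split; first by move=> P1 P2; exact: Pi3_third_kind.
split; first exact: (Omega_fundamental Kc croot omE r_gt0 r_lt_s r_neq_s_mod3 b_inj phi_basis).
exact: (Omega_tensor croot omE r_gt0 r_lt_s r_neq_s_mod3 phi_basis).
Qed.
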